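(* Let $A$ be a unital associative algebraic algebra over an arbitrary field $\mathbb{F}$. If the group of units $A^\times$ is either solvable or bounded Engel, then $A$ satisfies a (nontrivial) polynomial identity.
   Context: $A^\times$ is the group of multiplicative units of $A$. An algebra is algebraic if each of its elements is algebraic over $\mathbb{F}$. For group elements, $(x,y)=x^{-1}y^{-1}xy$; a group is bounded Engel if, for some fixed $n\ge 1$, it satisfies the (left-normed) group identity $(x,y,\ldots,y)=1$ with $n$ occurrences of $y$. *)

(* Defs.v *)
From HB Require Import structures.
From mathcomp Require Import all_boot all_order all_algebra.
From mathcomp Require Import monalg.

Set Implicit Arguments.
Unset Strict Implicit.
Unset Printing Implicit Defensive.

Import GRing.Theory.
Local Open Scope ring_scope.

(* MathComp's [{unit R}] is only available for finite rings, hence this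
   [groupType] of the units of an arbitrary [unitRingType]. *)
Section Units.
Variable R : unitRingType.

Record units : predArgType :=
  Units { units_val : R; units_valP : units_val \is a GRing.unit }.

HB.instance Definition _ := [isSub for units_val].
HB.instance Definition _ := [Choice of units by <:].

Definition units_one : units := Units (@unitr1 R).

Lemma units_inv_proof (u : units) : (units_val u)^-1 \is a GRing.unit.
Proof. by rewrite unitrV units_valP. Qed.
Definition units_inv (u : units) : units := Units (units_inv_proof u).

Lemma units_mul_proof (u v : units) :
  units_val u * units_val v \is a GRing.unit.
Proof. by rewrite unitrMr units_valP. Qed.
Definition units_mul (u v : units) : units := Units (units_mul_proof u v).

Lemma units_mulA : associative units_mul.
Proof. by move=> u v w; apply: val_inj; apply: mulrA. Qed.
Lemma units_mul1u : left_id units_one units_mul.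
Proof. by move=> u; apply: val_inj; apply: mul1r. Qed.
Lemma units_mulu1 : right_id units_one units_mul.
Proof. by move=> u; apply: val_inj; apply: mulr1. Qed.
Lemma units_mulVu : left_inverse units_one units_inv units_mul.
Proof. by move=> u; apply: val_inj; apply: mulVr; apply: units_valP. Qed.
Lemma units_muluV : right_inverse units_one units_inv units_mul.
Proof. by move=> u; apply: val_inj; apply: mulrV; apply: units_valP. Qed.

HB.instance Definition _ := isGroup.Build units
  units_mulA units_mul1u units_mulu1 units_mulVu units_muluV.

End Units.

Section Groups.
Variable G : groupType.

Inductive generated (S : G -> Prop) : G -> Prop :=
  | generated_in x of S x : generated S x
  | generated_1 : generated S 1%g
  | generated_M x y of generated S x & generated S y : generated S (x * y)%g
  | generated_V x of generated S x : generated S (x^-1)%g.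

Fixpoint derived_series (n : nat) : G -> Prop :=
  if n is m.+1 then
    generated (fun z : G => exists x y : G,
      [/\ derived_series m x, derived_series m y & z = [~ x, y]%g])
  else fun=> True.

Definition solvable_group : Prop :=
  exists n : nat, forall x : G, derived_series n x -> x = 1%g.

(* [~ x, y] is x^-1 * y^-1 * x * y; the iterate is [~ x, y, ..., y],
   with n occurrences of y. *)
Definition bounded_engel : Prop :=
  exists2 n : nat, (0 < n)%N &
    forall x y : G, iter n (fun z : G => [~ z, y]%g) x = 1%g.

End Groups.

Section Algebras.
Variables (F : fieldType) (A : algType F).

Definition algebraic_elt (a : A) : Prop :=
  exists2 p : {poly F}, p != 0 & horner_alg a p = 0.

Definition algebraic_algebra : Prop := forall a : A, algebraic_elt a.

(* Noncommutative polynomials in countably many indeterminates: the monoid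
   algebra over F of the free monoid on nat. *)
Definition eval_word (v : nat -> A) (w : {fmonom nat}) : A :=
  \prod_(i <- (w : seq nat)) v i.

Definition eval_nc (v : nat -> A) (f : {malg F[{fmonom nat}]}) : A :=
  mmap (in_alg A) (eval_word v) f.

Definition satisfies_PI : Prop :=
  exists2 f : {malg F[{fmonom nat}]}, f != 0 &
    forall v : nat -> A, eval_nc v f = 0.

End Algebras.

(* Main.v *)
Require Import Defs.
From HB Require Import structures.
From mathcomp Require Import all_boot all_order all_algebra.
From mathcomp Require Import boolp classical_sets functions.
From mathcomp Require Import monalg.
From mathcomp Require Import all_fingroup all_field.
Set Implicit Arguments.
Unset Strict Implicit.
Unset Printing Implicit Defensive.
Import GRing.Theory.
Local Open Scope ring_scope.

(* Over an infinite field, 1 + l x is invertible for all but finitely many l, and a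
   group commutator of such elements starts with the Lie commutator of their leading
   terms; hence the group law forces the corresponding Lie polynomial to vanish on A.

   Over a finite field A is periodic, and units lift along quotients, so the law
   passes to every prime quotient P. In the Engel case P is commutative, hence x and
   y in [A, A] generate a nilpotent ring S. Let I be a maximal commutative ideal of S;
   for a large power q of p, x^q and y^q centralize I, and [x^q, y^q] lies in I,
   so that [[x^q, y^q], x^q] = 0. In the solvable case P is commutative or
   M_2({0, 1, -1}), hence satisfies [[a, b]^2, c] = 0. The values of this polynomial
   lie in every prime ideal, and in a prime ring an ideal J with 1 + J a solvable
   group of units is central; thus a power of [f, f'] vanishes on A, for two
   instances f and f' of that polynomial with disjoint variables. *)

(** The structure of a prime quotient P rests on one dichotomy. For r and s of square zero, r s is
    nilpotent or, P being periodic, has a nonzero idempotent power, which yields 2 x 2 matrix units.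
    In the nilpotent case the group law bounds the index of nilpotency, and Levitzki's lemma turns
    the bound into vanishing. The Engel law excludes matrix units; solvability excludes 3 x 3 ones,
    and in the 2 x 2 case all scalars other than 0, 1 and -1. Without nontrivial idempotents P
    becomes a division ring with units of finite order, which is commutative by Wedderburn's
    theorem. Since A has no bounded degree of algebraicity, uniformity is the obstacle. In the Engel
    case, an ideal maximal among those that omit a word in x and y of every length is prime; its
    quotient being commutative, the commutators x and y die in it, so all words of some length N
    vanish already in A. This N depends on x and y and must not enter the identity: the ideal I and
    the exponent q, which depends on n and p only, remove it. *)

(** * Rewriting in noncommutative rings *)

Inductive ncexp :=
  | NCvar of nat | NC0 | NC1 | NCadd of ncexp & ncexp | NCopp of ncexp
  | NCmul of ncexp & ncexp | NCexp of ncexp & nat | NCmuln of ncexp & nat.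

(* A polynomial is a list of signed words; [true] is the sign minus. *)
Definition ncpoly := seq (bool * seq nat).

Definition ncp_opp (p : ncpoly) : ncpoly := [seq (~~ m.1, m.2) | m <- p].
Definition ncp_mul (p q : ncpoly) : ncpoly :=
  [seq (m.1 (+) n.1, m.2 ++ n.2) | m <- p, n <- q].

Fixpoint ncnorm (e : ncexp) : ncpoly :=
  match e with
  | NCvar i => [:: (false, [:: i])]
  | NC0 => [::]
  | NC1 => [:: (false, [::])]
  | NCadd a b => ncnorm a ++ ncnorm b
  | NCopp a => ncp_opp (ncnorm a)
  | NCmul a b => ncp_mul (ncnorm a) (ncnorm b)
  | NCexp a n => iter n (ncp_mul (ncnorm a)) [:: (false, [::])]
  | NCmuln a n => iter n (cat (ncnorm a)) [::]
  end.

Fixpoint nc_strip (l w : seq nat) : option (seq nat) :=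
  match l, w with
  | [::], _ => Some w
  | i :: l', j :: w' => if i == j then nc_strip l' w' else None
  | _, _ => None
  end.

Definition ncrule := (seq nat * ncpoly)%type.

Fixpoint nc_head (rs : seq ncrule) (w : seq nat) : option ncpoly :=
  if rs is r :: rs' then
    if nc_strip r.1 w is Some s then Some (ncp_mul r.2 [:: (false, s)])
    else nc_head rs' w
  else None.

Fixpoint nc_step (rs : seq ncrule) (w : seq nat) : option ncpoly :=
  if nc_head rs w is Some p then Some p else
  if w is i :: w' then
    omap (ncp_mul [:: (false, [:: i])]) (nc_step rs w')
  else None.

Fixpoint nc_reduce (fuel : nat) (rs : seq ncrule) (p : ncpoly) : ncpoly :=
  if fuel is k.+1 then
    flatten [seq (if nc_step rs m.2 is Some q
                  then nc_reduce k rs (ncp_mul [:: (m.1, [::])] q)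
                  else [:: m]) | m <- p]
  else p.

Definition nc_rules (es : seq (ncexp * ncexp)) : seq ncrule :=
  pmap (fun e => if ncnorm e.1 is [:: (false, w)]
                 then Some (w, ncnorm e.2) else None) es.

(** A sound but incomplete test: the fuel 60 only bounds the depth of rewriting, and every
    intermediate result has the same value. Comparing positive and negative words as multisets
    replaces the collection of like terms. *)
Definition nc_check es (a b : ncexp) : bool :=
  let p := nc_reduce 60 (nc_rules es) (ncnorm (NCadd a (NCopp b))) in
  perm_eq [seq m.2 | m <- p & ~~ m.1] [seq m.2 | m <- p & m.1].

Section NCSound.
Variables (R : pzRingType) (v : seq R).

Fixpoint nceval (e : ncexp) : R :=
  match e with
  | NCvar i => nth 0 v i
  | NC0 => 0
  | NC1 => 1
  | NCadd a b => nceval a + nceval b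
  | NCopp a => - nceval a
  | NCmul a b => nceval a * nceval b
  | NCexp a n => nceval a ^+ n
  | NCmuln a n => nceval a *+ n
  end.

Definition ncw (w : seq nat) : R := \prod_(i <- w) nth 0 v i.
Definition ncm (m : bool * seq nat) : R := if m.1 then - ncw m.2 else ncw m.2.
Definition ncp (p : ncpoly) : R := \sum_(m <- p) ncm m.

Lemma ncw_cat w1 w2 : ncw (w1 ++ w2) = ncw w1 * ncw w2.
Proof. exact: big_cat. Qed.

Lemma ncp_cat p q : ncp (p ++ q) = ncp p + ncp q.
Proof. exact: big_cat. Qed.

Lemma ncp_oppE p : ncp (ncp_opp p) = - ncp p.
Proof.
rewrite /ncp /ncp_opp big_map -sumrN; apply: eq_bigr => -[[] w] _ //=.
by rewrite /ncm /= opprK.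
Qed.

Lemma ncp_mulE p q : ncp (ncp_mul p q) = ncp p * ncp q.
Proof.
rewrite /ncp /ncp_mul big_allpairs_dep mulr_suml; apply: eq_bigr => m _ /=.
rewrite mulr_sumr; apply: eq_bigr => n _ /=; rewrite /ncm /= ncw_cat.
by case: m n => [[] ?] [[] ?] /=; rewrite ?(mulrN, mulNr, opprK).
Qed.

Lemma ncp_mono w : ncp [:: (false, w)] = ncw w.
Proof. by rewrite /ncp big_seq1. Qed.

Lemma ncnormE e : ncp (ncnorm e) = nceval e.
Proof.
elim: e => [i|||a IHa b IHb|a IHa|a IHa b IHb|a IHa n|a IHa n] /=.
- by rewrite ncp_mono /ncw big_seq1.
- by rewrite /ncp big_nil.
- by rewrite ncp_mono /ncw big_nil.
- by rewrite ncp_cat IHa IHb.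
- by rewrite ncp_oppE IHa.
- by rewrite ncp_mulE IHa IHb.
- elim: n => [|n IHn] /=; first by rewrite ncp_mono /ncw big_nil.
  by rewrite ncp_mulE IHn IHa exprS.
- elim: n => [|n IHn] /=; first by rewrite /ncp big_nil.
  by rewrite ncp_cat IHn IHa mulrS.
Qed.

Lemma nc_stripP l w s : nc_strip l w = Some s -> w = l ++ s.
Proof.
elim: l w => [|i l IH] [|j w] //=; first by case=> <-.
  by case=> <-.
by case: eqP => // -> /IH ->.
Qed.

Lemma nc_stepE rs w p :
  (forall r, r \in rs -> ncw r.1 = ncp r.2) ->
  nc_step rs w = Some p -> ncp p = ncw w.
Proof.
move=> rsP; have headP w' q : nc_head rs w' = Some q -> ncp q = ncw w'.
  elim: rs rsP => //= r rs IH rsP; case E: nc_strip => [s|] => [[<-]|].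
    by rewrite ncp_mulE ncp_mono (nc_stripP E) ncw_cat rsP ?mem_head.
  by apply: IH => r' r'rs; apply: rsP; rewrite inE r'rs orbT.
elim: w p => [|i w IH] p /=; case E: nc_head => [q|] //=.
- by case=> <-; apply: headP.
- by case=> <-; apply: headP.
case E': nc_step => [q|] //= [<-].
by rewrite ncp_mulE ncp_mono (IH _ E') -ncw_cat.
Qed.

Lemma nc_reduceE k rs p :
  (forall r, r \in rs -> ncw r.1 = ncp r.2) -> ncp (nc_reduce k rs p) = ncp p.
Proof.
move=> rsP; elim: k p => //= k IH p; rewrite /ncp.
elim: p => [|m p IHp] /=; first by rewrite !big_nil.
rewrite big_cat big_cons /= {}IHp; congr (_ + _).
case E: nc_step => [q|]; last by rewrite big_seq1.
rewrite -/(ncp _) IH ncp_mulE (nc_stepE rsP E).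
by case: m E => [[] w] E; rewrite /ncp big_seq1 /ncm /ncw big_nil ?mulNr mul1r.
Qed.

Fixpoint nc_hyps (es : seq (ncexp * ncexp)) : Prop :=
  if es is e :: es' then nceval e.1 = nceval e.2 /\ nc_hyps es' else True.

Lemma nc_sound es a b : nc_hyps es -> nc_check es a b -> nceval a = nceval b.
Proof.
move=> esP; rewrite /nc_check; set p := nc_reduce _ _ _ => pP.
have rsP r : r \in nc_rules es -> ncw r.1 = ncp r.2.
  elim: es esP {p pP} => //= -[e1 e2] es IH [/= e12 esP].
  rewrite /nc_rules /=; case E: (ncnorm e1) => [|[[] w] [|? ?]] //=; do ?exact: IH.
  rewrite inE => /orP[/eqP -> /=|]; last exact: IH.
  by rewrite ncnormE -e12 -ncnormE E ncp_mono.
apply/eqP; rewrite -subr_eq0 -/(nceval (NCadd a (NCopp b))) -ncnormE.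
rewrite -(nc_reduceE 60 _ rsP) -/p /ncp (bigID (fun m => ~~ m.1)) /=.
have -> : \sum_(m <- p | ~~ m.1) ncm m =
          \sum_(w <- [seq m.2 | m <- p & ~~ m.1]) ncw w.
  by rewrite big_map big_filter; apply: eq_bigr => -[[] w].
have -> : \sum_(m <- p | ~~ ~~ m.1) ncm m =
          - \sum_(w <- [seq m.2 | m <- p & m.1]) ncw w.
  rewrite big_map -sumrN big_filter.
  by apply: eq_big => -[[] w].
by rewrite (perm_big _ pP) subrr.
Qed.

End NCSound.

(* Atoms are compared up to conversion: the same term can occur with different
   paths in the hierarchy of structures. *)
Ltac nc_idx x l :=
  match l with
  | ?y :: _ => let _ := match goal with _ => unify x y end in constr:(0%N)
  | _ :: ?l' => let n := nc_idx x l' in constr:(S n)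
  end.
Ltac nc_isnat n :=
  lazymatch n with O => idtac | S ?m => nc_isnat m | _ => fail end.
Ltac nc_atoms t l :=
  lazymatch t with
  | @GRing.add _ ?a ?b => let l' := nc_atoms a l in nc_atoms b l'
  | @GRing.opp _ ?a => nc_atoms a l
  | @GRing.mul _ ?a ?b => let l' := nc_atoms a l in nc_atoms b l'
  | @GRing.zero _ => l
  | @GRing.one _ => l
  | _ =>
    match t with
    | @GRing.exp _ ?a ?n => let _ := match goal with _ => nc_isnat n end in nc_atoms a l
    | @GRing.natmul _ ?a ?n => let _ := match goal with _ => nc_isnat n end in nc_atoms a l
    | _ => let _ := nc_idx t l in l
    | _ => constr:(t :: l)
    end
  end.
Ltac nc_reify t l :=
  lazymatch t with
  | @GRing.add _ ?a ?b => let x := nc_reify a l in let y := nc_reify b l in constr:(NCadd x y)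
  | @GRing.opp _ ?a => let x := nc_reify a l in constr:(NCopp x)
  | @GRing.mul _ ?a ?b => let x := nc_reify a l in let y := nc_reify b l in constr:(NCmul x y)
  | @GRing.zero _ => constr:(NC0)
  | @GRing.one _ => constr:(NC1)
  | _ =>
    match t with
    | @GRing.exp _ ?a ?n => let _ := match goal with _ => nc_isnat n end in
        let x := nc_reify a l in constr:(NCexp x n)
    | @GRing.natmul _ ?a ?n => let _ := match goal with _ => nc_isnat n end in
        let x := nc_reify a l in constr:(NCmuln x n)
    | _ => let n := nc_idx t l in constr:(NCvar n)
    end
  end.
Ltac nc_hatoms hs l :=
  lazymatch hs with
  | (?hs', ?h) =>
    let l' := nc_hatoms hs' l in
    lazymatch type of h with ?a = ?b => let l'' := nc_atoms a l' in nc_atoms b l'' end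
  | tt => l
  end.
Ltac nc_hreify hs l acc :=
  lazymatch hs with
  | (?hs', ?h) =>
    lazymatch type of h with
    | ?a = ?b => let x := nc_reify a l in let y := nc_reify b l in
       nc_hreify hs' l constr:((x, y) :: acc)
    end
  | tt => acc
  end.
Ltac nc_hproof hs acc :=
  lazymatch hs with
  | (?hs', ?h) => nc_hproof hs' constr:(conj h acc)
  | tt => acc
  end.
(* [nc (tt, h1, .., hn)] proves an equation in a noncommutative ring, using the
   equations [hi], whose left-hand sides are monomials, as rewrite rules. *)
Ltac nc hs :=
  lazymatch goal with
  | |- @eq ?T ?a ?b =>
    let R := lazymatch a with _ => constr:(T : pzRingType) end in
    let l0 := constr:(@nil T) in
    let l1 := nc_atoms a l0 in
    let l2 := nc_atoms b l1 in
    let l := nc_hatoms hs l2 in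
    let x := nc_reify a l in
    let y := nc_reify b l in
    let es := nc_hreify hs l constr:(@nil (ncexp * ncexp)) in
    let pf := nc_hproof hs I in
    exact (@nc_sound _ l es x y pf (eq_refl true <: nc_check es x y = true))
  end.

(** * Prime quotients *)

(** Containing 0 is kept as a separate condition: the empty set, which is the union of the empty
    chain in Zorn's lemma, is thus allowed. *)
Definition ideal_like (R : pzRingType) (I : R -> Prop) : Prop :=
  [/\ forall x y, I x -> I y -> I (x - y), forall a x, I x -> I (a * x)
    & forall a x, I x -> I (x * a)].

Section IdealQuotient.
Variables (R : pzRingType) (I : R -> Prop).
Hypotheses (I0 : I 0) (idealI : ideal_like I).

Lemma ideal_opp x : I x -> I (- x).
Proof. by case: idealI => IB _ _ Ix; rewrite -sub0r; apply: IB. Qed.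

Lemma ideal_add x y : I x -> I y -> I (x + y).
Proof.
by move=> Ix /ideal_opp Iy; case: idealI => IB _ _; rewrite -[y]opprK; apply: IB.
Qed.

(** [choose] depends only on the coset of x, so the quotient is the subtype of chosen
    representatives. *)
Definition ideal_repr (x : R) : R := choose (fun y => `[<I (y - x)>]) x.

Lemma ideal_reprP x : I (ideal_repr x - x).
Proof. apply/asboolP; apply: (@chooseP R (fun y => `[<I (y - x)>]) x).
by apply/asboolP; rewrite subrr. Qed.

Lemma ideal_repr_eq x y : (ideal_repr x = ideal_repr y) <-> I (x - y).
Proof.
split=> [xy|Ixy].
  have := ideal_add (ideal_opp (ideal_reprP x)) (ideal_reprP y).
  by rewrite xy; congr I; nc tt.
rewrite /ideal_repr; have -> : (fun z => `[<I (z - x)>]) = (fun z => `[<I (z - y)>]).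
  apply/funext => z; apply/asbool_equiv_eq; split=> Iz.
    by have := ideal_add Iz Ixy; congr I; nc tt.
  by have := ideal_add Iz (ideal_opp Ixy); congr I; nc tt.
by apply: choose_id; apply/asboolP => //; rewrite subrr.
Qed.

(* The hypotheses are parameters of the type so that its ring structure can be
   a canonical instance. *)
Record ideal_quotient (I0' : I 0) (idealI' : ideal_like I) : predArgType :=
  IdealQuotient { iq_val : R; _ : ideal_repr iq_val == iq_val }.
Local Notation iquot := (ideal_quotient I0 idealI).

HB.instance Definition _ := [isSub of iquot for @iq_val I0 idealI].
HB.instance Definition _ := [Choice of iquot by <:].

Lemma ideal_reprK x : ideal_repr (ideal_repr x) == ideal_repr x.
Proof. by apply/eqP/ideal_repr_eq/ideal_reprP. Qed.

Definition iq_pi x : iquot := IdealQuotient I0 idealI (ideal_reprK x).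

Lemma iq_piP x y : (iq_pi x = iq_pi y) <-> I (x - y).
Proof.
rewrite -ideal_repr_eq; split=> [[//]|xy]; exact: val_inj.
Qed.

Lemma iq_valK u : iq_pi (iq_val u) = u.
Proof. by apply: val_inj; case: u => u /= /eqP. Qed.

Lemma iq_ind (K : iquot -> Prop) : (forall x, K (iq_pi x)) -> forall u, K u.
Proof. by move=> KP u; rewrite -[u]iq_valK. Qed.

Definition iq_add (u v : iquot) : iquot := iq_pi (iq_val u + iq_val v).
Definition iq_opp (u : iquot) : iquot := iq_pi (- iq_val u).
Definition iq_mul (u v : iquot) : iquot := iq_pi (iq_val u * iq_val v).

Lemma iq_val_pi x : I (iq_val (iq_pi x) - x).
Proof. exact: ideal_reprP. Qed.

Lemma iq_addE x y : iq_add (iq_pi x) (iq_pi y) = iq_pi (x + y).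
Proof.
apply/iq_piP; have := ideal_add (iq_val_pi x) (iq_val_pi y).
by congr I; nc tt.
Qed.

Lemma iq_oppE x : iq_opp (iq_pi x) = iq_pi (- x).
Proof. by apply/iq_piP; have := ideal_opp (iq_val_pi x); congr I; nc tt. Qed.

Lemma iq_mulE x y : iq_mul (iq_pi x) (iq_pi y) = iq_pi (x * y).
Proof.
have [_ Il Ir] := idealI.
apply/iq_piP; have := ideal_add (Ir (iq_val (iq_pi y)) _ (iq_val_pi x))
  (Il x _ (iq_val_pi y)).
by congr I; nc tt.
Qed.

Lemma iq_addA : associative iq_add.
Proof.
by elim/iq_ind=> x; elim/iq_ind=> y; elim/iq_ind=> z; rewrite !iq_addE addrA.
Qed.
Lemma iq_addC : commutative iq_add.
Proof. by elim/iq_ind=> x; elim/iq_ind=> y; rewrite !iq_addE addrC. Qed.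
Lemma iq_add0 : left_id (iq_pi 0) iq_add.
Proof. by elim/iq_ind=> x; rewrite iq_addE add0r. Qed.
Lemma iq_addN : left_inverse (iq_pi 0) iq_opp iq_add.
Proof. by elim/iq_ind=> x; rewrite iq_oppE iq_addE addNr. Qed.
Lemma iq_mulA : associative iq_mul.
Proof.
by elim/iq_ind=> x; elim/iq_ind=> y; elim/iq_ind=> z; rewrite !iq_mulE mulrA.
Qed.
Lemma iq_mul1 : left_id (iq_pi 1) iq_mul.
Proof. by elim/iq_ind=> x; rewrite iq_mulE mul1r. Qed.
Lemma iq_mulr1 : right_id (iq_pi 1) iq_mul.
Proof. by elim/iq_ind=> x; rewrite iq_mulE mulr1. Qed.
Lemma iq_mulDl : left_distributive iq_mul iq_add.
Proof.
elim/iq_ind=> x; elim/iq_ind=> y; elim/iq_ind=> z.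
by rewrite iq_addE !iq_mulE iq_addE mulrDl.
Qed.
Lemma iq_mulDr : right_distributive iq_mul iq_add.
Proof.
elim/iq_ind=> x; elim/iq_ind=> y; elim/iq_ind=> z.
by rewrite iq_addE !iq_mulE iq_addE mulrDr.
Qed.

HB.instance Definition _ :=
  GRing.isZmodule.Build iquot iq_addA iq_addC iq_add0 iq_addN.
HB.instance Definition _ := GRing.Zmodule_isPzRing.Build iquot
  iq_mulA iq_mul1 iq_mulr1 iq_mulDl iq_mulDr.

Lemma iq_pi_zmod_morphism : zmod_morphism iq_pi.
Proof. by move=> x y; rewrite -iq_addE -iq_oppE. Qed.
HB.instance Definition _ :=
  GRing.isZmodMorphism.Build R iquot iq_pi iq_pi_zmod_morphism.

Lemma iq_pi_monoid_morphism : GRing.monoid_morphism iq_pi.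
Proof. by split=> // x y; rewrite -iq_mulE. Qed.
HB.instance Definition _ :=
  GRing.isMonoidMorphism.Build R iquot iq_pi iq_pi_monoid_morphism.

End IdealQuotient.

Lemma exists_ideal_quotient (R : pzRingType) (I : R -> Prop) :
  I 0 -> ideal_like I ->
  exists (P : pzRingType) (f : {rmorphism R -> P}),
    (forall y, exists x, y = f x) /\ (forall x, f x = 0 <-> I x).
Proof.
move=> I0 idealI; exists (ideal_quotient I0 idealI), (@iq_pi R I I0 idealI).
split=> [y|x]; first by exists (iq_val y); apply/esym; exact: iq_valK.
have := @iq_piP R I I0 idealI x 0; rewrite subr0; exact.
Qed.

Definition prime_ring (P : pzRingType) : Prop :=
  forall a b : P, (forall x, a * x * b = 0) -> a = 0 \/ b = 0.

Fixpoint words (R : pzRingType) (xs : seq R) (m : nat) : seq R :=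
  if m is k.+1 then [seq x * w | x <- xs, w <- words xs k] else [:: 1].

Lemma words_add (R : pzRingType) (xs : seq R) m n w : w \in words xs (m + n) ->
  exists u v, [/\ u \in words xs m, v \in words xs n & w = u * v].
Proof.
elim: m w => [|m IH] w.
  by exists 1, w; rewrite mem_head mul1r.
case/allpairsP => -[x w'] /= [xxs /IH[u [v [um vn ->]]] ->].
exists (x * u), v; rewrite mulrA; split=> //.
by apply/allpairsP; exists (x, u).
Qed.

Lemma words1 (R : pzRingType) (c : R) m : words [:: c] m = [:: c ^+ m].
Proof. by elim: m => //= m ->; rewrite /= exprS. Qed.

Section PrimeAvoidance.
Variables (R : pzRingType) (xs : seq R).
Hypothesis nil_xs : forall m, exists2 w, w \in words xs m & w <> 0.

Local Open Scope classical_set_scope.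

Let avoids (I : set R) := forall m, exists2 w, w \in words xs m & ~ I w.
Let good : set (set R) := [set I | ideal_like I /\ avoids I].

Lemma chain_seq (F : set (set R)) (l : seq R) : total_on F subset ->
  l <> [::] -> (forall w, w \in l -> exists2 X, F X & X w) ->
  exists2 X, F X & forall w, w \in l -> X w.
Proof.
move=> totF; elim: l => // w [|w' l] IH _ lF.
  by have [X FX Xw] := lF w (mem_head _ _); exists X => // v; rewrite inE => /eqP ->.
have [|v vl|X FX XP] := IH; first by [].
  by apply: lF; rewrite inE vl orbT.
have [Y FY Yw] := lF w (mem_head _ _).
have [XY|YX] := totF _ _ FX FY; [exists Y => // v|exists X => // v];
  rewrite inE => /orP[/eqP -> //|vl]; first exact/XY/XP.
  exact: YX.
exact: XP.
Qed.

(** An ideal maximal among those that contain no whole list [words xs m] is prime, because a word of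
    length m + n splits into words of lengths m and n. Zorn's lemma applies because each list is
    finite. *)
Lemma exists_prime_avoiding : exists (P : pzRingType) (f : {rmorphism R -> P}),
  [/\ prime_ring P, forall y, exists x, y = f x
    & forall m, exists2 w, w \in words xs m & f w <> 0].
Proof.
have [|I [[idealI avI] maxI]] := @Zorn_bigcup R good.
  move=> F Fgood totF; split.
    split=> [x y [X FX Xx] [Y FY Yy]|a x [X FX Xx]|a x [X FX Xx]].
    - have [XY|YX] := totF _ _ FX FY.
        by exists Y => //; case: (Fgood _ FY) => -[+ _ _] _; apply=> //; apply: XY.
      by exists X => //; case: (Fgood _ FX) => -[+ _ _] _; apply=> //; apply: YX.
    - by exists X => //; case: (Fgood _ FX) => -[_ + _] _; apply.
    - by exists X => //; case: (Fgood _ FX) => -[_ _ +] _; apply.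
  move=> m; apply: contrapT => noW.
  have [w0 w0m _] := nil_xs m.
  have [|w wm|X FX XP] := @chain_seq F (words xs m) totF.
  - by move=> E; rewrite E in w0m.
  - by apply: contrapT => nw; apply: noW; exists w.
  - by case: (Fgood _ FX) => _ /(_ m)[w /XP].
(* Without 0 the maximal element would be empty, and the zero ideal is larger. *)
have I0 : I 0.
  apply: contrapT => nI0.
  have Iempty x : ~ I x.
    by move=> Ix; apply: nI0; rewrite -(subrr x); case: idealI => + _ _; apply.
  apply: (maxI [set 0]); last first.
    split; last by move=> m; have [w ? ?] := nil_xs m; exists w.
    by split=> [x y -> ->|a x ->|a x ->] /=; rewrite ?subr0 ?mulr0 ?mul0r.
  by split=> [x /Iempty //|/(_ 0) sub]; apply: nI0; apply: sub.
have [P [f [surjf kerf]]] := exists_ideal_quotient I0 idealI.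
exists P, f; split=> //; last first.
  by move=> m; have [w wm nIw] := avI m; exists w => // /kerf.
move=> a b; have [a' ->] := surjf a; have [b' ->] := surjf b => ab0.
apply: contrapT => /not_orP[na nb].
(* The ideal [I + R c R] meets every [words xs m] eventually when [c] is not in [I]. *)
pose J c : set R := [set x | forall K, ideal_like K -> I `<=` K -> K c -> K x].
have idealJ c : ideal_like (J c).
  split=> [x y Jx Jy|r x Jx|r x Jx] K iK IK Kc; have [KB Kl Kr] := iK.
  - by apply: KB; [apply: Jx|apply: Jy].
  - by apply: Kl; apply: Jx.
  - by apply: Kr; apply: Jx.
have hits c : ~ I c -> exists m, forall w, w \in words xs m -> J c w.
  move=> nIc; apply: contrapT => noM; apply: (maxI (J c)).
    split=> [x Ix K iK IK _|sub]; first exact: IK.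
    by apply: nIc; apply: sub => K.
  split=> // m; apply: contrapT => nm; apply: noM; exists m => w wm.
  by apply: contrapT => nJ; apply: nm; exists w.
have [|m am] := hits a'; first by move/kerf.
have [|n bn] := hits b'; first by move/kerf.
have [IB Il Ir] := idealI.
have JJ x y : J a' x -> J b' y -> I (x * y).
  move=> Jx Jy.
  have step r : I (a' * r * y).
    (* [J b'] and [J a'] are intersections of ideals, so each is used by choosing a suitable K:
       first a residual of I on one side, then on the other. *)
    apply: (Jy [set z | forall r, I (a' * r * z)]) => //.
    - split=> [u v Hu Hv s|s u Hu t|s u Hu t] /=.
      + by rewrite mulrBr; apply: IB.
      + by rewrite mulrA -[a' * t * s]mulrA.
      + by rewrite mulrA; apply: Ir.
    - by move=> z Iz s; apply: Il.
    - by move=> s; apply/kerf; rewrite !rmorphM ab0.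
  have := Jx [set z | forall r, I (z * r * y)] _ _ _ 1; rewrite /= mulr1; apply.
  - split=> [u v Hu Hv s|s u Hu t|s u Hu t] /=.
    + by rewrite mulrBl mulrBl; apply: IB.
    + by rewrite -!mulrA; apply: Il; rewrite mulrA.
    + by rewrite -[u * s * t]mulrA.
  - by move=> z Iz s; apply/Ir/Ir.
  - exact: step.
have [w wmn nIw] := avI (m + n).
have [u [v [um vn wE]]] := words_add wmn.
by apply: nIw; rewrite wE; apply: JJ; [apply: am|apply: bn].
Qed.

End PrimeAvoidance.

(** * Levitzki's lemma *)

Lemma exprM_shift (R : pzRingType) (z x : R) n :
  (z * x) ^+ n * z = z * (x * z) ^+ n.
Proof.
by elim: n => [|n IH]; rewrite ?mul1r ?mulr1 // exprS -mulrA IH exprS !mulrA.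
Qed.

Lemma expr_add_annihil (R : pzRingType) (u v : R) k : u * v = 0 ->
  (u + v) ^+ k.+1 = u ^+ k.+1 + v * (u + v) ^+ k.
Proof.
move=> uv; elim: k => [|k IH]; first by rewrite !expr1 mulr1.
by rewrite exprS mulrDl {1}IH mulrDr -exprS mulrA uv mul0r addr0.
Qed.

(** Induction on n, used twice: for z it leaves b = (z x)^(n+1) z to be killed, and for b the
    required identity comes from expanding the hypothesis at x + b' y, where u v = 0. *)
Lemma levitzki (P : pzRingType) (z : P) n : prime_ring P ->
  (forall x, (z * x) ^+ n * z = 0) -> z = 0.
Proof.
move=> primeP; elim: n z => [|[|n] IH] z zP.
- by have := zP 0; rewrite mul1r.
- by have [|//|//] := primeP z z; move=> x; have := zP x; rewrite expr1.
apply: (IH z) => x; set b := _ * z; apply: (IH b) => y.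
have bE : b = z * (x * z) ^+ n.+1 by rewrite /b exprM_shift.
set b' := (x * z) ^+ n.+1 in bE; set u := z * x; set v := b * y.
have uv : u * v = 0 by rewrite /v mulrA /b mulrA -exprS zP mul0r.
have zx' : u + v = z * (x + b' * y) by rewrite /u /v bE mulrDr mulrA.
have := zP (x + b' * y); rewrite -zx' expr_add_annihil // mulrDl.
rewrite [_ ^+ n.+2 * z]zP add0r expr_add_annihil // mulrDr mulrDl.
move/(congr1 (fun w => v ^+ n * w)); rewrite mulr0 mulrDr.
rewrite [X in _ + X](_ : _ = 0) ?addr0; last first.
  have vz : v ^+ n.+2 * z = 0 by rewrite /v bE -mulrA zP.
  have e : (u + v) ^+ n * z = z * ((x + b' * y) * z) ^+ n.
    by rewrite zx' exprM_shift.
  by move: vz; rewrite !exprSr => vz; nc (tt, e, vz).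
by move=> <-; rewrite exprSr -!mulrA.
Qed.

(** * Derived series of groups of units *)

Definition inverse_pair (R : pzRingType) (x x' : R) : Prop :=
  x * x' = 1 /\ x' * x = 1.

(* Elements are paired with their inverses so that the derived series makes sense
   in rings without a total inverse, such as quotients and rings of functions. *)
Inductive derived_pair (R : pzRingType) (V : R -> R -> Prop) :
    nat -> R -> R -> Prop :=
  | derived_pair0 x x' of V x x' : derived_pair V 0 x x'
  | derived_pair1 m : derived_pair V m 1 1
  | derived_pairM m x x' y y' of derived_pair V m x x' & derived_pair V m y y' :
      derived_pair V m (x * y) (y' * x')
  | derived_pairV m x x' of derived_pair V m x x' : derived_pair V m x' x
  | derived_pairR m x x' y y' of derived_pair V m x x' & derived_pair V m y y' :
      derived_pair V m.+1 (x' * y' * x * y) (y' * x' * y * x).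

Section DerivedPair.
Variables (R : pzRingType) (V : R -> R -> Prop).
Hypotheses (V1 : V 1 1) (VV : forall x x', V x x' -> V x' x).
Hypothesis VM : forall x x' y y', V x x' -> V y y' -> V (x * y) (y' * x').
Hypothesis Vinv : forall x x', V x x' -> inverse_pair x x'.

Lemma derived_pair_sub m x x' : derived_pair V m x x' -> V x x'.
Proof.
elim=> {m x x'} [//|//|m x x' y y' _ ? _ ?|m x x' _ ?|m x x' y y' _ Vx _ Vy].
- exact: VM.
- exact: VV.
- rewrite -[x' * y' * x * y]mulrA -[y' * x' * y * x]mulrA.
  by apply: VM; apply: VM => //; apply: VV.
Qed.

Lemma derived_pair_conj m x x' g g' : derived_pair V m x x' -> V g g' ->
  derived_pair V m (g' * x * g) (g' * x' * g).
Proof.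
move=> + Vg; have [gg' g'g] := Vinv Vg.
elim=> {m x x'} [x x' Vx|m|m x x' y y' _ Hx _ Hy|m x x' _|m x x' y y' _ Hx _ Hy].
- apply: derived_pair0; rewrite -[X in V _ X]mulrA.
  by apply: (VM _ Vg); apply: VM => //; apply: VV.
- by rewrite mulr1 g'g; apply: derived_pair1.
- have := derived_pairM Hx Hy; congr (derived_pair V m); nc (tt, gg').
- exact: derived_pairV.
- have := derived_pairR Hx Hy; congr (derived_pair V m.+1); nc (tt, gg').
Qed.

End DerivedPair.

Lemma derived_pair_morph (R P : pzRingType) (f : {rmorphism R -> P})
    (V : R -> R -> Prop) (W : P -> P -> Prop) m x x' :
  (forall y y', V y y' -> W (f y) (f y')) ->
  derived_pair V m x x' -> derived_pair W m (f x) (f x').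
Proof.
move=> VW; elim=> {m x x'}
  [x x' Vx|m|m x x' y y' _ Hx _ Hy|m x x' _ Hx|m x x' y y' _ Hx _ Hy].
- exact/derived_pair0/VW.
- by rewrite rmorph1; apply: derived_pair1.
- by rewrite !rmorphM; apply: derived_pairM.
- exact: derived_pairV.
- by rewrite !rmorphM; apply: derived_pairR.
Qed.

Lemma derived_pair_lift (R P : pzRingType) (f : {rmorphism R -> P})
    (V : R -> R -> Prop) (W : P -> P -> Prop) m y y' :
  (forall z z', W z z' -> exists x x', [/\ V x x', f x = z & f x' = z']) ->
  derived_pair W m y y' ->
  exists x x', [/\ derived_pair V m x x', f x = y & f x' = y'].
Proof.
move=> WV; elim=> {m y y'} [y y' /WV[x [x' [Vx <- <-]]]|m|
   m _ _ _ _ _ [x [x' [Hx <- <-]]] _ [y [y' [Hy <- <-]]]|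
   m _ _ _ [x [x' [Hx <- <-]]]|
   m _ _ _ _ _ [x [x' [Hx <- <-]]] _ [y [y' [Hy <- <-]]]].
- by exists x, x'; split=> //; apply: derived_pair0.
- by exists 1, 1; rewrite rmorph1; split=> //; apply: derived_pair1.
- by exists (x * y), (y' * x'); rewrite !rmorphM; split=> //; apply: derived_pairM.
- by exists x', x; split=> //; apply: derived_pairV.
- exists (x' * y' * x * y), (y' * x' * y * x); rewrite !rmorphM.
  by split=> //; apply: derived_pairR.
Qed.

(** * Solvable adjoint groups in prime rings *)

Definition central (R : pzRingType) (x : R) : Prop := forall y, x * y = y * x.

Lemma prime_central_reg (P : pzRingType) (c x : P) : prime_ring P ->
  central c -> c * x = 0 -> c = 0 \/ x = 0.
Proof. by move=> primeP cc cx; apply: primeP => y; rewrite cc -mulrA cx mulr0. Qed.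

Section SolvableAdjoint.
Variables (P : pzRingType) (J : P -> Prop).
Hypotheses (primeP : prime_ring P) (J0 : J 0) (idealJ : ideal_like J).
Hypothesis qregJ : forall j, J j -> exists x', inverse_pair (1 + j) x'.
Hypothesis two : 2%:R = 0 :> P \/ exists h : P, h * 2%:R = 1.

Let V (x x' : P) := J (x - 1) /\ inverse_pair x x'.

Let JB x y : J x -> J y -> J (x - y). Proof. by case: idealJ => + _ _; apply. Qed.
Let Jl a x : J x -> J (a * x). Proof. by case: idealJ => _ + _; apply. Qed.
Let Jr a x : J x -> J (x * a). Proof. by case: idealJ => _ _; apply. Qed.
Let JD x y : J x -> J y -> J (x + y).
Proof. exact: (ideal_add J0 idealJ). Qed.

Let V_unit x : J (x - 1) -> exists x', V x x'.
Proof.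
move=> Jx; have [x' xx'] := qregJ Jx; exists x'; split=> //.
by move: xx'; rewrite addrC subrK.
Qed.

Let V1 : V 1 1. Proof. by split; rewrite ?subrr //; split; rewrite mulr1. Qed.

Let VV x x' : V x x' -> V x' x.
Proof.
case=> Jx [xx' x'x]; split=> //.
have -> : x' - 1 = 0 - x' * (x - 1) by nc (tt, x'x).
by apply: JB => //; apply: Jl.
Qed.

Let VM x x' y y' : V x x' -> V y y' -> V (x * y) (y' * x').
Proof.
move=> [Jx [xx' x'x]] [Jy [yy' y'y]]; split.
  have -> : x * y - 1 = (x - 1) * y + (y - 1) by nc tt.
  by apply: JD => //; apply: Jr.
by split; nc (tt, xx', x'x, yy', y'y).
Qed.

Lemma prime_ideal_reg a b : (exists2 j, J j & j <> 0) ->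
  (forall j, J j -> a * j * b = 0) -> a = 0 \/ b = 0.
Proof.
move=> [j Jj nzj] ab; have jb k : J k -> a = 0 \/ k * b = 0.
  by move=> Jk; apply: primeP => x; rewrite mulrA -[a * x * k]mulrA; apply: ab; apply: Jl.
have [->|nza] := EM (a = 0); [by left|right].
have [x||//] := primeP (a := j) (b := b); last by move/nzj.
by have [||->] := jb (j * x) => //; apply: Jr.
Qed.

(** * Abelian normal subgroups of 1 + J *)

Section Abelian.
Variable H : P -> P -> Prop.
Hypotheses (HJ : forall h h', H h h' -> V h h').
Hypothesis HC : forall h h' g g', H h h' -> V g g' -> H (g' * h * g) (g' * h' * g).
Hypothesis abelH : forall h h' k k', H h h' -> H k k' -> h * k = k * h.

(** The bicommutant of H: a commutative ring that contains H and is stable under conjugation by 1 +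
    J. *)
Let E (x : P) := forall y, (forall h h', H h h' -> y * h = h * y) -> x * y = y * x.

Let EH h h' : H h h' -> E h. Proof. by move=> Hh y /(_ h h' Hh). Qed.

Let EC x y : E x -> E y -> x * y = y * x.
Proof.
move=> Ex Ey; apply: Ex => h h' Hh; apply: Ey => k k' Hk; exact: abelH Hh Hk.
Qed.

Let EB x y : E x -> E y -> E (x - y).
Proof. by move=> Ex Ey z zP; rewrite mulrBl mulrBr Ex // Ey. Qed.

Let EM' x y : E x -> E y -> E (x * y).
Proof. by move=> Ex Ey z zP; rewrite -mulrA Ey // mulrA Ex // mulrA. Qed.

Let Econj x g g' : E x -> V g g' -> E (g' * x * g).
Proof.
move=> Ex Vg y yP; have [_ [gg' g'g]] := Vg.
have e : x * (g * y * g') = g * y * g' * x.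
  apply: Ex => h h' Hh; have /yP e := HC Hh Vg.
  have -> : g * y * g' * h = g * (y * (g' * h * g)) * g' by nc (tt, gg').
  by rewrite e; nc (tt, gg').
have -> : g' * x * g * y = g' * (x * (g * y * g')) * g by nc (tt, g'g).
by rewrite e; nc (tt, g'g).
Qed.

Let K (g g' e : P) := g' * e * g - e.

Let EK e g g' : E e -> V g g' -> E (K g g' e).
Proof. by move=> Ee Vg; apply: EB => //; apply: Econj. Qed.

Let JK e g g' : V g g' -> J (K g g' e).
Proof.
move=> [Jg [gg' g'g]]; rewrite /K.
have -> : g' * e * g - e = g' * e * (g - 1) - g' * (g - 1) * e by nc (tt, g'g).
by apply: JB; [apply: Jl|rewrite -mulrA; apply/Jl/Jr].
Qed.

Let annihil g g' x f : V g g' -> E x -> E (g * x) -> E f -> K g g' f * x = 0.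
Proof.
move=> [_ [gg' g'g]] Ex Egx Ef.
have fx := EC Ef Ex; have fgx := EC Ef Egx.
have -> : K g g' f * x = g' * (f * (g * x) - g * (f * x)) by rewrite /K; nc (tt, g'g).
by rewrite fgx fx; nc tt.
Qed.

(** Compare conjugation by g with conjugation by g + c, where c = K g g' a lies in J. The values at
    e differ by some x with g x = c m, so x and g x both lie in E and [annihil] applies to x. *)
Let KKK g g' a e f : V g g' -> E a -> E e -> E f ->
  K g g' a * K g g' e * K g g' f = 0.
Proof.
move=> Vg Ea Ee Ef; set c := K g g' a.
have Ec : E c by apply: EK.
have [_ [gg' g'g]] := Vg.
have [k' Vk] : exists k', V (g + c) k'.
  apply: V_unit; have -> : g + c - 1 = (g - 1) + c by nc tt.
  by apply: JD; [case: Vg|apply: JK].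
have [_ [kk' k'k]] := Vk.
set m := K (g + c) k' e; have Em : E m by apply: EK.
have gm : (g + c) * m = e * g - g * e.
  have ec := EC Ee Ec.
  have -> : (g + c) * m = (g + c) * k' * e * (g + c) - (g + c) * e by rewrite /m /K; nc tt.
  by rewrite kk'; nc (tt, ec).
have gK : g * K g g' e = e * g - g * e by rewrite /K; nc (tt, gg').
set x := K g g' e - m; have Ex : E x by apply: EB => //; apply: EK.
have gx : g * x = c * m.
  have -> : g * x = g * K g g' e - ((g + c) * m - c * m) by rewrite /x; nc tt.
  by rewrite gK gm; nc tt.
have Egx : E (g * x) by rewrite gx; apply: EM'.
have cx : c * x = 0 by apply: annihil.
have gxE : g * x = c * K g g' e.
  by rewrite gx; move: cx; rewrite /x mulrBr => /eqP; rewrite subr_eq0 => /eqP.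
have xf : x * K g g' f = 0 by rewrite EC //; [apply: annihil|apply: EK].
by rewrite -gxE -mulrA xf mulr0.
Qed.

(** For g = 1 + j the commutator of u with g is g K(u), and the factors K commute with E; so the
    triple commutator is g times a product of three factors K. *)
Let DDD a e f j : E a -> E e -> E f -> J j ->
  let w := f * j - j * f in let w' := e * w - w * e in a * w' - w' * a = 0.
Proof.
move=> Ea Ee Ef Jj /=; have [g' Vg] : exists g', V (1 + j) g'.
  by apply: V_unit; rewrite addrC addKr.
have [_ [gg' g'g]] := Vg; have Kaef := KKK Vg Ea Ee Ef.
set g := 1 + j in Vg gg' g'g Kaef *.
have jE : j = g - 1 by rewrite /g addrC addKr.
have DK u : E u -> u * g - g * u = g * K g g' u by rewrite /K => Eu; nc (tt, gg').
have -> : f * j - j * f = g * K g g' f by rewrite -DK // jE; nc tt.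
have -> : e * (g * K g g' f) - g * K g g' f * e = g * (K g g' e * K g g' f).
  have c := EC Ee (EK Ef Vg).
  have -> : e * (g * K g g' f) - g * K g g' f * e =
    (e * g - g * e) * K g g' f + g * (e * K g g' f - K g g' f * e) by nc tt.
  by rewrite c DK //; nc tt.
have c := EC Ea (EM' (EK Ee Vg) (EK Ef Vg)).
have -> : a * (g * (K g g' e * K g g' f)) - g * (K g g' e * K g g' f) * a =
    (a * g - g * a) * (K g g' e * K g g' f) +
    g * (a * (K g g' e * K g g' f) - K g g' e * K g g' f * a) by nc tt.
by rewrite c DK // -!mulrA [K g g' a * _]mulrA Kaef; nc tt.
Qed.

(** For g = 1 + j, c j c = c g c - c c, and c g c is the product of c with a conjugate of c, times
    g. *)
Let conj_annihil c : (exists2 j, J j & j <> 0) ->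
  (forall g g', V g g' -> c * (g' * c * g) = 0) -> c = 0.
Proof.
move=> nzJ cP; have c1 := cP 1 1 V1.
have cc : c * c = 0 by rewrite -c1; nc tt.
have [j Jj|//|//] := @prime_ideal_reg c c nzJ.
have [g' Vg] : exists g', V (1 + j) g' by apply: V_unit; rewrite addrC addKr.
have := cP _ _ (VV Vg); have [_ [gg' g'g]] := Vg => e.
set g := 1 + j in gg' g'g e.
have jE : j = g - 1 by rewrite /g addrC addKr.
have -> : c * j * c = c * (g * c * g') * g - c * c by rewrite jE; nc (tt, g'g).
by rewrite e cc; nc tt.
Qed.

Let sq_zero c e1 e2 : (exists2 j, J j & j <> 0) -> E e1 -> E e2 ->
  e1 * e1 = 0 -> e2 * e2 = 0 -> c = e1 * e2 -> c = 0.
Proof.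
move=> nzJ E1 E2 e11 e22 cE; have e12 := EC E2 E1.
have Ec : E c by rewrite cE; apply: EM'.
have cc : c * c = 0 by rewrite cE; nc (tt, e12, e11, e22).
apply: conj_annihil => // g g' Vg; have [_ [gg' g'g]] := Vg.
set k := g' * c * g; have Ek : E k by apply: Econj.
have ck := EC Ek Ec.
have kk : k * k = 0 by rewrite /k; nc (tt, gg', cc).
have [j Jj|//|//] := @prime_ideal_reg (c * k) (c * k) nzJ.
(* Multiplied by c = e1 e2 on the left, the triple commutator collapses to c (k j - j k) c = 0, as
   e1 and e2 have square zero. *)
have /(congr1 (fun z => c * z)) := DDD E1 E2 Ek Jj; rewrite mulr0 => D.
have e : c * j * c * k = k * c * j * c.
  apply/eqP; rewrite -subr_eq0; apply/eqP; rewrite -[RHS]oppr0 -D cE.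
  have kE1 := EC Ek E1; have kE2 := EC Ek E2.
  by nc (tt, e12, e11, e22, kE1, kE2).
have -> : c * k * j * (c * k) = k * (c * j * c * k) by nc (tt, ck).
by rewrite e; nc (tt, kk).
Qed.

(** E has no nonzero element b of square zero: [sq_zero] kills the product of b with each conjugate,
    and [conj_annihil] then kills b. Since K(h) has cube zero it vanishes; so h commutes with J,
    hence with P by primeness. *)
Lemma abelian_normal_central h h' : H h h' -> central h.
Proof.
move=> Hh; have Eh := EH Hh; have [nzJ|zJ] := EM (exists2 j, J j & j <> 0); last first.
  have [Jh _] := HJ Hh; have h1 : h - 1 = 0.
    by apply: contrapT => nz; apply: zJ; exists (h - 1).
  by move=> y; rewrite -[h](subrK 1) h1 add0r mul1r mulr1.
have K0 b : E b -> b * b = 0 -> b = 0.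
  move=> Eb bb; apply: conj_annihil => // g g' Vg.
  have [_ [gg' g'g]] := Vg.
  by apply: (sq_zero nzJ Eb (Econj Eb Vg)) => //; nc (tt, gg', bb).
have hJ j : J j -> h * j = j * h.
  move=> Jj; have [g' Vg] : exists g', V (1 + j) g'.
    by apply: V_unit; rewrite addrC addKr.
  have EKh := EK Eh Vg.
  have e := KKK Vg Eh Eh Eh.
  have Kh : K (1 + j) g' h = 0.
    apply: (K0) => //; apply: (K0); first exact: EM'.
    by rewrite mulrA e mul0r.
  have [_ [gg' _]] := Vg.
  have : (1 + j) * K (1 + j) g' h = 0 by rewrite Kh mulr0.
  rewrite /K mulrBr !mulrA gg' mul1r => /eqP; rewrite subr_eq0 => /eqP.
  by rewrite mulrDr mulrDl mul1r mulr1 => /addrI.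
move=> y; have [x Jx||/eqP] := @prime_ideal_reg 1 (h * y - y * h) nzJ.
- rewrite mul1r; have e := hJ _ Jx; have e2 := hJ _ (Jr y Jx).
  have -> : x * (h * y - y * h) = h * (x * y) - x * y * h - (h * x - x * h) * y by nc tt.
  by rewrite e e2; nc tt.
- by move=> one0; rewrite -[LHS]mul1r -[RHS]mul1r one0 !mul0r.
by rewrite subr_eq0 => /eqP.
Qed.

End Abelian.

Lemma central_mul (c d : P) : central c -> central d -> central (c * d).
Proof. by move=> cc cd x; rewrite -mulrA cd mulrA cc mulrA. Qed.

Lemma central_sub (c d : P) : central c -> central d -> central (c - d).
Proof. by move=> cc cd x; rewrite mulrBl mulrBr cc cd. Qed.

Lemma central1 : central (1 : P).
Proof. by move=> x; rewrite mul1r mulr1. Qed.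

Section ClassTwo.
Variable H : P -> P -> Prop.
Hypotheses (HJ : forall h h', H h h' -> V h h').
Hypothesis HV : forall h h', H h h' -> H h' h.
Hypothesis HC : forall h h' g g', H h h' -> V g g' -> H (g' * h * g) (g' * h' * g).
Hypothesis centH : forall h h' k k', H h h' -> H k k' -> central (h' * k' * h * k).

(* With z = (h, k) central and c = z - 1, the commutator (1 + c h, k) lies in
   [H] and in the commutative ring generated by [h]; that it commutes with [k]
   up to a central factor is a quadratic equation for [h], and comparing the
   eigenvalues 1, z, z^2 of [k] forces z = 1. *)
Lemma class_two_abelian h h' k k' : H h h' -> H k k' -> h * k = k * h.
Proof.
move=> Hh Hk; have [Jh [hh' h'h]] := HJ Hh; have [Jk [kk' k'k]] := HJ Hk.
set z := h' * k' * h * k; have cz : central z := centH Hh Hk.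
have Vz : V z (k' * h' * k * h).
  have := VM (VM (VV (HJ Hh)) (VV (HJ Hk))) (VM (HJ Hh) (HJ Hk)).
  by congr V; rewrite /z; nc tt.
have [Jc [zz' z'z]] := Vz; set c := z - 1 in Jc.
have cc : central c by apply: central_sub => //; apply: central1.
have hk : h * k = z * k * h by have cz1 := cz k; rewrite cz1 -mulrA cz /z; nc (tt, kk', hh').
suff c0 : c = 0.
  by rewrite hk -[z](subrK 1) -/c c0 add0r mul1r.
have [X' VX] : exists X', V (1 + c * h) X'.
  by apply: V_unit; rewrite addrC addKr; apply: Jr.
have [JX [XX' X'X]] := VX.
have Hk1 := HC Hk VX.
(* Keeps the value of X as an equation, so that X can become an opaque atom for [nc]. *)
have XE : 1 + c * h = 1 + c * h by [].
set X := {1 3 4 5 6 7}(1 + c * h) in XE VX JX XX' X'X Hk1.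
set k1 := X' * k * X in Hk1; set k1' := X' * k' * X in Hk1.
have ceta := centH (HV Hk1) Hk; set eta := k1 * k' * k1' * k in ceta.
have hz : h * z = z * h := esym (cz h).
have kz : k' * z = z * k' := esym (cz k').
have k'hk : k' * h * k = z * h by rewrite -mulrA hk; nc (tt, k'k, kz).
have zE : c = z - 1 by [].
have cE : k' * c = c * k' := esym (cc k').
clearbody z c X.
have X1E : k' * X * k = 1 + c * z * h by rewrite XE; nc (tt, k'k, cE, k'hk).
set X1 := 1 + c * z * h in X1E.
have X2E : k' * X1 * k = 1 + c * z * z * h.
  by rewrite /X1; nc (tt, k'k, cE, kz, k'hk).
set X2 := 1 + c * z * z * h in X2E.
have k1k : k1' * k = X' * X1 by rewrite -X1E /k1'; nc tt.
have etaE : k' * (k1' * k) * k = eta * (k1' * k).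
  by rewrite [RHS]mulrA [in RHS]ceta /eta /k1 /k1'; nc (tt, k'k, kk', XX', X'X).
have XX1 : X * X1 = X1 * X.
  have hc := esym (cc h); have zc := esym (cc z).
  by rewrite XE /X1; nc (tt, hz, hc, zc).
have eX := esym (ceta X); have eX1 := esym (ceta X1).
(* [k1' * k] is X' X1; conjugation by k sends X to X1 and X1 to X2, and multiplies this product by
   eta. *)
have quad : X * X2 = eta * (X1 * X1).
  have e : X2 = X1 * (k' * (X' * X1) * k).
    by rewrite -{1}X1E -X2E; nc (tt, kk', XX').
  by rewrite e -k1k etaE k1k; nc (tt, XX1, XX', eX, eX1).
have [//|nzc] := EM (c = 0).
have hc := esym (cc h); have zc := esym (cc z).
set A0 := 1 - eta; set A2 := z * z * (1 - eta).
have cA0 : central A0 by apply: central_sub => //; apply: central1.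
have czz : central (z * z) by apply: central_mul.
have cA2 : central A2 by apply: central_mul.
have eh := esym (ceta h); have ec := esym (ceta c); have ez := esym (ceta z).
have eqn0 : A0 + c * (1 + z * z - eta * z - eta * z) * h + c * c * A2 * h * h = 0.
  have : X * X2 - eta * (X1 * X1) = 0 by rewrite quad subrr.
  move=> <-; rewrite XE /X2 /X1 /A0 /A2; nc (tt, hz, hc, zc, eh, ec, ez).
have hk2 : k' * (h * h) * k = z * z * h * h.
  have -> : k' * (h * h) * k = (k' * h * k) * (k' * h * k) by nc (tt, kk').
  by rewrite k'hk; nc (tt, hz).
have ek' := esym (ceta k').
have eqn1 : A0 + c * (1 + z * z - eta * z - eta * z) * z * h
            + c * c * A2 * z * z * h * h = 0.
  have : k' * (A0 + c * (1 + z * z - eta * z - eta * z) * h + c * c * A2 * h * h) * k = 0.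
    by rewrite eqn0 mulr0 mul0r.
  move=> <-; move: hk2; rewrite /A0 /A2 mulrA => hk2.
  nc (tt, k'k, hk2, k'hk, cE, kz, ek', hz, hc, zc, eh, ec, ez).
set B := c * c * A2 in eqn0 eqn1.
have cB : central B by apply: central_mul => //; apply: central_mul.
have BE : B = c * (c * (z * (z * A0))) by rewrite /B /A2 -/A0; nc tt.
have A0eta : A0 = 1 - eta by [].
clearbody B A0.
(* z times the first equation minus the second: the linear terms cancel and z - 1 = c factors
   out. *)
have A0E : A0 = z * B * h * h.
  have : c * (A0 - z * B * h * h) = 0.
    transitivity (z * 0 - 0 : P); last by rewrite mulr0 subr0.
    rewrite -{1}eqn0 -{1}eqn1 zE.
    have Bz := cB z; have A0z := cA0 z.
    by nc (tt, hz, hc, zc, eh, ec, ez, Bz, A0z).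
  by case/(prime_central_reg primeP cc) => // /eqP; rewrite subr_eq0 => /eqP.
have A0E2 : A0 = z * B * z * z * h * h.
  have -> : A0 = k' * (z * B * h * h) * k by rewrite -A0E -mulrA cA0 mulrA k'k mul1r.
  have Bk := esym (cB k'); have Bz := cB z; rewrite mulrA in hk2.
  by nc (tt, Bk, kz, hk2, Bz).
have one_c : 1 = 0 :> P -> c = 0 by move=> e; rewrite -[c]mul1r e mul0r.
have : c * (B * (z + 1)) = 0.
  have : z * B * z * z * h * h - z * B * h * h = 0 by rewrite -A0E -A0E2 subrr.
  move=> /(congr1 (fun x => x * h' * h' * (k' * h' * k * h))); rewrite mul0r mul0r mul0r => <-.
  rewrite zE; set z' := k' * h' * k * h in zz' *.
  have Bz := cz B.
  have zh' := cz h'.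
  nc (tt, hh', Bz, zh', zz').
case/(prime_central_reg primeP cc) => // /(prime_central_reg primeP cB)[B0|z1].
  have z0 : z = 0 -> c = 0 by move=> z0; apply: one_c; rewrite -zz' z0 mul0r.
  move: BE; rewrite B0 => /esym.
  case/(prime_central_reg primeP cc) => // /(prime_central_reg primeP cc)[//|].
  case/(prime_central_reg primeP cz) => [/z0 //|].
  case/(prime_central_reg primeP cz) => [/z0 //|A00].
  move/eqP: A0eta; rewrite A00 eq_sym subr_eq0 => /eqP eta1.
  have ch : c * h = 0 -> c = 0 by rewrite -{2}[c]mulr1 -hh' mulrA => ->; rewrite mul0r.
  (* For eta = 1 the equation becomes c (z - 1)^2 h = 0. *)
  have : c * (c * (c * h)) = 0.
    by rewrite -eqn0 A00 B0 -eta1 {2 3}zE; nc tt.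
  case/(prime_central_reg primeP cc) => // /(prime_central_reg primeP cc)[//|].
  exact: ch.
(* Now z = -1. If 2 is invertible then -1 lies in J, and 0 = 1 + (-1) would be a unit. *)
have c2 : c = - 2%:R by rewrite zE -[z](addrK 1) z1; nc tt.
case: two => [e|[h0 h02]]; first by rewrite c2 e oppr0.
have Jm1 : J (-1).
  by have -> : -1 = h0 * c by [rewrite c2 mulrN h02]; apply: Jl.
have [x' [m1 _]] := qregJ Jm1.
by apply: one_c; rewrite -m1 subrr mul0r.
Qed.

End ClassTwo.

(** The derived series is climbed from its trivial end: if the next derived group is central, the
    present one has class at most two, hence is abelian, hence central. *)
Lemma solvable_adjoint_central d :
  (forall x x', derived_pair V d x x' -> x = 1) -> forall j, J j -> central j.
Proof.
move=> sol; suff cV x x' : V x x' -> central x.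
  move=> j Jj y; have [x' /cV cx] : exists x', V (1 + j) x'.
    by apply: V_unit; rewrite addrC addKr.
  by have := cx y; rewrite mulrDl mulrDr mul1r mulr1 => /addrI.
suff cD m' : forall x x', derived_pair V (d - m')%N x x' -> central x.
  by have := cD d; rewrite subnn => cD0 Vx; apply: (cD0 x x'); apply: derived_pair0.
elim: m' => [|m' IH] {}x {}x'.
  by rewrite subn0 => /sol ->; apply: central1.
(* Truncated subtraction: both levels are 0 when d <= m'. *)
case: (leqP d m') => [dm|lt].
  suff -> : (d - m'.+1 = d - m')%N by apply: IH.
  by rewrite (eqP dm); apply/eqP; rewrite subn_eq0 leqW.
have dE : (d - m')%N = (d - m'.+1).+1 by rewrite subnSK.
rewrite dE in IH; set i := (d - m'.+1)%N in IH *.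
have HV h h' : derived_pair V i h h' -> V h h'.
  by apply: derived_pair_sub.
have HC := derived_pair_conj VV VM (fun x x' (Vx : V x x') => Vx.2) (m := i).
move=> Hx; apply: (abelian_normal_central HV HC _ Hx) => h h' k k' Hh Hk.
apply: (class_two_abelian HV _ HC _ Hh Hk).
  by move=> ? ?; apply: derived_pairV.
by move=> a a' b b' Ha Hb; apply: (IH _ _ (derived_pairR Ha Hb)).
Qed.

End SolvableAdjoint.

(** * Finite subrings of domains *)

Section FiniteDomain.
Variables (P : pzRingType) (s : seq P).
Hypotheses (nz1 : 1 != 0 :> P) (s1 : 1 \in s).
Hypotheses (sB : forall x y, x \in s -> y \in s -> x - y \in s).
Hypotheses (sM : forall x y, x \in s -> y \in s -> x * y \in s).

Let S : {pred P} := [pred x | x \in s].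

Lemma finite_subring_closed : subring_closed S.
Proof. by split; [exact: s1|exact: sB|exact: sM]. Qed.

Record subring_of_seq : predArgType := SubringOfSeq { sos_val : P; _ : sos_val \in S }.
HB.instance Definition _ := [isSub for sos_val].
HB.instance Definition _ := [Choice of subring_of_seq by <:].
HB.instance Definition _ := GRing.SubChoice_isSubPzRing.Build P S subring_of_seq finite_subring_closed.

Let to_sub (x : subring_of_seq) : seq_sub s :=
  let: SubringOfSeq y sy := x in SeqSub sy.
Let of_sub (x : seq_sub s) : subring_of_seq := SubringOfSeq (ssvalP x).
Lemma to_subK : cancel to_sub of_sub.
Proof. by case=> x sx; apply: val_inj. Qed.
HB.instance Definition _ := CanIsCountable to_subK.
HB.instance Definition _ : isFinite subring_of_seq := CanIsFinite to_subK.

Lemma subring_of_seq_nz1 : 1 != 0 :> subring_of_seq.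
Proof. by apply: contra_neq nz1 => /(congr1 sos_val). Qed.
HB.instance Definition _ := GRing.PzSemiRing_isNonZero.Build subring_of_seq subring_of_seq_nz1.
HB.instance Definition _ := FinRing.isNzRing.Build subring_of_seq.

(** Wedderburn's little theorem, for the finite ring whose elements are listed by s. *)
Lemma finite_domain_commutative :
  (forall x y, x \in s -> y \in s -> x * y = 0 -> x = 0 \/ y = 0) ->
  forall x y, x \in s -> y \in s -> x * y = y * x.
Proof.
move=> dom x y xs ys.
have dom' : GRing.integral_domain_axiom subring_of_seq.
  move=> [a sa] [b sb] /(congr1 val) /= ab; apply/orP.
  by have [a0|b0] := dom a b sa sb ab; [left|right]; apply/eqP/val_inj.
by have /(congr1 val) := @finDomain_mulrC _ dom' (SubringOfSeq (xs : x \in S)) (SubringOfSeq (ys : y \in S)).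
Qed.
End FiniteDomain.

(** * Periodic division rings *)

Definition periodic (R : pzRingType) : Prop :=
  forall x : R, exists m k, x ^+ m = x ^+ (m + k.+1).

Lemma bin_pchar0 (R : pzRingType) p k : prime p -> p%:R = 0 :> R ->
  (0 < k < p)%N -> 'C(p, k)%:R = 0 :> R.
Proof.
move=> prp p0 kp; have /dvdnP[m ->] := prime_dvd_bin prp kp.
by rewrite natrM p0 mulr0.
Qed.

Lemma exprB1_pchar (R : pzRingType) p (x : R) : prime p -> p%:R = 0 :> R ->
  x ^+ p = 1 -> (x - 1) ^+ p = 0.
Proof.
move=> prp p0 xp; rewrite exprBn_comm; last exact: commr1.
case: p prp p0 xp => // p prp p0 xp.
rewrite big_ord_recl big_ord_recr /= big1 => [|i _]; last first.
  rewrite -mulr_natr bin_pchar0 ?mulr0 //; by rewrite /bump /= add1n ltnS ltn_ord.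
rewrite subn0 expr0 mul1r expr1n mulr1 bin0 mulr1n add0r /bump /= add1n subnn binn.
rewrite expr0 !mulr1 expr1n mulr1 mulr1n xp; have [p2|odd_p] := even_prime prp.
  by move: p0; rewrite p2 -signr_odd expr0.
by rewrite -signr_odd odd_p expr1 subrr.
Qed.

Section PeriodicDivision.
Variables (P : pzRingType) (p : nat).
Hypotheses (nz1 : 1 != 0 :> P) (prp : prime p) (p0 : p%:R = 0 :> P).
Hypothesis divP : forall x : P, x <> 0 -> exists x', inverse_pair x x'.
Hypothesis perP : periodic P.

Lemma division_domain (x y : P) : x * y = 0 -> x = 0 \/ y = 0.
Proof.
move=> xy; have [->|/divP[x' [_ x'x]]] := EM (x = 0); [by left|right].
by rewrite -[y]mul1r -x'x -mulrA xy mulr0.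
Qed.

Lemma division_expr_neq0 (x : P) n : x <> 0 -> x ^+ n <> 0.
Proof.
move=> nzx; elim: n => [|n IH]; first exact/eqP.
by rewrite exprS => /division_domain[].
Qed.

Lemma division_order (x : P) : x <> 0 -> exists2 k, (0 < k)%N & x ^+ k = 1.
Proof.
move=> nzx; have [m [k e]] := perP x; exists k.+1 => //.
have : x ^+ m * (x ^+ k.+1 - 1) = 0 by rewrite mulrBr -exprD -e mulr1 subrr.
by case/division_domain => [/(division_expr_neq0 nzx)|/eqP] //; rewrite subr_eq0 => /eqP.
Qed.

(* Some sum of the form [\sum_j w^-j u^-j x u^j] with [w] a power of [u] is a
   nonzero eigenvector of the conjugation by [u] for the eigenvalue [w]. *)
Lemma division_eigenvector (u x : P) : u * x <> x * u ->
  exists b i, [/\ b <> 0, b * u = u ^+ i.+1 * b & u ^+ i <> 1].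
Proof.
move=> ux; have nzu : u <> 0 by move=> u0; apply: ux; rewrite u0 mul0r mulr0.
have exk : exists k, (0 < k)%N && (u ^+ k == 1).
  by have [k k0 uk] := division_order nzu; exists k; rewrite k0 uk eqxx.
case: (ex_minnP exk) => k /andP[k0 /eqP uk] mink.
have small j : (0 < j < k)%N -> u ^+ j <> 1.
  by move=> /andP[j0 jk] /eqP uj; have := mink j; rewrite j0 uj leqNgt jk => /(_ isT).
(* Otherwise u^(k/p) - 1 has p-th power zero, so u^(k/p) = 1 against the minimality of k. *)
have kp : ~~ (p %| k)%N.
  apply/negP => /dvdnP[k1 kE]; have k10 : (0 < k1)%N by move: k0; rewrite kE; case: (k1).
  have := small k1; rewrite k10 kE ltn_Pmulr ?prime_gt1 // => /(_ isT); apply.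
  have /(exprB1_pchar prp p0) : (u ^+ k1) ^+ p = 1 by rewrite -exprM -kE.
  move=> e; apply: contrapT => nz; apply: (@division_expr_neq0 (u ^+ k1 - 1) p) => //.
  by move/eqP; rewrite subr_eq0 => /eqP.
have nzk : k%:R <> 0 :> P.
  move=> kP; have /coprimeP : coprime p k by rewrite prime_coprime.
  case=> [|[a b] /= ab]; first exact: prime_gt0.
  have : (a * p)%:R - (b * k)%:R = 1%:R :> P.
    have le : (b * k <= a * p)%N by apply: ltnW; rewrite -subn_gt0 ab.
    by rewrite -natrB // ab.
  by rewrite !natrM kP p0 !mulr0 subr0 => /esym/eqP; apply/negP.
pose v := u ^+ k.-1.
have uv : u * v = 1 by rewrite -exprS prednK.
have vu : v * u = 1 by rewrite -exprSr prednK.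
(* [k - j] stands for the exponent -j, as u^k = 1. *)
pose X i : P := \sum_(j < k) u ^+ (i * (k - j)) * (v ^+ j * x * u ^+ j).
have XE i : v * X i * u = u ^+ i * X i.
  pose f j := u ^+ (i * (k - j)) * (v ^+ j * x * u ^+ j).
  have fk : f k = f 0%N.
    have uik : u ^+ (i * k) = 1 by rewrite mulnC exprM uk expr1n.
    have vk : v ^+ k = 1 by rewrite /v -exprM mulnC exprM uk expr1n.
    by rewrite /f subnn muln0 subn0 uik vk uk !expr0.
  have shift : u ^+ i * \sum_(j < k) f j = u ^+ i * \sum_(j < k) f j.+1.
    congr (_ * _); move: fk; rewrite -(prednK k0) => fk.
    by rewrite big_ord_recl big_ord_recr /= fk addrC.
  rewrite [RHS]shift mulr_sumr mulr_suml mulr_sumr; apply: eq_bigr => j _.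
  have E : (i + i * (k - j.+1) = i * (k - j))%N by rewrite -mulnS subnSK.
  have c : v * u ^+ (i * (k - j)) = u ^+ (i * (k - j)) * v.
    by apply: commrX; rewrite /GRing.comm uv vu.
  rewrite /f [RHS]mulrA -exprD E exprS exprSr; move: (u ^+ (i * (k - j))) c => U c.
  by nc (tt, c).
have sumX : \sum_(i < k) X i = k%:R * x.
  rewrite exchange_big /=; case: k k0 uk small {mink kp nzk exk} v uv vu X XE => // k _ uk small v uv vu _ _.
  rewrite big_ord_recl /= [X in _ + X]big1 ?addr0 => [|j _].
    rewrite -[k.+1 in RHS]card_ord -sumr_const mulr_suml; apply: eq_bigr => i _.
    by rewrite subn0 mulnC exprM uk expr1n !expr0 !mul1r mulr1.
  rewrite -mulr_suml (_ : \sum_(i < k.+1) _ = 0) ?mul0r //.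
  set w := u ^+ (k.+1 - bump 0 j).
  have -> : \sum_(i < k.+1) u ^+ (i * (k.+1 - lift ord0 j)) = \sum_(i < k.+1) w ^+ i.
    by apply: eq_bigr => i _; rewrite mulnC exprM.
  have : (w - 1) * \sum_(i < k.+1) w ^+ i = 0.
    by rewrite -subrX1 /w -exprM mulnC exprM uk expr1n subrr.
  case/division_domain => // /eqP; rewrite subr_eq0 => /eqP w1.
  have := small (k.+1 - bump 0 j)%N; rewrite -/w w1; case=> //.
  by rewrite /bump /= add1n subSS subn_gt0 ltn_ord /= ltnS leq_subr.
(* If all components with i > 0 vanish, k x is the component fixed by conjugation, and x commutes
   with u because k is nonzero in P. *)
have [[i [ik nz]]|none] := EM (exists i, (0 < i < k)%N /\ X i <> 0).
  exists (X i), i; split=> //; last exact: small.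
  have := congr1 (fun y => u * y) (XE i); rewrite !mulrA uv mul1r => ->.
  by rewrite -exprS.
case: ux; have kx : k%:R * x = X 0%N.
  rewrite -sumX -(prednK k0) big_ord_recl big1 ?addr0 // => i _.
  apply: contrapT => nz; apply: none; exists (lift ord0 i); split=> //.
  by rewrite lift0 /= -[X in (_ < X)%N](prednK k0) ltnS ltn_ord.
have := XE 0%N; rewrite -kx expr0 mul1r => e.
have : k%:R * (v * x * u - x) = 0.
  have c : v * k%:R = k%:R * v := commr_nat v k.
  have -> : k%:R * (v * x * u - x) = v * (k%:R * x) * u - k%:R * x by nc (tt, c).
  by rewrite e subrr.
case/division_domain => // /eqP; rewrite subr_eq0 => /eqP vxu.
by rewrite -{1}vxu !mulrA uv mul1r.
Qed.


Lemma comm_exp_shift (u b : P) t c a : b * u = u ^+ t * b ->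
  b ^+ c * u ^+ a = u ^+ (t ^ c * a) * b ^+ c.
Proof.
move=> bu; have step n : b * u ^+ n = u ^+ (t * n) * b.
  elim: n => [|n IH]; first by rewrite muln0 mulr1 mul1r.
  by rewrite exprSr mulrA IH -mulrA bu mulrA -exprD mulnS addnC.
elim: c => [|c IH]; first by rewrite expn0 mul1n mulr1 mul1r.
by rewrite exprS -mulrA IH mulrA step expnS mulnA -mulrA -exprS.
Qed.

(** The combinations of the u^i b^j with coefficients below p form a finite subring, because u and b
    have finite order; being a domain, it is commutative. *)
Lemma division_metacyclic_comm (u b : P) t :
  u <> 0 -> b <> 0 -> b * u = u ^+ t * b -> b * u = u * b.
Proof.
move=> nzu nzb bu.
have [k k0 uk] := division_order nzu; have [l l0 bl] := division_order nzb.
have pgt0 := prime_gt0 prp.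
pose ev (g : 'I_k * 'I_l -> nat) : P := \sum_(ij : 'I_k * 'I_l) (u ^+ ij.1 * b ^+ ij.2) *+ g ij.
pose s := [seq ev (fun ij => nat_of_ord (f ij)) | f : {ffun 'I_k * 'I_l -> 'I_p}].
have mulrp (y : P) : y *+ p = 0 by rewrite -mulr_natr p0 mulr0.
have evs g : ev g \in s.
  apply/mapP; exists [ffun ij => Ordinal (ltn_pmod (g ij) pgt0)].
    by rewrite mem_enum.
  apply: eq_bigr => ij _; rewrite ffunE /=.
  by rewrite [in LHS](divn_eq (g ij) p) mulrnDr mulnC mulrnA mulrp mul0rn add0r.
have sD y z : y \in s -> z \in s -> y + z \in s.
  case/mapP => f _ -> /mapP[g _ ->].
  have -> : ev (fun ij => f ij : nat) + ev (fun ij => g ij : nat) = ev (fun ij => f ij + g ij)%N.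
    by rewrite /ev -big_split; apply: eq_bigr => ij _; rewrite mulrnDr.
  exact: evs.
have s0 : 0 \in s.
  by have -> : 0 = ev (fun=> 0%N); [rewrite /ev big1|apply: evs].
have sMn y n : y \in s -> y *+ n \in s.
  by move=> ys; elim: n => [|n IH]; rewrite ?mulr0n ?mulrS //; apply: sD.
have sN y : y \in s -> - y \in s.
  move=> ys; have -> : - y = y *+ p.-1.
    by apply/eqP; rewrite eq_sym -addr_eq0 -mulrSr prednK // mulrp.
  exact: sMn.
have smono i j : u ^+ i * b ^+ j \in s.
  have -> : u ^+ i * b ^+ j = ev (fun ij => (ij == (Ordinal (ltn_pmod i k0), Ordinal (ltn_pmod j l0)))%N).
    rewrite /ev (bigD1 (Ordinal (ltn_pmod i k0), Ordinal (ltn_pmod j l0))) //= eqxx mulr1n.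
    rewrite big1 ?addr0 => [|ij /negPf -> //]; rewrite [in LHS](divn_eq i k) [in LHS](divn_eq j l).
    by rewrite !exprD mulnC exprM uk expr1n mul1r mulnC exprM bl expr1n mul1r.
  exact: evs.
have sM y z : y \in s -> z \in s -> y * z \in s.
  case/mapP => f _ -> /mapP[g _ ->]; rewrite /ev mulr_suml.
  apply: (big_ind (fun y => y \in s)) => // ij _; rewrite mulr_sumr.
  apply: (big_ind (fun y => y \in s)) => // ij' _; rewrite mulrnAl mulrnAr.
  apply/sMn/sMn; have -> : u ^+ ij.1 * b ^+ ij.2 * (u ^+ ij'.1 * b ^+ ij'.2) =
    u ^+ ij.1 * (b ^+ ij.2 * u ^+ ij'.1) * b ^+ ij'.2 by rewrite !mulrA.
  by rewrite (comm_exp_shift _ _ bu) mulrA -exprD -mulrA -exprD; apply: smono.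
apply: (@finite_domain_commutative P s) => //.
- by have := smono 0%N 0%N; rewrite mulr1.
- by move=> y z ys zs; apply: sD => //; apply: sN.
- by move=> y z _ _; apply: division_domain.
- by have := smono 0%N 1%N; rewrite mul1r expr1.
- by have := smono 1%N 0%N; rewrite mulr1 expr1.
Qed.

(** An eigenvector b for a noncentral x satisfies b x = x^(i+1) b with x^i <> 1, yet b and x commute
    by [division_metacyclic_comm]. *)
Lemma periodic_division_commutative (x y : P) : x * y = y * x.
Proof.
apply: contrapT => xy; have [b [i [nzb bx xi]]] := division_eigenvector xy.
have nzx : x <> 0 by move=> x0; apply: xy; rewrite x0 mul0r mulr0.
apply: xi; have e : (x ^+ i - 1) * (x * b) = 0.
  by rewrite mulrBl mul1r mulrA -exprSr -bx (division_metacyclic_comm nzx nzb bx) subrr.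
case/division_domain: e => [/eqP|/division_domain[]//].
by rewrite subr_eq0 => /eqP.
Qed.

End PeriodicDivision.

(** * Periodic prime rings *)

Definition nilpotent_elt (R : pzRingType) (x : R) : Prop := exists n, x ^+ n = 0.

Lemma nilpotent_inv (R : pzRingType) (x : R) : nilpotent_elt x ->
  exists2 x', inverse_pair (1 + x) x' & forall y, x * y = y * x -> x' * y = y * x'.
Proof.
case=> n xn; exists (\sum_(i < n) (- x) ^+ i).
  have e : (1 + x) * \sum_(i < n) (- x) ^+ i = 1.
    have := subrX1 (- x) n; rewrite exprNn xn mulr0 sub0r => e.
    by rewrite -[1 + x]opprK opprD mulNr addrC -e opprK.
  split=> //; rewrite -[RHS]e mulr_suml mulr_sumr; apply: eq_bigr => i _.
  by apply/esym/commrX; rewrite /GRing.comm; nc tt.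
move=> y xy; rewrite mulr_suml mulr_sumr; apply: eq_bigr => i _.
by apply/esym/commrX; rewrite /GRing.comm mulrN mulNr xy.
Qed.

Lemma periodic_idempotent (R : pzRingType) (x : R) : periodic R ->
  exists n, x ^+ n.+1 * x ^+ n.+1 = x ^+ n.+1.
Proof.
(* A multiple of the period k + 1 that is at least the preperiod m. *)
move=> /(_ x)[m [k e]]; exists (m.+1 * k.+1).-1; rewrite prednK ?muln_gt0 //.
have step j i : x ^+ (m + j) = x ^+ (m + j + i * k.+1).
  elim: i => [|i IH]; first by rewrite addn0.
  rewrite IH -addnA exprD e -exprD mulSn; congr (x ^+ _).
  by rewrite [(k.+1 + _)%N]addnC -!addnA; congr (_ + _)%N; rewrite addnC -addnA.
have le : (m <= m.+1 * k.+1)%N by rewrite (leq_trans (leqnSn m)) ?leq_pmulr.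
by rewrite -exprD -[in RHS](subnKC le) (step _ m.+1) (subnKC le).
Qed.

(* The corner ring of the idempotent [e] contains the 2 x 2 matrix units
   e11 = [e], e12 = [u], e21 = [v], e22 = [v * u]. *)
Definition matrix_units (R : pzRingType) (e u v : R) : Prop :=
  [/\ e * e = e, e * u = u, v * e = v, u * v = e & u * e = 0 /\ e * v = 0].

Lemma exists_matrix_units (R : pzRingType) (r s : R) : periodic R ->
  r * r = 0 -> s * s = 0 -> ~ nilpotent_elt (r * s) ->
  exists n e u v, [/\ matrix_units e u v, e <> 0, e = (r * s) ^+ n.+1,
    u = e * r & v = s * (r * s) ^+ n * e].
Proof.
move=> perR rr ss nnil; have [n ee] := periodic_idempotent (r * s) perR.
set e := (r * s) ^+ n.+1 in ee.
have rse : r * s * (r * s) ^+ n = e by rewrite -exprS.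
have re : r * e = 0 by rewrite -rse; nc (tt, rr).
have es : e * s = 0 by rewrite /e exprSr; nc (tt, ss).
exists n, e, (e * r), (s * (r * s) ^+ n * e); split=> //; last by move=> e0; apply: nnil; exists n.+1.
by split; [|nc (tt, ee)|nc (tt, ee)|move: rse; rewrite -mulrA => rse; nc (tt, rse, ee)|split; [nc (tt, re)|nc (tt, es)]].
Qed.

(** Levitzki's lemma for z = a x b: the idempotents absorb into z, so a general multiplier y may be
    replaced by b y a. *)
Lemma corner_levitzki (P : pzRingType) (a b : P) n : prime_ring P ->
  a * a = a -> b * b = b ->
  (forall x y, (a * x * b * (b * y * a)) ^+ n * (a * x * b) = 0) -> a = 0 \/ b = 0.
Proof.
move=> primeP aa bb ab0; apply: (primeP) => x; apply: (@levitzki P _ n primeP) => y.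
rewrite -[RHS](ab0 x y); elim: n {ab0} => [|n IH]; first by rewrite !mul1r.
set z := a * x * b in IH *.
rewrite !exprS -[LHS]mulrA IH -[RHS]mulrA exprM_shift; move: ((_ * z) ^+ n) => T.
rewrite /z.
by nc (tt, aa, bb).
Qed.

Lemma nilpotent_mulC (R : pzRingType) (r s : R) :
  nilpotent_elt (r * s) -> nilpotent_elt (s * r).
Proof.
by case=> m e; exists m.+1; rewrite exprSr mulrA exprM_shift e mulr0 mul0r.
Qed.

Lemma nilpotent_or_unit (R : pzRingType) :
  (forall e : R, e * e = e -> e = 0 \/ e = 1) -> periodic R ->
  forall x : R, nilpotent_elt x \/ exists x', inverse_pair x x'.
Proof.
move=> idem perR x; have [n e] := periodic_idempotent x perR.
have [x0|x1] := idem _ e; first by left; exists n.+1.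
by right; exists (x ^+ n); split; rewrite -?exprS -?exprSr.
Qed.

(** ** Engel condition *)

(** The group commutator of p.1 with y, and its inverse, where p.2 is the inverse of p.1; the
    inverse is carried along because R has no inversion. *)
Definition comm_pair (R : pzRingType) (y y' : R) (p : R * R) : R * R :=
  (p.2 * y' * p.1 * y, y' * p.2 * y * p.1).

Definition engel_law (R : pzRingType) (n : nat) : Prop :=
  forall x x' y y' : R, inverse_pair x x' -> inverse_pair y y' ->
  (iter n (comm_pair y y') (x, x')).1 = 1.

(** Because b a = 0, the m-th iterated commutator of 1 + a with 1 + b is exactly 1 + a b^m. *)
Lemma engel_annihil (R : pzRingType) n (a b g' : R) : engel_law R n ->
  a * a = 0 -> b * a = 0 -> inverse_pair (1 + b) g' -> a * b ^+ n = 0.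
Proof.
move=> eng aa ba bg; have [gg' g'g] := bg.
have g'a : g' * a = a.
  by rewrite -[a in LHS](_ : (1 + b) * a = a) ?mulrA ?g'g ?mul1r //; nc (tt, ba).
have ga : inverse_pair (1 + a) (1 - a) by split; nc (tt, aa).
suff H m : iter m (comm_pair (1 + b) g') (1 + a, 1 - a) = (1 + a * b ^+ m, 1 - a * b ^+ m).
  by have := eng _ _ _ _ ga bg; rewrite H /= => /eqP; rewrite addrC -subr_eq0 addrK => /eqP.
elim: m => [|m IH] /=; first by rewrite mulr1.
rewrite IH /comm_pair /= exprSr.
set c := a * b ^+ m; have g'c : g' * c = c by rewrite mulrA g'a.
have ca : b * c = 0 by rewrite mulrA ba mul0r.
have cc : c * c = 0.
  by rewrite /c; case: m {IH c g'c ca} => [|m]; [nc (tt, aa)|rewrite exprSr; nc (tt, ba)].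
rewrite mulrA -/c.
have g'gb : g' * b = 1 - g' by rewrite -g'g; nc tt.
by congr pair; nc (tt, g'c, ca, cc, g'gb).
Qed.

(* For the involutions [t] and [t'] below, [x = t * t'] has order 6 and is inverted
   by [t], so that the iterated commutator of [x] with [t] is [x ^ ((-2) ^ n)]. *)
Lemma engel_no_matrix_units (R : pzRingType) n (e u v : R) : engel_law R n ->
  matrix_units e u v -> e = 0.
Proof.
move=> eng [ee eu ve uv [ue ev]].
have uu : u * u = 0 by rewrite -eu; nc (tt, ue).
have vv : v * v = 0 by rewrite -{1}ve; nc (tt, ev).
pose t := 1 - e - v * u + u + v; pose t' := 1 + u - v * u - v * u.
have tt1 : t * t = 1 by rewrite /t; nc (tt, ee, eu, ve, uv, ue, ev, uu, vv).
have tt2 : t' * t' = 1 by rewrite /t'; nc (tt, ee, eu, ve, uv, ue, ev, uu, vv).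
pose x := t * t'; pose x' := t' * t.
have xx' : inverse_pair x x' by rewrite /x /x'; clearbody t t'; split; nc (tt, tt1, tt2).
have [_ x'x] := xx'.
have eng_t m : exists w, [/\ (iter m (comm_pair t t) (x, x')).1 = w ^+ (2 ^ m),
    (iter m (comm_pair t t) (x, x')).2 = (t * w * t) ^+ (2 ^ m) & w = x \/ w = x'].
  elim: m => [|m [w [e1 e2 wE]]].
    by exists x; rewrite /= !expr1 /x /x'; split; [|clearbody t t'; nc (tt, tt1, tt2)|left].
  exists (t * w * t); rewrite /= /comm_pair /= e1 e2.
  have tX z k : t * z ^+ k * t = (t * z * t) ^+ k.
    elim: k => [|k IH]; first by rewrite mulr1.
    by rewrite !exprS -IH; clearbody t; nc (tt, tt1).
  have t2 z : t * (t * z * t) * t = z by clearbody t; nc (tt, tt1).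
  split.
  - have assoc A B : A * t * B * t = A * (t * B * t) by rewrite !mulrA.
    by rewrite assoc tX -exprD expnS mul2n addnn.
  - by rewrite tX t2 -exprD expnS mul2n addnn.
  by case: wE => ->; [right|left]; rewrite /x /x'; clearbody t t'; nc (tt, tt1, tt2).
have x6 z : z = x \/ z = x' -> z ^+ 8 = z ^+ 2.
  have x3 : x * x * x = 1 - e - v * u - e - v * u.
    by rewrite /x /t /t'; nc (tt, ee, eu, ve, uv, ue, ev, uu, vv).
  have x6 : x ^+ 6 = 1.
    have -> : x ^+ 6 = x * x * x * (x * x * x) by nc tt.
    by rewrite x3; nc (tt, ee, eu, ve, uv, ue, ev, uu, vv).
  have x'6 : x' ^+ 6 = 1.
    have : x' ^+ 6 * x ^+ 6 = 1 by clearbody x x'; nc (tt, x'x).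
    by rewrite x6 mulr1.
  by case=> ->; rewrite (exprD _ 6 2) ?x6 ?x'6 mul1r.
have [w [e1 _ wE]] := eng_t n; have := eng _ _ t t xx' (conj tt1 tt1); rewrite e1 => w1.
have w2 : w ^+ 2 = 1.
  (* 2^(2m+1) is congruent to 2 modulo 6. *)
  have w8 m : w ^+ (2 ^ (m.*2.+1)) = w ^+ 2.
    elim: m => [|m IH]; first by rewrite expn1.
    by rewrite doubleS 2!expnS mulnA mulnC exprM IH -exprM (x6 _ wE).
  by rewrite -(w8 n) -addnn -addnS expnD exprM w1 expr1n.
have : x ^+ 2 = 1.
  case: wE w2 => -> // e2; have [xx _] := xx'.
  have : x ^+ 2 * x' ^+ 2 = 1 by clearbody x x'; nc (tt, xx).
  by rewrite e2 mulr1.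
(* This extracts the lower left entry, which is 1 in x^2 and 0 in the identity. *)
move=> /(congr1 (fun z => u * z * e)); rewrite mulr1 ue => <-.
by rewrite /x /t /t'; nc (tt, ee, eu, ve, uv, ue, ev, uu, vv).
Qed.

Section EngelPeriodicPrime.
Variables (P : pzRingType) (n p : nat).
Hypotheses (nz1 : 1 != 0 :> P) (prp : prime p) (p0 : p%:R = 0 :> P).
Hypotheses (primeP : prime_ring P) (perP : periodic P) (eng : engel_law P n).

(** For r in e P f and s in f P e, r s is nilpotent since matrix units are excluded, and
    [engel_annihil] gives r (s r)^n = 0 with the fixed n that Levitzki's lemma needs. *)
Lemma engel_idempotent (e : P) : e * e = e -> e = 0 \/ e = 1.
Proof.
move=> ee; pose f := 1 - e.
have ff : f * f = f by rewrite /f; nc (tt, ee).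
have ef : e * f = 0 by rewrite /f; nc (tt, ee).
have fe : f * e = 0 by rewrite /f; nc (tt, ee).
have [x y||f0] := @corner_levitzki P e f n primeP ee ff; [|by left|]; last first.
  by right; apply/esym/eqP; rewrite -subr_eq0 -/f f0.
set r := e * x * f; set s := f * y * e.
have rr : r * r = 0 by rewrite /r; nc (tt, fe).
have ss : s * s = 0 by rewrite /s; nc (tt, ef).
have [nil|nnil] := EM (nilpotent_elt (r * s)); last first.
  have [m [e' [u [v [mu nz _ _ _]]]]] := exists_matrix_units perP rr ss nnil.
  by case: nz; apply: engel_no_matrix_units eng mu.
have [g' inv _] := nilpotent_inv (nilpotent_mulC nil).
rewrite exprM_shift; apply: (engel_annihil eng rr _ inv).
by rewrite -mulrA rr mulr0.
Qed.

(** A square-zero a vanishes by Levitzki's lemma: s a is a unit, which forces a = 0, or nilpotent,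
    and then [engel_annihil] applies. With only trivial idempotents, P is then a division ring. *)
Lemma periodic_engel_commutative (x y : P) : x * y = y * x.
Proof.
have sq0 (a : P) : a * a = 0 -> a = 0.
  move=> aa; apply: (@levitzki P _ n primeP) => s; rewrite exprM_shift.
  have saa : s * a * a = 0 by rewrite -mulrA aa mulr0.
  have [nil|[w [_ wsa]]] := nilpotent_or_unit engel_idempotent perP (s * a).
    have [g' inv _] := nilpotent_inv nil.
    exact: (engel_annihil eng aa saa inv).
  have : w * (s * a * a) = a by rewrite mulrA wsa mul1r.
  by rewrite saa mulr0 => <-; rewrite mul0r.
have red (a : P) : nilpotent_elt a -> a = 0.
  case=> m; elim/ltn_ind: m a => -[|[|m]] IH a am.
  - by have /eqP := nz1; rewrite -[X in _ <> X]am expr0 => /(_ erefl).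
  - by rewrite expr1 in am.
  apply: (IH m.+1) => //; apply: sq0.
  by rewrite -exprD addnS -addSn exprD am mul0r.
apply: (periodic_division_commutative nz1 prp p0 _ perP) => z nz.
by have [/red|] := nilpotent_or_unit engel_idempotent perP z.
Qed.

End EngelPeriodicPrime.

(** ** Solvable groups of units *)

Lemma two_pchar (R : pzRingType) p : prime p -> p%:R = 0 :> R ->
  2%:R = 0 :> R \/ exists h : R, h * 2%:R = 1.
Proof.
move=> prp p0; have [p2|odd_p] := even_prime prp; first by left; rewrite -p2.
right; exists (p./2.+1)%:R; rewrite -natrM (_ : _ * _ = p + 1)%N ?natrD ?p0 ?add0r //.
by rewrite -[in RHS](odd_double_half p) odd_p muln2 doubleS addn1 add1n.
Qed.

Section SolvableUnits.
Variables (R : pzRingType) (d : nat).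
Hypothesis two : 2%:R = 0 :> R \/ exists h : R, h * 2%:R = 1.
Hypothesis sol : forall x x' : R, derived_pair (@inverse_pair R) d x x' -> x = 1.

Let D := derived_pair (@inverse_pair R).

Let D0 m x x' : D m x x' -> inverse_pair x x'.
Proof.
apply: derived_pair_sub => [||a a' b b' [aa' a'a] [bb' b'b]].
- by split; rewrite mulr1.
- by move=> a a' [].
- by split; nc (tt, aa', a'a, bb', b'b).
Qed.

(** * Square-zero elements with nilpotent product *)

Section NilpotentProduct.
Variables r s : R.
Hypotheses (rr : r * r = 0) (ss : s * s = 0) (nil : nilpotent_elt (r * s)).
Let rho := r * s.

(** Coefficients c for which 1 + c r and 1 + s c behave like elementary 2 x 2 matrices. *)
Let C (c : R) := [/\ c * rho = rho * c, r * c * r = 0 & s * c * s = 0].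

Let Q m (q : R) := forall c, C c ->
  D m (1 + q * c * r) (1 - q * c * r) /\ D m (1 + s * q * c) (1 - s * q * c).

(** The recursion computes the degree in rho of q j j, where q = rho^k and j = q q rho: one
    commutator step turns the coefficient q into q j j. *)
Fixpoint sq_zero_bound (m : nat) : nat :=
  if m is k.+1 then sq_zero_bound k + (sq_zero_bound k + sq_zero_bound k).+1.*2 else 0.

(* [h] is diagonal up to a nilpotent term: conjugation by it multiplies [q * c * r]
   by [1 + j] on both sides, so that commutators with [h] raise the power of [rho]. *)
Lemma sq_zero_derived m : Q m (rho ^+ sq_zero_bound m).
Proof.
have rrho : r * rho = 0 by rewrite /rho mulrA rr mul0r.
have rhos : rho * s = 0 by rewrite /rho -mulrA ss mulr0.
have CD m' c : C c -> forall q, q = rho ^+ m' -> C (q * c).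
  move=> [crho rcr scs] q ->; have rc : rho ^+ m' * rho = rho * rho ^+ m' by rewrite -exprS -exprSr.
  split; first by nc (tt, rc, crho).
    case: m' {rc} => [|m']; first by rewrite mul1r.
    by rewrite exprS; nc (tt, rrho).
  case: m' {rc} => [|m']; first by rewrite mul1r.
  have crho' := esym crho; by rewrite exprSr; nc (tt, crho', rhos).
elim: m => [|m IH] c Cc.
  have [crho rcr scs] := Cc.
  rewrite /= expr0 mul1r mulr1; split; apply: derived_pair0; split.
  - by nc (tt, rcr).
  - by nc (tt, rcr).
  - by nc (tt, scs).
  - by nc (tt, scs).
set k := sq_zero_bound m in IH *; set q := rho ^+ k in IH *.
have rho_q : rho * q = q * rho by rewrite /q -exprS -exprSr.
have nil_j : nilpotent_elt (q * q * rho).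
  case: nil => n rn; exists n; have -> : q * q * rho = rho ^+ (k + k).+1.
    by rewrite exprSr exprD.
  by rewrite -exprM mulnC exprM rn expr0n; case: n rn => // rn; rewrite /= -[RHS]rn.
have [a [aI1 aI2] acomm] := nilpotent_inv nil_j.
have C1 : C 1 by split; rewrite ?mulr1 ?mul1r.
have Cq : C q by have := CD k 1 C1 q erefl; rewrite mulr1.
have Cqq : C (q * q) by have := CD k q Cq q erefl.
have [_ rqr sqs] := Cq; have [_ rqqr sqqs] := Cqq.
have a_q : a * q = q * a by apply: acomm; nc (tt, rho_q).
have a_rho : a * rho = rho * a by apply: acomm; nc (tt, rho_q).
have qqrho_a : q * q * rho * a = 1 - a by rewrite -[X in X - a]aI1; nc tt.
have r_qrho : r * q * rho = 0 by rewrite -mulrA -rho_q mulrA rrho mul0r.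
have r_qqrho : r * q * q * rho = 0 by rewrite -mulrA -rho_q mulrA r_qrho mul0r.
have r_a : r * a = r.
  have : r * ((1 + q * q * rho) * a) = r by rewrite aI1 mulr1.
  by move=> {2}<-; nc (tt, r_qqrho).
have a_s : a * s = s.
  have : a * (1 + q * q * rho) * s = s by rewrite aI2 mul1r.
  by move=> {2}<-; nc (tt, rhos).
have r_qa : r * q * a = r * q by rewrite -mulrA -a_q mulrA r_a.
have r_qqa : r * q * q * a = r * q * q by rewrite -mulrA -a_q mulrA r_qa.
have Ca : C a by split; [|rewrite r_a|rewrite -mulrA a_s].
have rs : r * s = rho by [].
rewrite mulrA in rqqr; rewrite mulrA in sqqs.
(* Four elementary factors of level m, with coefficients 1 and a = (1 + j)^-1. *)
pose h := (1 - s * q * a) * (1 + q * 1 * r) * ((1 + s * q * 1) * (1 - q * a * r)).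
pose h' := (1 + q * a * r) * (1 - s * q * 1) * ((1 - q * 1 * r) * (1 + s * q * a)).
have Dh : D m h h'.
  have [D1 D2] := IH _ C1; have [D3 D4] := IH _ Ca.
  by apply: derived_pairM; apply: derived_pairM => //; apply: derived_pairV.
have hE : h = 1 + q * q * rho - s * q * q * a * r.
  rewrite /h; nc (tt, rs, rho_q, a_q, a_rho, qqrho_a, r_qrho, r_qqrho, r_a, a_s, r_qa, r_qqa, rqr, rqqr, sqs, sqqs, rr, ss, rhos, rrho).
have h'E : h' = a + s * q * q * r.
  rewrite /h'; nc (tt, rs, rho_q, a_q, a_rho, qqrho_a, r_qrho, r_qqrho, r_a, a_s, r_qa, r_qqa, rqr, rqqr, sqs, sqqs, rr, ss, rhos, rrho).
set j := q * q * rho in hE nil_j *.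
have rh' : r * h' = (1 + j) * r by rewrite h'E /j; nc (tt, r_a, rs, rho_q).
have h's : h' * s = s * (1 + j) by rewrite h'E /j; nc (tt, a_s, rs).
have j_rho : j * rho = rho * j by rewrite /j; nc (tt, rho_q).
have j_q : j * q = q * j by rewrite /j; nc (tt, rho_q).
have rj : r * j = 0 by rewrite /j; nc (tt, r_qqrho).
have js : j * s = 0 by rewrite /j; nc (tt, rhos).
(* The factor gained is (1 + j)^2 - 1. *)
have step b : C b -> D m.+1 (1 + q * (b * (j + j + j * j)) * r) (1 - q * (b * (j + j + j * j)) * r)
    /\ D m.+1 (1 + s * q * (b * (j + j + j * j))) (1 - s * q * (b * (j + j + j * j))).
  move=> Cb; have [D1 D2] := IH _ Cb; have [brho rbr sbs] := Cb.
  have [_ rqbr sqbs] := CD k b Cb q erefl; rewrite !mulrA in rqbr sqbs.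
  have bq : b * q = q * b by apply/commrX.
  have jb : j * b = b * j by rewrite /j; nc (tt, brho, bq).
  have hqbr : h * q * b * r = (1 + j) * q * b * r by rewrite hE; nc (tt, rqbr, j_q).
  have sqbh : s * q * b * h = s * q * b * (1 + j) by rewrite hE /j; nc (tt, sqbs).
  have sqbjh : s * q * b * j * h = s * q * b * j * (1 + j) by rewrite hE -/j; nc (tt, js, jb, j_q, sqbs).
  have [hh' h'h] := D0 Dh.
  split.
    have := derived_pairR (derived_pairV Dh) (derived_pairV D1).
    clearbody q j h h'.
    have q_j := esym j_q; have bj := esym jb.
    by congr (D _ _ _); nc (tt, hqbr, rh', hh', rqbr, q_j, bj, rj).
  have := derived_pairR Dh (derived_pairV D2).
  clearbody q j h h'.
  by congr (D _ _ _); nc (tt, sqbh, sqbjh, h's, h'h, sqbs, j_q, jb, js).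
have qE : q * j * j = rho ^+ sq_zero_bound m.+1.
  by rewrite /j /q -!(exprD, exprSr) /=; congr (_ ^+ _); rewrite -addnn !addnS !addSn !addnA.
have [rho_c rcr scs] := Cc.
have CJ b : C b -> b * j = j * b.
  move=> [brho _ _]; have bq : b * q = q * b by apply/commrX.
  by rewrite /j; nc (tt, brho, bq).
have jc := esym (CJ _ Cc).
(* The gained factor is j j when 2 = 0. Otherwise it is 2 (1 + j/2) j, and c1 carries the inverse of
   2 (1 + j/2) and a further j. Both cases leave j j c. *)
rewrite -qE; case: two => [t0|[h0 h02]].
  have [D1 D2] := step c Cc; have jj0 : j + j = 0 by rewrite -mulr2n -mulr_natr t0 mulr0.
  rewrite jj0 add0r in D1 D2; split.
    by move: D1; congr (D _ _ _); nc (tt, jc).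
  by move: D2; congr (D _ _ _); nc (tt, jc).
have nat2 y : 2%:R * y = y * 2%:R :> R by rewrite mulr_natl mulr_natr.
have h0C y : h0 * y = y * h0.
  have e2 := nat2 h0; rewrite h02 in e2.
  transitivity (h0 * (y * (2%:R * h0))); first by rewrite e2 mulr1.
  by rewrite [y * _]mulrA -nat2 !mulrA h02 mul1r.
have [b0 [bI1 bI2] b0comm] : exists2 b0, inverse_pair (1 + h0 * j) b0 &
    forall y, h0 * j * y = y * (h0 * j) -> b0 * y = y * b0.
  apply: nilpotent_inv; case: nil_j => n jn; exists n.
  by rewrite exprMn_comm ?jn ?mulr0.
pose c1 := j * b0 * h0 * c.
have h0rho := h0C rho; have b0rho : b0 * rho = rho * b0.
  by apply: b0comm; nc (tt, h0rho, j_rho).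
have h0j := h0C j; have b0j : b0 * j = j * b0.
  by apply: b0comm; nc (tt, h0j).
have [rb0 b0s] : r * b0 = r /\ b0 * s = s.
  have h0r := h0C r; split.
    have : r * ((1 + h0 * j) * b0) = r by rewrite bI1 mulr1.
    by move=> {2}<-; have rh0 := esym h0r; nc (tt, rh0, rj).
  have : b0 * (1 + h0 * j) * s = s by rewrite bI2 mul1r.
  by move=> {2}<-; nc (tt, js).
have Cc1 : C c1.
  split; first by rewrite /c1; nc (tt, rho_c, j_rho, h0rho, b0rho).
    by rewrite /c1; nc (tt, rj).
  have jb0 := esym b0j; have jh0 := esym h0j.
  by rewrite /c1; nc (tt, jb0, jh0, jc, js).
have c1E : c1 * (j + j + j * j) = j * j * c.
  have h0c := h0C c; have b0c : b0 * c = c * b0.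
    by apply: b0comm; nc (tt, h0c, jc).
  have b0h0 := esym (h0C b0).
  have e : j + j + j * j = 2%:R * (1 + h0 * j) * j.
    have h20 : 2%:R * h0 = 1 by rewrite nat2.
    by rewrite mulrDr mulr1 mulrA h20; nc tt.
  rewrite e /c1.
  have -> : j * b0 * h0 * c * (2%:R * (1 + h0 * j) * j) = h0 * 2%:R * (j * c * (b0 * (1 + h0 * j)) * j).
    have jh0 := esym h0j; have ch0 := esym h0c; have cj := esym jc.
    by nc (tt, b0h0, jh0, ch0, cj, b0c, b0j).
  by rewrite bI2 h02; nc (tt, jc).
have [D1 D2] := step c1 Cc1; rewrite c1E in D1 D2; split.
  by move: D1; congr (D _ _ _); nc (tt, jc).
by move: D2; congr (D _ _ _); nc (tt, jc).
Qed.

(** At level d the derived group is trivial; the resulting exponent depends on d alone, as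
    Levitzki's lemma requires. *)
Lemma sq_zero_nilpotent_bound : rho ^+ sq_zero_bound d * r = 0.
Proof.
have [|/sol e _] := @sq_zero_derived d 1; first by split; rewrite ?mulr1 ?mul1r.
by move/(congr1 (fun z => z - 1)): e; rewrite subrr addrC addKr mulr1.
Qed.

End NilpotentProduct.

(** With a third index k available, 1 + E i j is the commutator of 1 + E i k and 1 + E k j, so it
    lies in every derived group. *)
Lemma solvable_no_matrix_units3 (e : R) (a b : 'I_3 -> R) : e * e = e ->
  (forall i j, b i * a j = if i == j then e else 0) -> e = 0.
Proof.
move=> ee ba; pose E i j := a i * e * b j.
have EE i j k l : E i j * E k l = if j == k then E i l else 0.
  have := ba j k; rewrite /E; case: eqP => _ jk; nc (tt, jk, ee).
have DE m i j : i != j -> D m (1 + E i j) (1 - E i j).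
  elim: m i j => [|m IH] i j ij.
    have ii := EE i j i j; rewrite eq_sym (negbTE ij) in ii.
    by apply: derived_pair0; split; nc (tt, ii).
  have [k ik kj] : exists2 k : 'I_3, i != k & k != j.
    (* The three indices sum to 3. *)
    exists (3 - i - j : nat)%:R; case: i ij => -[|[|[|]]] ?; case: j => -[|[|[|]]] ? //.
  have ik_kj := EE i k k j; have kj_ik := EE k j i k; have ik_ik := EE i k i k.
  have kj_kj := EE k j k j; have ij_ik := EE i j i k; have ij_kj := EE i j k j.
  have kj_ij := EE k j i j.
  rewrite eqxx in ik_kj; rewrite eq_sym (negbTE ij) in kj_ik.
  rewrite eq_sym (negbTE ik) in ik_ik; rewrite eq_sym (negbTE kj) in kj_kj.
  rewrite eq_sym (negbTE ij) in ij_ik; rewrite eq_sym (negbTE kj) in ij_kj.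
  rewrite eq_sym (negbTE ij) in kj_ij.
  have := derived_pairR (IH _ _ ik) (IH _ _ kj).
  by congr (D _ _ _); move: ik_kj kj_ik ik_ik kj_kj ij_ik ij_kj kj_ij;
    move: (E i k) (E k j) (E i j) => x y z h1 h2 h3 h4 h5 h6 h7;
    nc (tt, h1, h2, h3, h4, h5, h6, h7).
have /sol : D d (1 + E ord0 ord_max) (1 - E ord0 ord_max) by exact: DE.
move=> /(congr1 (fun z => z - 1)); rewrite subrr addrC addKr => E0.
have b0 := ba ord0 ord0; have b2 := ba ord_max ord_max; rewrite !eqxx in b0 b2.
have : b ord0 * E ord0 ord_max * a ord_max = e by rewrite /E; nc (tt, b0, b2, ee).
by rewrite E0 mulr0 mul0r.
Qed.

Section DiagonalConjugation.
Variables (e u v alpha alpha' beta : R).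
Hypothesis mu : matrix_units e u v.
Hypotheses (ea : e * alpha = alpha) (ae : alpha * e = alpha).
Hypotheses (ea' : e * alpha' = alpha') (aa' : alpha * alpha' = e).
Hypotheses (a'e : alpha' * e = alpha') (a'a : alpha' * alpha = e).
Hypotheses (eb : e * beta = beta) (be : beta * e = beta).
Hypotheses (ab : alpha * beta = beta * alpha) (ba : beta * (alpha * alpha - e) = e).

(* [h] is the diagonal matrix (alpha, alpha^-1), the standard product of elementary
   matrices; its commutator with [1 + c * u] is [1 + (alpha ^ 2 - e) * c * u]. *)
Lemma diagonal_conjugation m c : e * c = c -> c * e = c -> alpha * c = c * alpha ->
  D m (1 + c * u) (1 - c * u) /\ D m (1 + v * c) (1 - v * c).
Proof.
have [ee eu ve uv [ue ev]] := mu.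
elim: m c => [|m IH] c ec ce ac.
  have uc : u * c = 0 by rewrite -ec; nc (tt, ue).
  have cv : c * v = 0 by rewrite -ce; nc (tt, ev).
  by split; apply: derived_pair0; split; nc (tt, uc, cv).
pose h := 1 - e - v * u + alpha + v * alpha' * u.
pose h' := 1 - e - v * u + alpha' + v * alpha * u.
have ua : u * alpha = 0 by rewrite -ea mulrA ue mul0r.
have ua' : u * alpha' = 0 by rewrite -ea' mulrA ue mul0r.
have av : alpha * v = 0 by rewrite -ae -mulrA ev mulr0.
have a'v : alpha' * v = 0 by rewrite -a'e -mulrA ev mulr0.
have uu : u * u = 0 by rewrite -eu; nc (tt, ue).
have vv : v * v = 0 by rewrite -{1}ve; nc (tt, ev).
have Dh : D m h h'.
  have [D1 _] := IH _ ea ae erefl.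
  have [_ D2] := IH alpha' ea' a'e (etrans aa' (esym a'a)).
  have [D3 D4] := IH e ee ee (etrans ae (esym ea)).
  have := derived_pairM (derived_pairM (derived_pairM D1 (derived_pairV D2)) D1)
    (derived_pairM (derived_pairM (derived_pairV D3) D4) (derived_pairV D3)).
  by congr (D _ _ _); rewrite /h /h'; nc (tt, ee, eu, ve, uv, ue, ev, ea, ae, ea', a'e, aa', a'a, ua, ua', av, a'v, uu, vv).
(* c divided by alpha^2 - e: the commutator with h multiplies it back to c. *)
pose b := beta * c.
have eb' : e * b = b by rewrite /b mulrA eb.
have be' : b * e = b by rewrite /b -mulrA ce.
have ab' : alpha * b = b * alpha by rewrite /b; nc (tt, ab, ac).
have [D1 D2] := IH b eb' be' ab'.
have ub : u * b = 0 by rewrite -eb' mulrA ue mul0r.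
have bv : b * v = 0 by rewrite -be' -mulrA ev mulr0.
have cE : alpha * alpha * b = b + c.
  have aab : alpha * alpha * beta = beta + e.
    by rewrite -ba -[alpha * alpha * beta]mulrA ab mulrA ab; nc (tt, be).
  by rewrite /b mulrA aab mulrDl ec.
have baa : b * alpha * alpha = b + c by rewrite -cE; nc (tt, ab').
have aba : alpha * b * alpha = b + c by rewrite -baa ab'.
have uc : u * c = 0 by rewrite -ec; nc (tt, ue).
have cv : c * v = 0 by rewrite -ce; nc (tt, ev).
clearbody b; split.
  have := derived_pairR (derived_pairV Dh) (derived_pairV D1).
  by congr (D _ _ _); rewrite /h /h'; nc (tt, aba, ee, eu, ve, uv, ue, ev, ea, ae, ea', a'e, aa', a'a, ua, ua', av, a'v, uu, vv, eb', be', ub, bv, ec, ce, uc, cv).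
have := derived_pairR Dh (derived_pairV D2).
by congr (D _ _ _); rewrite /h /h'; nc (tt, aba, ee, eu, ve, uv, ue, ev, ea, ae, ea', a'e, aa', a'a, ua, ua', av, a'v, uu, vv, eb', be', ub, bv, ec, ce, uc, cv).
Qed.

Lemma solvable_no_regular_diagonal : e = 0.
Proof.
have [ee eu ve uv _] := mu.
have [/sol + _] := @diagonal_conjugation d e ee ee (etrans ae (esym ea)).
move=> /(congr1 (fun z => z - 1)); rewrite subrr addrC addKr eu => u0.
by rewrite -uv u0 mul0r.
Qed.

End DiagonalConjugation.
End SolvableUnits.

Section SolvablePeriodicPrime.
Variables (P : pzRingType) (d p : nat).
Hypotheses (nz1 : 1 != 0 :> P) (prp : prime p) (p0 : p%:R = 0 :> P).
Hypotheses (primeP : prime_ring P) (perP : periodic P).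
Hypothesis sol : forall x x' : P, derived_pair (@inverse_pair P) d x x' -> x = 1.

Let two := two_pchar prp p0.

(** Were every such r s nilpotent, [sq_zero_nilpotent_bound] would bound the indices and
    [corner_levitzki] would give a = 0 or b = 0. *)
Lemma orthogonal_idempotents_link (a b : P) : a * a = a -> b * b = b ->
  a * b = 0 -> b * a = 0 -> a <> 0 -> b <> 0 ->
  exists r s, [/\ a * r * b = r, b * s * a = s & ~ nilpotent_elt (r * s)].
Proof.
move=> aa bb ab ba nza nzb; apply: contrapT => nil.
have [x y|//|//] := @corner_levitzki P a b (sq_zero_bound d) primeP aa bb.
apply: (sq_zero_nilpotent_bound two sol); [nc (tt, ba)|nc (tt, ab)|].
apply: contrapT => nnil; apply: nil; exists (a * x * b), (b * y * a).
by split=> //; nc (tt, aa, bb).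
Qed.

(** If 1 - e - v u were nonzero, linking it to e would give a part e' of e with three orthogonal
    copies, that is 3 x 3 matrix units. *)
Lemma matrix_units_full (e u v : P) : matrix_units e u v -> e <> 0 -> e + v * u = 1.
Proof.
move=> [ee eu ve uv [ue ev]] nze; apply: contrapT => n1.
pose g := 1 - e - v * u.
have gg : g * g = g by rewrite /g; nc (tt, ee, eu, ve, uv, ue, ev).
have eg : e * g = 0 by rewrite /g; nc (tt, ee, ev).
have ge : g * e = 0 by rewrite /g; nc (tt, ee, ue).
have ug : u * g = 0 by rewrite /g; nc (tt, ue, uv, eu).
have gv : g * v = 0 by rewrite /g; nc (tt, ev, uv, ve).
have nzg : g <> 0 by move=> g0; apply: n1; rewrite -[LHS]addr0 -g0 /g; nc tt.
have [r [s [rE sE nnil]]] := orthogonal_idempotents_link ee gg eg ge nze nzg.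
clearbody g.
have gr : g * r = 0 by rewrite -rE; nc (tt, ge).
have er : e * r = r by rewrite -rE; nc (tt, ee).
have rg : r * g = r by rewrite -rE; nc (tt, gg).
have gs : g * s = s by rewrite -sE; nc (tt, gg).
have se : s * e = s by rewrite -sE; nc (tt, ee).
have rr : r * r = 0 by rewrite -rE; nc (tt, ge).
have ss : s * s = 0 by rewrite -sE; nc (tt, eg).
have [n [e' [u' [v' [[ee' eu' ve' uv' [ue' ev']] nze' e'E u'E v'E]]]]] :=
  exists_matrix_units perP rr ss nnil.
have e_e' : e * e' = e' by rewrite e'E exprS; nc (tt, er).
have e'_e : e' * e = e' by rewrite e'E exprSr; nc (tt, se).
have gv' : g * v' = v' by rewrite v'E; nc (tt, gs).
have u'g : u' * g = u' by rewrite u'E; nc (tt, rg).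
pose a (i : 'I_3) := nth 0 [:: e'; v * e'; v'] i.
pose b (i : 'I_3) := nth 0 [:: e'; e' * u; u'] i.
have uv'0 : u * v' = 0 by rewrite -gv' mulrA ug mul0r.
have u'v0 : u' * v = 0 by rewrite -u'g -mulrA gv mulr0.
have ue'0 : u * e' = 0 by rewrite -e_e' mulrA ue mul0r.
have e'v0 : e' * v = 0 by rewrite -e'_e -mulrA ev mulr0.
apply: nze'; apply: (solvable_no_matrix_units3 sol (a := a) (b := b) ee').
by case=> -[|[|[|//]]] ? [] [|[|[|//]]] ?; rewrite /a /b /=;
  nc (tt, ee', eu', ve', uv', ue', ev', uv, e_e', e'_e, uv'0, u'v0, ue'0, e'v0).
Qed.

(** * The corner ring e P e *)

Section Corner.
Variables e u v : P.
Hypotheses (mu : matrix_units e u v) (nze : e <> 0).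

Let S (a : P) := e * a = a /\ a * e = a.

(** For f nonzero, f, f u and v f are matrix units too, so f + v f u = 1; compressing by e leaves f
    = e. *)
Lemma corner_idempotent f : S f -> f * f = f -> f = 0 \/ f = e.
Proof.
move=> [ef fe] ff; have [ee eu ve uv [ue ev]] := mu.
have [->|nzf] := EM (f = 0); [by left|right].
have : matrix_units f (f * u) (v * f).
  have uf : u * f = 0 by rewrite -ef mulrA ue mul0r.
  have fv : f * v = 0 by rewrite -fe -mulrA ev mulr0.
  by split; [|nc (tt, ff)|nc (tt, ff)|nc (tt, uv, fe, ff)|split; [nc (tt, uf)|nc (tt, fv)]].
move=> /matrix_units_full /(_ nzf) /(congr1 (fun z => e * z * e)).
by rewrite mulr1 ee => <-; nc (tt, ef, fe, ev).
Qed.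

Lemma corner_nilpotent_or_unit a : S a -> nilpotent_elt a \/ exists n, a ^+ n.+1 = e.
Proof.
move=> [ea ae]; have [n aa] := periodic_idempotent a perP.
have SX : S (a ^+ n.+1).
  by split; [rewrite exprS mulrA ea|rewrite exprSr -mulrA ae].
by have [an|an] := corner_idempotent SX aa; [left; exists n.+1|right; exists n].
Qed.

(** Levitzki's lemma: b = a x e is a unit of the corner, which forces a = 0, or nilpotent; then b =
    (b u) v is a product of two square-zero elements, so its index is bounded. *)
Lemma corner_sq_zero a : S a -> a * a = 0 -> a = 0.
Proof.
move=> [ea ae] aa; have [ee eu ve uv [ue ev]] := mu.
apply: (@levitzki P a (sq_zero_bound d).+1 primeP) => x.
set K := sq_zero_bound d.
have -> : (a * x) ^+ K.+1 * a = (a * x * e) ^+ K.+1 * a.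
  elim: K.+1 => [|k IH]; first by rewrite !mul1r.
  by rewrite !exprS -mulrA IH; set y := _ ^+ k; case: k @y {IH} => [|k] y;
    rewrite /y ?expr0 ?exprS; nc (tt, ea).
have Sb : S (a * x * e) by split; nc (tt, ea, ee).
have [nil|[n bn]] := corner_nilpotent_or_unit Sb; last first.
  suff a0 : a = 0 by rewrite [X in _ * X]a0 mulr0.
  by rewrite -[LHS]ae -bn exprS; move: (_ ^+ n) => y; nc (tt, aa).
have [eb be] := Sb; set b := a * x * e in nil eb be *.
have ub : u * b = 0 by rewrite -eb mulrA ue mul0r.
have vv : v * v = 0 by rewrite -{1}ve; nc (tt, ev).
have bu : b * u * v = b by rewrite -mulrA uv.
have bubu : b * u * (b * u) = 0 by nc (tt, ub).
have := @sq_zero_nilpotent_bound _ d two sol (b * u) v bubu vv; rewrite bu => /(_ nil) H.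
by rewrite exprSr -[X in _ * X * a]bu mulrA H !mul0r.
Qed.

Lemma corner_reduced a : S a -> nilpotent_elt a -> a = 0.
Proof.
move=> Sa [m]; elim/ltn_ind: m a Sa => -[|[|m]] IH a Sa am.
- by have /eqP := nz1; rewrite -[X in _ <> X]am expr0 => /(_ erefl).
- by rewrite expr1 in am.
have [ea ae] := Sa.
apply: (IH m.+1) => //; apply: corner_sq_zero.
  by split; [rewrite exprS mulrA ea|rewrite exprSr -mulrA ae].
by rewrite -exprD addnS -addSn exprD am mul0r.
Qed.

Lemma corner_unit a : S a -> a <> 0 -> exists n, a ^+ n.+1 = e.
Proof. by move=> Sa nza; have [/(corner_reduced Sa)|] := corner_nilpotent_or_unit Sa. Qed.

(** For any other a, both a and a^2 - e are units of the corner, which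
    [solvable_no_regular_diagonal] excludes. *)
Lemma corner_small a : S a -> [\/ a = 0, a = e | a = - e].
Proof.
move=> Sa; have [ea ae] := Sa; have [ee _ _ _ _] := mu.
have [->|nza] := EM (a = 0); first by constructor 1.
have [->|nz1a] := EM (a = e); first by constructor 2.
have [->|nz2a] := EM (a = - e); first by constructor 3.
have S1 : S (a - e) by split; nc (tt, ea, ae, ee).
have [|k a1k] := corner_unit S1; first by move/eqP; rewrite subr_eq0 => /eqP.
have Sb : S (a * a - e) by split; nc (tt, ea, ae, ee).
have [b0|n bn] := corner_unit Sb.
  case: nz2a; apply/eqP; rewrite -addr_eq0; apply/eqP.
  have -> : a + e = e * (a + e) by nc (tt, ea, ee).
  have e0 : (a - e) * (a + e) = 0 by rewrite -b0; nc (tt, ea, ae, ee).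
  by rewrite -[X in X * _]a1k exprSr -mulrA e0 mulr0.
have [m am] := corner_unit Sa nza.
have eX b k' : S b -> e * b ^+ k' = b ^+ k' * e.
  case=> eb be; case: k' => [|k']; first by rewrite expr0 mulr1 mul1r.
  by rewrite {1}exprS mulrA eb -exprS exprSr -mulrA be.
have am_e := eX _ m Sa; have bn_e := eX _ n Sb.
case: nze; apply: (@solvable_no_regular_diagonal _ d sol e u v a (a ^+ m * e) ((a * a - e) ^+ n * e) mu) => //.
- by rewrite mulrA am_e -mulrA ee.
- by rewrite mulrA -exprS am.
- by rewrite -mulrA ee.
- by rewrite -mulrA ea -exprSr.
- by rewrite mulrA bn_e -mulrA ee.
- by rewrite -mulrA ee.
- have c : a * (a * a - e) ^+ n = (a * a - e) ^+ n * a.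
    by apply: commrX; rewrite /GRing.comm; nc (tt, ea, ae).
  by rewrite mulrA c; nc (tt, ea, ae).
by rewrite -mulrA (proj1 Sb) -exprSr.
Qed.

(** P consists of the 2 x 2 matrices over a commutative corner; a commutator has trace zero, so its
    square is scalar by Cayley-Hamilton, and the scalar is 0, 1 or -1. *)
Lemma corner_commutator_sq_central (x y z : P) :
  (x * y - y * x) * (x * y - y * x) * z = z * ((x * y - y * x) * (x * y - y * x)).
Proof.
set w := x * y - y * x; have [ee eu ve uv [ue ev]] := mu; have e1 := matrix_units_full mu nze.
have comm (a b : P) : S a -> S b -> a * b = b * a.
  move=> /corner_small [] -> /corner_small [] ->; nc tt.
pose q11 (t : P) := e * t * e; pose q12 (t : P) := e * t * v.
pose q21 (t : P) := u * t * e; pose q22 (t : P) := u * t * v.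
have S11 t : S (q11 t) by split; rewrite /q11; nc (tt, ee).
have S12 t : S (q12 t) by split; rewrite /q12; nc (tt, ee, ve).
have S21 t : S (q21 t) by split; rewrite /q21; nc (tt, ee, eu).
have S22 t : S (q22 t) by split; rewrite /q22; nc (tt, eu, ve).
have prod a b : a * b = a * e * b + a * v * (u * b).
  by rewrite -[a in LHS]mulr1 -e1; nc tt.
have tr : q22 w = - q11 w.
  have M11 a b : q11 (a * b) = q11 a * q11 b + q12 a * q21 b.
    by rewrite /q11 /q12 /q21 [a * b]prod; nc (tt, ee).
  have M22 a b : q22 (a * b) = q21 a * q12 b + q22 a * q22 b.
    by rewrite /q22 /q12 /q21 [a * b]prod; nc (tt, ee).
  have B11 a b : q11 (a - b) = q11 a - q11 b by rewrite /q11; nc tt.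
  have B22 a b : q22 (a - b) = q22 a - q22 b by rewrite /q22; nc tt.
  rewrite /w B11 B22 !M11 !M22.
  have c1 := comm _ _ (S11 y) (S11 x); have c2 := comm _ _ (S22 y) (S22 x).
  have c3 := comm _ _ (S21 y) (S12 x); have c4 := comm _ _ (S12 y) (S21 x).
  by clearbody q11 q12 q21 q22; nc (tt, c1, c2, c3, c4).
have wE : w = q11 w + q12 w * u + v * q21 w - v * q11 w * u.
  rewrite -[X in v * X * u]opprK -tr -[LHS]mul1r -[LHS]mulr1 -e1 /q11 /q12 /q21 /q22.
  by move: (w) => a; nc tt.
move: (q11 w) (q12 w) (q21 w) (S11 w) (S12 w) (S21 w) wE => a b c Sa Sb Sc wE.
have ab := comm _ _ Sa Sb; have ac := comm _ _ Sa Sc; have bc := comm _ _ Sb Sc.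
have [ea ae] := Sa; have [eb be] := Sb; have [ec ce] := Sc.
have Sd : S (a * a + b * c) by split; nc (tt, ea, ae, eb, ce).
have -> : w * w = (a * a + b * c) + v * (a * a + b * c) * u.
  have u0 q : S q -> u * q = 0 by case=> + _; move=> <-; rewrite mulrA ue mul0r.
  have v0 q : S q -> q * v = 0 by case=> _; move=> <-; rewrite -mulrA ev mulr0.
  have ua := u0 _ Sa; have ub := u0 _ Sb; have uc := u0 _ Sc.
  have av := v0 _ Sa; have bv := v0 _ Sb; have cv := v0 _ Sc.
  by rewrite wE; nc (tt, uv, ua, ub, uc, av, bv, cv, ea, ae, eb, be, ec, ce, ab, ac, bc).
have [->|->|->] := corner_small Sd.
- by nc tt.
- by rewrite ve e1 mulr1 mul1r.
by rewrite mulrN ve mulNr -opprD e1 mulrN1 mulN1r.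
Qed.

End Corner.

(** Every element is nilpotent or a unit, so the nilpotent ones form an ideal. It is central by
    [solvable_adjoint_central], and central nilpotent elements of a prime ring vanish. *)
Lemma periodic_solvable_reduced : (forall e : P, e * e = e -> e = 0 \/ e = 1) ->
  forall x : P, nilpotent_elt x -> x = 0.
Proof.
move=> idem; have nu := nilpotent_or_unit idem perP.
have nil_nunit (x y : P) : nilpotent_elt x -> x * y = 1 \/ y * x = 1 -> False.
  case=> m; elim: m => [|m IH]; first by rewrite expr0 => one0; case/eqP: nz1.
  move=> xm xy; apply: IH => //; case: xy => xy.
    by rewrite -[LHS]mulr1 -xy mulrA -exprSr xm mul0r.
  by rewrite -[LHS]mul1r -xy -mulrA -exprS xm mulr0.
have nilM (x y : P) : nilpotent_elt x -> nilpotent_elt (y * x).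
  move=> nx; case: (nu (y * x)) => // -[z [_ zyx]].
  by case: (nil_nunit x (z * y)) => //; right; rewrite -mulrA.
have ideal_nil : ideal_like (@nilpotent_elt P).
  split=> [x y nx ny|a x /nilM //|a x nx]; last exact/nilpotent_mulC/nilM.
  case: (nu (x - y)) => // -[z [_ zxy]].
  have [t [t1 _] _] := nilpotent_inv (nilM _ z ny).
  have zx : z * x = 1 + z * y by rewrite -zxy; nc tt.
  by case: (nil_nunit (z * x) t (nilM _ z nx)); left; rewrite zx.
have nil0 : nilpotent_elt (0 : P) by exists 1%N; rewrite expr1.
move=> x nx; have cx : central x.
  apply: (solvable_adjoint_central primeP nil0 ideal_nil _ two (d := d)) nx.
    by move=> j /nilpotent_inv[j' + _]; exists j'.
  move=> y y' Dy; apply: (sol (x' := y')).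
  by apply: (derived_pair_morph (f := idfun)) Dy => ? ? [].
case: nx => m; elim: m => [|m IH]; first by rewrite expr0 => /eqP; rewrite (negbTE nz1).
by rewrite exprS => /(prime_central_reg primeP cx)[].
Qed.

Lemma periodic_solvable_identity (x y z : P) :
  (x * y - y * x) ^+ 2 * z - z * (x * y - y * x) ^+ 2 = 0.
Proof.
have [idem|] := EM (forall e : P, e * e = e -> e = 0 \/ e = 1).
  have nil0 := periodic_solvable_reduced idem.
  rewrite (periodic_division_commutative nz1 prp p0 _ perP x y); first by nc tt.
  by move=> t nzt; have [/nil0|] := nilpotent_or_unit idem perP t.
move=> /existsNP[e /not_implyP[ee /not_orP[nze ne1]]].
have ff : (1 - e) * (1 - e) = 1 - e by nc (tt, ee).
have [||//||r [s [rE sE nnil]]] := orthogonal_idempotents_link ee ff.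
- by nc (tt, ee).
- by nc (tt, ee).
- by move/eqP; rewrite subr_eq0 => /eqP e1; apply: ne1.
have rr : r * r = 0 by rewrite -rE; nc (tt, ee).
have ss : s * s = 0 by rewrite -sE; nc (tt, ee).
have [n [e' [u [v [mu nze' _ _ _]]]]] := exists_matrix_units perP rr ss nnil.
by rewrite !expr2 (corner_commutator_sq_central mu nze') subrr.
Qed.

End SolvablePeriodicPrime.

(** ** Engel condition in nilpotent subrings *)

Definition ad_right (R : pzRingType) (s t : R) : R := t * s - s * t.

Lemma iter_ad_right (R : pzRingType) (s t : R) k : iter k (ad_right s) t =
  \sum_(i < k.+1) (-1) ^+ i * 'C(k, i)%:R * (s ^+ i * t * s ^+ (k - i)).
Proof.
elim: k => [|k IH] /=; first by rewrite big_ord1 /= !expr0 bin0 !mul1r mulr1.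
rewrite IH /ad_right mulr_suml mulr_sumr.
rewrite [RHS]big_ord_recl /= bin0 subn0.
under [X in _ = _ + X]eq_bigr => i _.
  rewrite /bump /= add1n binS natrD subSS mulrDr mulrDl.
  over.
rewrite big_split /= addrA; congr (_ + _).
  rewrite [in RHS](@big_ord_recr R 0 +%R k) /= bin_small // mulr0 mul0r addr0.
  rewrite big_ord_recl /= bin0 subn0 [in RHS]exprSr [in RHS]mulrA.
  rewrite !expr0 !mulr1 !mul1r; congr (_ + _); apply: eq_bigr => i _.
  by rewrite /bump /= add1n -!mulrA -exprSr subnSK.
rewrite -sumrN; apply: eq_bigr => i _.
rewrite 2!exprS mulN1r !mulNr; congr (- _).
have c : (-1) ^+ i * 'C(k, i)%:R * s = s * ((-1) ^+ i * 'C(k, i)%:R) :> R.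
  by apply/esym/commrM; [apply/commr_sign|apply/commr_nat].
by rewrite !mulrA c !mulrA.
Qed.

Lemma iter_ad_right_pchar (R : pzRingType) p (s t : R) a :
  prime p -> p%:R = 0 :> R ->
  iter (p ^ a) (ad_right s) t = t * s ^+ (p ^ a) - s ^+ (p ^ a) * t.
Proof.
move=> prp p0; elim: a s t => [|a IH] s t; first by rewrite expn0 expr1.
have Fr z : iter p (ad_right s) z = ad_right (s ^+ p) z.
  rewrite iter_ad_right; case: p prp p0 {IH} => // p prp p0.
  rewrite big_ord_recl big_ord_recr /= big1 => [|i _]; last first.
    by rewrite bin_pchar0 ?mulr0 ?mul0r //; rewrite /bump /= add1n ltnS ltn_ord.
  rewrite /bump /= add1n subn0 subnn binn bin0 add0r !expr0 !mul1r !mulr1 /ad_right.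
  congr (_ + _); rewrite -signr_odd; have [p2|->] := even_prime prp; last by rewrite mulN1r.
  rewrite p2 /= expr0 mul1r; apply/eqP; rewrite -addr_eq0 -mulr2n -mulr_natr.
  by rewrite p2 in p0; rewrite p0 mulr0.
have -> : iter (p ^ a.+1) (ad_right s) t = iter (p ^ a) (ad_right (s ^+ p)) t.
  by rewrite expnSr iterM; apply: eq_iter.
by rewrite IH -!exprM -expnS.
Qed.

Section NilpotentFiltration.
Variables (R : pzRingType) (T : nat -> R -> Prop) (N n p : nat).
Hypotheses (TB : forall i x y, T i x -> T i y -> T i (x - y)).
Hypotheses (TM : forall i j x y, T i x -> T j y -> T (i + j) (x * y)).
Hypotheses (TS : forall i x, T i.+1 x -> T i x) (T0 : forall i, T i 0).
Hypothesis TN : forall x, T N x -> x = 0.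
Hypotheses (prp : prime p) (p0 : p%:R = 0 :> R) (eng : engel_law R n).

Local Notation S := (T 1).

(** Ideals of the nilpotent ring S; as for [ideal_like], the empty set qualifies, for Zorn's
    lemma. *)
Definition subring_ideal (I : R -> Prop) : Prop :=
  [/\ forall x, I x -> S x, forall x y, I x -> I y -> I (x - y),
      forall s x, S s -> I x -> I (s * x) & forall s x, S s -> I x -> I (x * s)].

Lemma filtration_le i j x : (i <= j)%N -> T j x -> T i x.
Proof.
move=> /subnK <-; elim: (j - i)%N => [|k IH]; first by rewrite add0n.
by rewrite addSn => /TS.
Qed.

Lemma subring_ideal_refl : subring_ideal S.
Proof. by split=> //; [apply: TB|move=> s x Ss Sx|move=> s x Ss Sx]; apply/TS/(@TM 1 1). Qed.

Section Ideal.
Variable I : R -> Prop.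
Hypotheses (idealI : subring_ideal I) (I0 : I 0).

Let IS x : I x -> S x. Proof. by case: idealI => + _ _ _; apply. Qed.
Let IB x y : I x -> I y -> I (x - y). Proof. by case: idealI => _ + _ _; apply. Qed.
Let Il s x : S s -> I x -> I (s * x). Proof. by case: idealI => _ _ + _; apply. Qed.
Let Ir s x : S s -> I x -> I (x * s). Proof. by case: idealI => _ _ _ +; apply. Qed.
Let IN x : I x -> I (- x). Proof. by rewrite -sub0r; apply: IB. Qed.
Let ID x y : I x -> I y -> I (x + y).
Proof. by move=> Ix Iy; rewrite -[y]opprK; apply/IB/IN. Qed.

Lemma subring_ideal_inv t : I t -> exists2 t', I t' & inverse_pair (1 + t) (1 + t').
Proof.
move=> It; have St := IS It.
have tX k : T k ((- t) ^+ k * t).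
  elim: k => [|k IH]; first by rewrite expr0 mul1r; apply/TS/IS.
  rewrite exprS -mulrA -add1n; apply: TM IH.
  by rewrite -sub0r; apply: TB.
have [g [Ig tg e]] : exists g, [/\ I g, t * g = g * t & (1 + t) * (1 + g) = 1 + (- t) ^+ N * t].
  elim: N => [|k [g [Ig tg e]]].
    by exists 0; rewrite expr0 mulr0 mul0r addr0 mulr1 mul1r.
  exists (- t - t * g); split; first by apply: IB; [apply: IN|apply: Il].
    by nc (tt, tg).
  rewrite exprS -mulrA; move: e; move: (_ ^+ k * t) => w e.
  have -> : 1 + - t * w = 1 + t - t * (1 + w) by nc tt.
  by rewrite -e; nc tt.
exists g => //; rewrite (TN (tX N)) addr0 in e; split=> //.
by rewrite -[RHS]e; nc (tt, tg).
Qed.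

End Ideal.

Lemma mul_of_inverse_pair (a b : R) : inverse_pair (1 + a) (1 + b) -> b * a = - b - a.
Proof.
by case=> _ e; have -> : b * a = (1 + b) * (1 + a) - 1 - b - a by [nc tt]; rewrite e; nc tt.
Qed.

Section CommutativeIdeal.
Variable I : R -> Prop.
Hypotheses (idealI : subring_ideal I) (I0 : I 0).
Hypothesis commI : forall x y, I x -> I y -> x * y = y * x.

Let IS x : I x -> S x. Proof. by case: idealI => + _ _ _; apply. Qed.
Let IB x y : I x -> I y -> I (x - y). Proof. by case: idealI => _ + _ _; apply. Qed.
Let Il s x : S s -> I x -> I (s * x). Proof. by case: idealI => _ _ + _; apply. Qed.
Let Ir s x : S s -> I x -> I (x * s). Proof. by case: idealI => _ _ _ +; apply. Qed.
Let ID x y : I x -> I y -> I (x + y).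
Proof. by move=> Ix Iy; rewrite -[y]opprK -[- y]sub0r; apply/IB/IB. Qed.

(* The products of two elements of [I] commute with [S], so that up to such
   elements [1 + t |-> (1 + t, 1 + s)] is the linear map [dl]. *)
Lemma engel_ideal_ad s t : S s -> I t -> iter n.+1 (ad_right s) t = 0.
Proof.
move=> Ss It; have [t' It' tt'] := subring_ideal_inv idealI I0 It.
have [s' Ss' uu'] := subring_ideal_inv subring_ideal_refl (T0 1) Ss.
have s's := mul_of_inverse_pair uu'.
pose dl z := (1 + s') * z * (1 + s) - z.
have Idl z : I z -> I (dl z).
  move=> Iz; have -> : dl z = s' * z + s' * z * s + z * s by rewrite /dl; nc tt.
  by apply: ID; [apply: ID; [|apply: Ir => //]; apply: Il|apply: Ir].
have cII a b z : I a -> I b -> S z -> a * b * z = z * (a * b).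
  move=> Ia Ib Sz; have e1 := commI Ia (Ir Sz Ib); have e2 := commI Ib (Il Sz Ia).
  by rewrite -mulrA e1 -mulrA e2 mulrA.
(* Only [dl t1] is tracked: the next commutator has the extra term t1' * dl t1, which commutes with
   S and is killed by [dl]. This costs one more iteration, n.+1. *)
have step m : exists t1 t1', [/\ iter m (comm_pair (1 + s) (1 + s')) (1 + t, 1 + t') = (1 + t1, 1 + t1'),
    I t1, I t1', inverse_pair (1 + t1) (1 + t1') & dl t1 = iter m.+1 dl t].
  elim: m => [|m [t1 [t1' [e It1 It1' tt1 dE]]]]; first by exists t, t'.
  have t1t := mul_of_inverse_pair tt1.
  exists (dl t1 + t1' * dl t1), (dl t1' + dl t1' * t1).
  have cw := cII _ _ _ It1' (Idl _ It1) Ss.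
  have e1 : (1 + t1') * (1 + s') * (1 + t1) * (1 + s) = 1 + (dl t1 + t1' * dl t1).
    by rewrite /dl; nc (tt, t1t, s's).
  have e2 : (1 + s') * (1 + t1') * (1 + s) * (1 + t1) = 1 + (dl t1' + dl t1' * t1).
    by rewrite /dl; nc (tt, t1t, s's).
  split.
  - by rewrite iterS e /comm_pair -e1 -e2.
  - by apply: ID; [|apply: Il; [exact: IS|]]; apply: Idl.
  - by apply: ID; [|apply: Ir; [exact: IS|]]; apply: Idl.
  - rewrite -e1 -e2; case: tt1 uu' => a1 a2 [a3 a4].
    move: (1 + t1) (1 + t1') (1 + s) (1 + s') a1 a2 a3 a4 => b1 b2 b3 b4 a1 a2 a3 a4.
    by split; nc (tt, a1, a2, a3, a4).
  have dlD a b : dl (a + b) = dl a + dl b by rewrite /dl; nc tt.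
  rewrite iterS -dE dlD -[RHS]addr0; congr (_ + _).
  by rewrite [LHS]/dl; move: (t1' * dl t1) cw => w cw; nc (tt, cw, s's).
have dl0 : iter n.+1 dl t = 0.
  have [t1 [t1' [e _ _ _ <-]]] := step n.
  have := eng tt' uu'; rewrite e /= => /(congr1 (fun z => z - 1)).
  by rewrite addrC addKr subrr => ->; rewrite /dl; nc tt.
(* The additive commutator of z with s is (1 + s) dl z, and 1 + s commutes with s. *)
suff dlE m : iter m (ad_right s) t = (1 + s) ^+ m * iter m dl t by rewrite dlE dl0 mulr0.
elim: m => [|m IH]; first by rewrite expr0 mul1r.
have c : s * (1 + s) ^+ m = (1 + s) ^+ m * s by apply/commrX; rewrite /GRing.comm; nc tt.
rewrite !iterS IH exprSr /ad_right /dl.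
case: uu' => u _; move: ((1 + s) ^+ m) c (iter m dl t) => A c z.
have -> : A * (1 + s) * ((1 + s') * z * (1 + s) - z) = A * ((1 + s) * (1 + s')) * z * (1 + s) - A * (1 + s) * z by nc tt.
by rewrite u; nc (tt, c).
Qed.

(** The iterate of order p^(n+1) of [ad_right s] is [ad_right] of s^q, and it vanishes on I because
    p^(n+1) >= n + 1. *)
Lemma engel_ideal_comm s t q : S s -> I t -> q = (p ^ n.+1)%N -> t * s ^+ q = s ^+ q * t.
Proof.
move=> Ss It ->; apply/eqP; rewrite -subr_eq0 -iter_ad_right_pchar //.
have /subnK <- : (n.+1 <= p ^ n.+1)%N by rewrite ltnW // ltn_expl ?prime_gt1.
by rewrite iterD engel_ideal_ad // iter_fix // /ad_right mul0r mulr0 subr0.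
Qed.

Let K c := S c /\ forall t, I t -> c * t = t * c.

Hypothesis maxI : forall I' : R -> Prop, subring_ideal I' ->
  (forall x y, I' x -> I' y -> x * y = y * x) -> (forall x, I x -> I' x) -> forall x, I' x -> I x.

(** The centralizer K of I need not be an ideal of S, but K' is one: moving z in S past t in I costs
    a multiple of z t - t z, which K' annihilates. *)
Let K' c := K c /\ forall s t, S s -> I t ->
  c * (s * t - t * s) = 0 /\ (s * t - t * s) * c = 0.

Let SM x y : S x -> S y -> S (x * y). Proof. by move=> Sx Sy; apply/TS/(@TM 1 1). Qed.

Lemma centralizer_derived c c' : K c -> K c' -> K' (c * c' - c' * c).
Proof.
move=> [Sc cI] [Sc' c'I]; split.
  split=> [|t It]; first by apply: TB; apply: SM.
  by have h := cI _ It; have h' := c'I _ It; nc (tt, h, h').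
move=> s t Ss It; set z := s * t - t * s.
have Iz : I z by apply: IB; [apply: Il|apply: Ir].
have cz := cI _ Iz; have cc'z : c * (c' * z) = c' * z * c.
  by apply: cI; apply: Il.
have czc' : c * (z * c') = z * c' * c by apply: cI; apply: Ir.
rewrite mulrA in cc'z; rewrite mulrA in czc'; split.
  have -> : (c * c' - c' * c) * z = c * c' * z - c' * (c * z) by nc tt.
  by rewrite cc'z cz mulrA subrr.
have -> : z * (c * c' - c' * c) = z * c * c' - z * c' * c by nc tt.
by rewrite -cz czc' subrr.
Qed.

Let K'comm c z t : K' c -> S z -> I t -> z * c * t = t * (z * c) /\ c * z * t = t * (c * z).
Proof.
move=> [[Sc cI] c0] Sz It; have [e1 e2] := c0 z t Sz It; have ct := cI t It.
split; apply/eqP; rewrite -subr_eq0; apply/eqP.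
  by rewrite -e2; nc (tt, ct).
by rewrite -e1; have tc := esym ct; nc (tt, tc).
Qed.

Let K'l z c : S z -> K' c -> K' (z * c).
Proof.
move=> Sz Kc; have [[Sc cI] c0] := Kc; split.
  by split=> [|t It]; [apply: SM|have [] := K'comm Kc Sz It].
move=> s t Ss It; have [e1 e2] := c0 s t Ss It; split; first by rewrite -mulrA e1 mulr0.
have [zct _] := K'comm Kc Sz It; have [szct _] := K'comm Kc (SM Ss Sz) It.
have -> : (s * t - t * s) * (z * c) = s * (t * (z * c)) - t * (s * z * c) by nc tt.
by rewrite -zct -szct; nc tt.
Qed.

Let K'r z c : S z -> K' c -> K' (c * z).
Proof.
move=> Sz Kc; have [[Sc cI] c0] := Kc; split.
  by split=> [|t It]; [apply: SM|have [] := K'comm Kc Sz It].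
move=> s t Ss It; have [e1 e2] := c0 s t Ss It; split; last by rewrite mulrA e2 mul0r.
have [_ czt] := K'comm Kc Sz It; have [_ czst] := K'comm Kc (SM Sz Ss) It.
have -> : c * z * (s * t - t * s) = c * (z * s) * t - c * z * t * s by nc tt.
by rewrite czst czt; nc tt.
Qed.

(* An element [z] of [K'] of maximal degree among those not in [I] could be added
   to [I], which is a maximal commutative ideal. *)
Lemma annihilator_in_ideal c : K' c -> I c.
Proof.
suff H k i z : (N <= i + k)%N -> (0 < i)%N -> K' z -> T i z -> I z.
  by move=> Kc; apply: (H N 1%N) => //; case: Kc => -[].
elim: k i z => [|k IH] i z; first by rewrite addn0 => Ni _ _ /(filtration_le Ni)/TN ->.
rewrite addnS -addSn => /IH{}IH i_gt0 Kz Tz.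
have [[Sz zI] _] := Kz.
have Smulz s m : S s -> S (s *~ m).
  have SN s' : S s' -> S (- s') by rewrite -sub0r; apply: TB.
  move=> Ss; have SMn l : S (s *+ l).
    elim: l => [|l IHl]; first by rewrite mulr0n.
    by rewrite mulrSr -[X in _ + X]opprK; apply: TB => //; apply: SN.
  by case: m => m; [exact: SMn|rewrite NegzE mulrNz; exact: SN (SMn _)].
(* I + Z z is an ideal: for s in S, s z and z s have degree above i, so they lie in I by
   induction. *)
pose I' w := exists m x, I x /\ w = x + z *~ m.
apply: (maxI (I' := I')); last by exists 1, 0; rewrite add0r.
- split.
  + move=> _ [m [x [/IS Sx ->]]]; rewrite -[z]opprK mulNrz; apply: TB => //.
    by apply: Smulz; rewrite -sub0r; apply: TB.
  + move=> _ _ [m [x [Ix ->]]] [m' [x' [Ix' ->]]]; exists (m - m'), (x - x').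
    by split; [apply: IB|rewrite mulrzBr; nc tt].
  + move=> s _ Ss [m [x [Ix ->]]]; exists 0, (s * x + s *~ m * z); split.
      apply: ID; first exact: Il.
      by apply: IH; [|apply: K'l => //; apply: Smulz|rewrite -add1n; apply: TM => //; apply: Smulz].
    by rewrite mulr0z addr0 mulrDr mulrzAl mulrzAr.
  + move=> s _ Ss [m [x [Ix ->]]]; exists 0, (x * s + z * (s *~ m)); split.
      apply: ID; first exact: Ir.
      by apply: IH; [|apply: K'r => //; apply: Smulz|rewrite -addn1; apply: TM => //; apply: Smulz].
    by rewrite mulr0z addr0 mulrDl mulrzAl mulrzAr.
- move=> _ _ [m [x [Ix ->]]] [m' [x' [Ix' ->]]].
  rewrite !mulrDl !mulrDr !mulrzAl !mulrzAr ?mulrzAl zI // zI // [x * x']commI //.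
  by rewrite -!addrA; congr (_ + _); rewrite addrCA -!mulrzA [(m * _)%R]mulrC.
- by move=> x Ix; exists 0, x; rewrite mulr0z addr0.
Qed.

End CommutativeIdeal.

Lemma exists_maximal_commutative_ideal : exists I : R -> Prop,
  [/\ subring_ideal I, I 0, forall x y, I x -> I y -> x * y = y * x &
   forall I' : R -> Prop, subring_ideal I' ->
    (forall x y, I' x -> I' y -> x * y = y * x) -> (forall x, I x -> I' x) ->
    forall x, I' x -> I x].
Proof.
pose good (I : set R) := subring_ideal I /\ forall x y, I x -> I y -> x * y = y * x.
have [F Fgood totF|I [[idealI commI] maxI]] := @Zorn_bigcup R good.
  have tot2 X Y x y : F X -> F Y -> X x -> Y y -> exists Z, [/\ F Z, Z x & Z y].
    by move=> FX FY Xx Yy; have [XY|YX] := totF _ _ FX FY; [exists Y|exists X]; split=> //; auto.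
  split; last first.
    move=> x y [X FX Xx] [Y FY Yy]; have [Z [FZ Zx Zy]] := tot2 _ _ _ _ FX FY Xx Yy.
    by have [_] := Fgood _ FZ; apply.
  split=> [x [X FX Xx]|x y [X FX Xx] [Y FY Yy]|s x Ss [X FX Xx]|s x Ss [X FX Xx]].
  - by have [[+ _ _ _] _] := Fgood _ FX; apply.
  - have [Z [FZ Zx Zy]] := tot2 _ _ _ _ FX FY Xx Yy; exists Z => //.
    by have [[_ + _ _] _] := Fgood _ FZ; apply.
  - by exists X => //; have [[_ _ + _] _] := Fgood _ FX; apply.
  - by exists X => //; have [[_ _ _ +] _] := Fgood _ FX; apply.
have max' I' : good I' -> (forall x, I x -> I' x) -> forall x, I' x -> I x.
  move=> gI' sub x I'x; apply: contrapT => nIx; apply: (maxI I') => //.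
  by split=> // /(_ _ I'x).
have I0 : I 0.
  have [//|nI0] := EM (I 0); apply: (max' (fun x => x = 0)) => //.
    split=> [|x y -> ->//]; split=> [x ->|x y -> ->|s x _ ->|s x _ ->] //.
    - by rewrite subr0.
    - by rewrite mulr0.
    - by rewrite mul0r.
  move=> x Ix; case: nI0; rewrite -(subrr x); case: idealI => _ + _ _; exact.
by exists I; split=> // I' iI' cI'; apply: max'.
Qed.

Lemma filtered_engel_identity x y q : S x -> S y -> q = (p ^ n.+1)%N ->
  let z := x ^+ q * y ^+ q - y ^+ q * x ^+ q in z * x ^+ q = x ^+ q * z.
Proof.
move=> Sx Sy qE z; have [I [idealI I0 commI maxI]] := exists_maximal_commutative_ideal.
have q_gt0 : (0 < q)%N by rewrite qE expn_gt0 prime_gt0.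
have SX s : S s -> S (s ^+ q).
  move=> Ss; rewrite -(prednK q_gt0); elim: q.-1 => [//|k IH].
  by rewrite exprS; apply/TS/(@TM 1 1).
have K s : S s -> S (s ^+ q) /\ forall t, I t -> s ^+ q * t = t * s ^+ q.
  by move=> Ss; split=> [|t It]; [apply: SX|apply/esym/(engel_ideal_comm idealI I0 commI)].
have Iz := annihilator_in_ideal idealI I0 commI maxI (centralizer_derived idealI (K _ Sx) (K _ Sy)).
by have [_ ->] := K _ Sx.
Qed.

End NilpotentFiltration.

(** These spans form the filtration T; level N is zero when the words of length N vanish. *)
Inductive word_span (R : pzRingType) (xs : seq R) (i : nat) : R -> Prop :=
  | word_span0 : word_span xs i 0
  | word_span_word j w of (i <= j)%N & w \in words xs j : word_span xs i w
  | word_spanB x y of word_span xs i x & word_span xs i y : word_span xs i (x - y).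

Lemma words_cat (R : pzRingType) (xs : seq R) m k u v :
  u \in words xs m -> v \in words xs k -> u * v \in words xs (m + k).
Proof.
elim: m u => [|m IH] u /=; first by rewrite inE => /eqP ->; rewrite mul1r.
case/allpairsP => -[x w] /= [xxs wm ->] vk; rewrite -mulrA.
by apply/allpairsP; exists (x, w * v); split=> //; apply: IH.
Qed.

Lemma word_spanM (R : pzRingType) (xs : seq R) i j x y :
  word_span xs i x -> word_span xs j y -> word_span xs (i + j) (x * y).
Proof.
elim=> [|m w im wm|x1 x2 _ IH1 _ IH2] Hy.
- by rewrite mul0r; apply: word_span0.
- elim: Hy => [|k v jk vk|y1 y2 _ IH1 _ IH2].
  + by rewrite mulr0; apply: word_span0.
  + by apply: (word_span_word (leq_add im jk)); apply: words_cat.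
  + by rewrite mulrBr; apply: word_spanB.
- by rewrite mulrBl; apply: word_spanB; [apply: IH1|apply: IH2].
Qed.

Lemma engel_nil_identity (R : pzRingType) p n N (x y : R) :
  prime p -> p%:R = 0 :> R -> engel_law R n ->
  (forall w, w \in words [:: x; y] N -> w = 0) ->
  let X := x ^+ (p ^ n.+1) in let Y := y ^+ (p ^ n.+1) in
  (X * Y - Y * X) * X = X * (X * Y - Y * X).
Proof.
move=> prp p0 eng nil /=; set xs := [:: x; y] in nil.
have span1 z : z \in xs -> word_span xs 1 z.
  move=> zxs; apply: (word_span_word (j := 1)) => //.
  by apply/allpairsP; exists (z, 1); rewrite mulr1 mem_head.
apply: (@filtered_engel_identity R (word_span xs) N n p) => //.
- by move=> i a b; apply: word_spanB.
- by move=> i j a b; apply: word_spanM.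
- move=> i a; elim=> [|j w ij wj|a1 a2 _ H1 _ H2]; first exact: word_span0.
    by apply: (word_span_word _ wj); apply: ltnW.
  exact: word_spanB.
- by move=> i; apply: word_span0.
- move=> a; elim=> [//|j w Nj|a1 a2 _ -> _ ->]; last by rewrite subrr.
  rewrite -(subnKC Nj) => /words_add[u [v [/nil -> _ ->]]]; exact: mul0r.
- by apply: span1; rewrite mem_head.
- by apply: span1; rewrite !inE eqxx orbT.
Qed.

(** * Noncommutative polynomials *)

Section EvalNC.
Variables (F : fieldType) (A : algType F) (v : nat -> A).

Lemma eval_word_mmorphism : mmorphism (eval_word v).
Proof.
split=> [m1 m2|]; first by rewrite /eval_word fmM big_cat.
by rewrite /eval_word fm1 big_nil.
Qed.
HB.instance Definition _ := monalg.isMultiplicative.Build _ _ (eval_word v) eval_word_mmorphism.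


HB.instance Definition _ := GRing.isZmodMorphism.Build {malg F[{fmonom nat}]} A
  (eval_nc v) (@mmap_is_additive _ _ _ (in_alg A) (eval_word v)).

Lemma eval_nc_monoid_morphism : GRing.monoid_morphism (eval_nc v).
Proof.
rewrite /eval_nc; have [|H1 H2] := @commr_mmap_is_multiplicative _ _ _ (in_alg A) (eval_word v); last by split.
by move=> g m m'; rewrite /GRing.comm /= mulr_algl mulr_algr.
Qed.
HB.instance Definition _ := GRing.isMonoidMorphism.Build {malg F[{fmonom nat}]} A
  (eval_nc v) eval_nc_monoid_morphism.

Definition nc_var i : {malg F[{fmonom nat}]} := << fmu i >>.

Lemma eval_nc_var i : eval_nc v (nc_var i) = v i.
Proof. by rewrite /eval_nc mmapU /= scale1r mul1r /eval_word fmuE big_seq1. Qed.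

End EvalNC.

(** A nonzero value certifies f != 0. Size 2 would not do: the polynomial [[a, b]^2, c] vanishes on
    2 x 2 matrices. *)
Lemma satisfies_PI_of_matrix (F : fieldType) (A : algType F) (f : {malg F[{fmonom nat}]})
    (v : nat -> 'M[F]_3) :
  eval_nc v f <> 0 -> (forall w, eval_nc w f = 0 :> A) -> satisfies_PI A.
Proof. by move=> nz f0; exists f => //; apply: contra_notN nz => /eqP ->; rewrite rmorph0. Qed.



Definition function_eval (T : Type) (R : pzRingType) (t : T) (f : T -> R) : R := f t.
Section FunctionEval.
Variables (T : Type) (R : pzRingType) (t : T).
Lemma function_eval_zmod_morphism : zmod_morphism (@function_eval T R t).
Proof. by []. Qed.
HB.instance Definition _ := GRing.isZmodMorphism.Build (T -> R) R
  (@function_eval T R t) function_eval_zmod_morphism.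
Lemma function_eval_monoid_morphism : GRing.monoid_morphism (@function_eval T R t).
Proof. by []. Qed.
HB.instance Definition _ := GRing.isMonoidMorphism.Build (T -> R) R
  (@function_eval T R t) function_eval_monoid_morphism.
End FunctionEval.

(** * Infinite fields *)

Section RegularFamilies.
Variables (F : fieldType) (A : unitAlgType F) (T : Type) (lam : T -> F).

Definition poly_family (g : T -> A) : Prop :=
  exists q : {poly A}, forall t, g t = q.[(lam t)%:A].

Lemma horner_alg_comm (q : {poly A}) (x : F) : comm_poly q x%:A.
Proof. by rewrite /comm_poly mulr_algl mulr_algr. Qed.

Lemma poly_family_const w : poly_family (fun=> w).
Proof. by exists w%:P => t; rewrite hornerC. Qed.

Lemma poly_familyD g h : poly_family g -> poly_family h -> poly_family (fun t => g t + h t).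
Proof. by move=> [q qE] [r rE]; exists (q + r) => t; rewrite hornerD qE rE. Qed.

Lemma poly_familyM g h : poly_family g -> poly_family h -> poly_family (fun t => g t * h t).
Proof.
move=> [q qE] [r rE]; exists (q * r) => t.
by rewrite hornerM_comm ?qE ?rE //; apply: horner_alg_comm.
Qed.

Lemma poly_family_scalar (f : {poly F}) : poly_family (fun t => f.[lam t]%:A).
Proof. by exists (map_poly (in_alg A) f) => t; rewrite -[(lam t)%:A]/(in_alg A _) horner_map. Qed.

Lemma poly_familyX g n : poly_family g -> poly_family (fun t => g t ^+ n).
Proof.
move=> pg; elim: n => [|n IH]; first exact: poly_family_const.
by have [q qE] := poly_familyM pg IH; exists q => t; rewrite exprS qE.
Qed.

Lemma poly_family_sum n (g : 'I_n -> T -> A) :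
  (forall i, poly_family (g i)) -> poly_family (fun t => \sum_i g i t).
Proof.
move=> pg; elim: n g pg => [|n IH] g pg.
  by have [q qE] := poly_family_const 0; exists q => t; rewrite big_ord0 -qE.
have [q qE] := poly_familyD (pg ord0) (IH _ (fun i => pg (lift ord0 i))).
by exists q => t; rewrite big_ord_recl qE.
Qed.

(** Families rational in the parameter and regular at 0, with a scalar denominator p. *)
Definition regular_family (g : T -> A) : Prop :=
  exists2 p : {poly F}, p.[0] != 0 & poly_family (fun t => p.[lam t] *: g t).

Lemma regular_poly g : poly_family g -> regular_family g.
Proof.
case=> q qE; exists 1; first by rewrite hornerC oner_neq0.
by exists q => t; rewrite hornerC scale1r qE.
Qed.

Lemma regularB (g h : T -> A) : regular_family g -> regular_family h -> regular_family (g - h).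
Proof.
move=> [p p0 pg] [r r0 rh]; exists (p * r); first by rewrite hornerM mulf_neq0.
have [q qE] := poly_familyD (poly_familyM (poly_family_scalar r) pg)
  (poly_familyM (poly_family_scalar (- p)) rh).
exists q => t; rewrite -qE !mulr_algl hornerM hornerN !scalerA mulNr scaleNr.
by rewrite [r.[_] * _]mulrC -scalerBr.
Qed.

Lemma regularM (g h : T -> A) : regular_family g -> regular_family h -> regular_family (g * h).
Proof.
move=> [p p0 pg] [r r0 rh]; exists (p * r); first by rewrite hornerM mulf_neq0.
have [q qE] := poly_familyM pg rh.
by exists q => t; rewrite -qE -scalerAl -scalerAr scalerA hornerM.
Qed.

End RegularFamilies.

(* If [sum_i P_i x^i = 0] has degree [n], put y = - l x in
   [sum_i P_i (- l)^(n - i) y^i = 0] and divide [1 - y^i] by [1 - y = 1 + l x]. *)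
Lemma algebraic_quasi_inverse (F : fieldType) (A : unitAlgType F) (x : A) :
  algebraic_elt x -> exists (rho : {poly F}) (q : {poly A}), rho.[0] != 0 /\
    forall l : F, (1 + l *: x) * q.[l%:A] = rho.[l]%:A /\ q.[l%:A] * (1 + l *: x) = rho.[l]%:A.
Proof.
move=> [P nzP Px]; set n := (size P).-1.
pose f i : {poly F} := P`_i *: (- 'X) ^+ (n - i).
pose g (l : F) : A := \sum_(i < n.+1) (f i).[l]%:A * \sum_(j < i) (- (l *: x)) ^+ j.
have [q qE] : poly_family id g.
  apply: poly_family_sum => i; apply: poly_familyM.
    exact: (poly_family_scalar A id (f i)).
  apply: poly_family_sum => j; apply: poly_familyX.
  have [q qE] := poly_familyM (poly_family_scalar A id (- 'X)) (@poly_family_const F A F id x).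
  by exists q => l; rewrite -qE hornerN hornerX mulr_algl scaleNr.
exists (\sum_(i < n.+1) f i), q; split.
  rewrite horner_sum big_ord_recr big1 /= => [|i _]; last first.
    by rewrite hornerZ horner_exp hornerN hornerX oppr0 expr0n subn_eq0 leqNgt ltn_ord mulr0.
  by rewrite hornerZ horner_exp subnn expr0 mulr1 add0r -lead_coefE lead_coef_eq0.
move=> l; rewrite -qE; pose y := - (l *: x).
have -> : 1 + l *: x = 1 - y by rewrite opprK.
have geom i : (1 - y) * (\sum_(j < i) y ^+ j) = 1 - y ^+ i.
  by rewrite -[1 - y]opprB mulNr -subrX1 opprB.
have comm i : (\sum_(j < i) y ^+ j) * (1 - y) = (1 - y) * \sum_(j < i) y ^+ j.
  rewrite mulr_suml mulr_sumr; apply: eq_bigr => j _.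
  by apply/esym/commrX; rewrite /GRing.comm; nc tt.
have fy : \sum_(i < n.+1) (f i).[l] *: y ^+ i = 0.
  have Px' : \sum_(i < n.+1) P`_i *: x ^+ i = 0.
    rewrite -[RHS]Px /horner_alg /horner_morph horner_coef size_map_poly /n prednK ?size_poly_gt0 //.
    by apply: eq_bigr => i _; rewrite coef_map /= mulr_algl.
  transitivity ((- l) ^+ n *: \sum_(i < n.+1) P`_i *: x ^+ i); last by rewrite Px' scaler0.
  rewrite scaler_sumr; apply: eq_bigr => i _.
  rewrite /f hornerZ horner_exp hornerN hornerX /y -scaleNr exprZn !scalerA.
  rewrite -mulrA -exprD subnK; first by rewrite mulrC.
  by rewrite -ltnS ltn_ord.
have rhoE : \sum_(i < n.+1) (f i).[l] *: (1 - y ^+ i) = (\sum_(i < n.+1) f i).[l]%:A.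
  under eq_bigr => i _ do rewrite scalerBr.
  by rewrite sumrB fy subr0 horner_sum scaler_suml.
rewrite /g mulr_suml mulr_sumr -rhoE; split; apply: eq_bigr => i _.
  by rewrite mulr_algl -scalerAr geom.
by rewrite mulr_algl -scalerAl comm geom.
Qed.

Definition infinite_field (F : fieldType) : Prop :=
  forall n, exists2 s : seq F, uniq s & (n <= size s)%N.

Section LeadingTerms.
Variables (F : fieldType) (A : unitAlgType F) (rho : {poly F}).
Hypotheses (infF : infinite_field F) (rho0 : rho.[0] != 0).

(** Where rho does not vanish the elements 1 + l x are invertible; l != 0 allows powers of the
    parameter to be cancelled. *)
Definition good_points := {l : F | (l != 0) && (rho.[l] != 0)}.
Let T := good_points.
Let lam (t : T) : F := val t.
Let L : T -> A := fun t => (lam t)%:A.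
Let reg := @regular_family F A T lam.

Lemma poly_family_eq0 (q : {poly A}) : (forall t : T, q.[(lam t)%:A] = 0) -> q = 0.
Proof.
move=> q0; apply: contrapT => /eqP nzq.
have nzr : rho * 'X != 0.
  by rewrite mulf_neq0 ?polyX_eq0 //; apply: contra_neq rho0 => ->; rewrite horner0.
have [s us ss] := infF (size q + size (rho * 'X)%R)%N.
set s1 := [seq l <- s | root (rho * 'X) l]; set s2 := [seq l <- s | ~~ root (rho * 'X) l].
have s1s : (size s1 < size (rho * 'X)%R)%N.
  by apply: max_poly_roots => //; [apply: filter_all|apply: filter_uniq].
have s2s : (size s2 < size q)%N.
  rewrite -(size_map (in_alg A)); apply: max_ring_poly_roots => //.
    rewrite all_map; apply/allP => l; rewrite mem_filter => /andP[nl _] /=.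
    have gl : (l != 0) && (rho.[l] != 0).
      by move: nl; rewrite /root hornerM hornerX mulf_eq0 negb_or andbC.
    by apply/eqP; apply: (q0 (exist _ l gl)).
  by rewrite map_uniq_roots filter_uniq.
move: ss; rewrite -(count_predC (root (rho * 'X)) s) -!size_filter -/s1 -/s2 leqNgt.
by rewrite addnC; case/negP; rewrite -addSn leq_add // ltnW.
Qed.


Lemma regular_const (w : A) : reg (cst w).
Proof. exact/regular_poly/poly_family_const. Qed.

Lemma regular_parameter : reg L.
Proof.
by apply: regular_poly; have [q qE] := poly_family_scalar A lam 'X; exists q => t; rewrite -qE hornerX.
Qed.

Lemma parameter_central (g : T -> A) : g * L = L * g.
Proof. by apply/funext => t; rewrite /L /= !fctE mulr_algl mulr_algr. Qed.

Lemma parameter_cancel n (g : T -> A) : L ^+ n * g = 0 -> g = 0.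
Proof.
have LX t : (L ^+ n) t = (lam t ^+ n)%:A.
  elim: n => [|n IH]; first by rewrite scale1r.
  by rewrite !exprS -scalerA -IH -[LHS]/(L t * (L ^+ n) t) mulr_algl.
move=> Lg; apply/funext => t; have /eqP : (L ^+ n) t * g t = 0 by exact: (congr1 (fun h => h t) Lg).
rewrite LX mulr_algl scaler_eq0 expf_eq0.
by have /andP[/negbTE -> _] := valP t; rewrite andbF => /eqP.
Qed.

Lemma leading_coef0 w (c : T -> A) : reg c -> cst w + L * c = 0 -> w = 0.
Proof.
move=> [p p0 [q qE]] wc.
have h0 : map_poly (in_alg A) p * w%:P + 'X * q = 0.
  apply: poly_family_eq0 => t; have wct : w + (lam t)%:A * c t = 0 by exact: (congr1 (fun h => h t) wc).
  rewrite hornerD !hornerM_comm; do ?exact: horner_alg_comm.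
  rewrite hornerC hornerX -qE -[X in _.[X] * w]/(in_alg A _).
  rewrite horner_map /= mulr_algl -scalerAr mulr_algl -scalerDr.
  by rewrite mulr_algl in wct; rewrite wct scaler0.
have : (map_poly (in_alg A) p * w%:P + 'X * q)`_0 = 0 by rewrite h0 coef0.
rewrite coefD coefMC coef_map /= coefXM /= addr0 mulr_algl => /eqP.
by rewrite scaler_eq0 -horner_coef0 (negbTE p0) => /eqP.
Qed.

(** X = 1 + w l^(N+1) up to higher order; w may be zero, and the group law will force it to be. *)
Definition leading (N : nat) (w : A) (X X' : T -> A) : Prop :=
  [/\ inverse_pair X X', reg X' & exists2 c, reg c & X = 1 + L ^+ N.+1 * (cst w + L * c)].

Let regD (g h : T -> A) : reg g -> reg h -> reg (g + h).
Proof.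
move=> rg rh; rewrite -[h]opprK -[- h]sub0r; apply: regularB => //.
by apply: regularB => //; apply: (regular_const 0).
Qed.

Let reg1 : reg 1. Proof. exact: (regular_const 1). Qed.

Let regX (g : T -> A) n : reg g -> reg (g ^+ n).
Proof.
move=> rg; elim: n => [|n IH]; first exact: reg1.
by rewrite exprS; apply: regularM.
Qed.

Let inverse_leading N w X X' : leading N w X X' -> exists2 e, reg e & X' = 1 - L * e.
Proof.
move=> [[XX' X'X] rX' [c rc XE]].
exists (L ^+ N * (cst w + L * c) * X').
  apply: regularM => //; apply: regularM; first exact/regX/regular_parameter.
  by apply: regD; [apply: regular_const|apply: regularM => //; apply: regular_parameter].
have E : X * X' = X' + L ^+ N.+1 * (cst w + L * c) * X' by rewrite XE mulrDl mul1r.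
by move: E; rewrite XX' exprS !mulrA => ->; rewrite addrK.
Qed.

(** X' Y' X Y = X' Y' (Y X + [X - 1, Y - 1]), where X' Y' Y X = 1 and the factor X' Y' is 1 modulo
    the parameter. *)
Lemma leading_commutator N M w z X X' Y Y' : leading N w X X' -> leading M z Y Y' ->
  leading (N + M).+1 (w * z - z * w) (X' * Y' * X * Y) (Y' * X' * Y * X).
Proof.
move=> lX lY; have [e re X'E] := inverse_leading lX; have [f rf Y'E] := inverse_leading lY.
have [[XX' X'X] rX' [c rc XE]] := lX; have [[YY' Y'Y] rY' [d rd YE]] := lY.
have reg_shape i u b : reg b -> reg (1 + L ^+ i * (cst u + L * b)).
  move=> rb; apply: regD => //; apply: regularM; first exact/regX/regular_parameter.
  by apply: regD; [apply: regular_const|apply: regularM => //; apply: regular_parameter].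
split.
- by split; nc (tt, XX', X'X, YY', Y'Y).
- by rewrite XE YE; do ?apply: regularM => //; apply: reg_shape.
pose g : T -> A := cst w * d - d * cst w + (c * cst z - cst z * c) + L * (c * d - d * c).
(* g is the remainder of the additive commutator; h adds the contribution of X' Y' = 1 + L (L e f -
   e - f). *)
pose h : T -> A := g + (L * e * f - e - f) * (cst (w * z - z * w) + L * g).
have rg : reg g.
  have rw := regular_const w; have rz := regular_const z.
  apply: regD; first apply: regD.
  - by apply: regularB; apply: regularM.
  - by apply: regularB; apply: regularM.
  - apply: regularM; first exact: regular_parameter.
    by apply: regularB; apply: regularM.
exists h.
  apply: regD => //; apply: regularM.
    apply: regularB => //; apply: regularB => //; apply: regularM => //.
    by apply: regularM => //; apply: regular_parameter.
  by apply: regD; [apply: regular_const|apply: regularM => //; apply: regular_parameter].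
have [eL fL cL dL] : [/\ e * L = L * e, f * L = L * f, c * L = L * c & d * L = L * d].
  by split; apply: parameter_central.
have wL := parameter_central (cst w); have zL := parameter_central (cst z).
have -> : X' * Y' * X * Y = X' * Y' * (Y * X + (X - 1) * (Y - 1) - (Y - 1) * (X - 1)).
  by nc tt.
have e1 : (X - 1) * (Y - 1) - (Y - 1) * (X - 1) =
    L ^+ (N + M).+2 * (cst (w * z - z * w) + L * g).
  have -> : cst (w * z - z * w) = cst w * cst z - cst z * cst w :> (T -> A) by [].
  have comm k (b : T -> A) : b * L ^+ k = L ^+ k * b by apply/commrX/parameter_central.
  have -> : L ^+ (N + M).+2 = L ^+ N.+1 * L ^+ M.+1 by rewrite -exprD addnS addSn.
  have LNM := comm M.+1 (L ^+ N.+1).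
  have := comm N.+1 (cst z + L * d); have := comm M.+1 (cst w + L * c).
  rewrite XE YE ![1 + _]addrC !addrK.
  move: (L ^+ N.+1) (L ^+ M.+1) LNM => p q pq h1 h2.
  have -> : p * (cst w + L * c) * (q * (cst z + L * d)) = p * q * ((cst w + L * c) * (cst z + L * d)).
    by rewrite -!mulrA; congr (_ * _); rewrite mulrA h1 -!mulrA.
  have -> : q * (cst z + L * d) * (p * (cst w + L * c)) = p * q * ((cst z + L * d) * (cst w + L * c)).
    by rewrite pq -!mulrA; congr (_ * _); rewrite mulrA h2 -!mulrA.
  by rewrite -mulrBr; congr (_ * _); rewrite /g; nc (tt, cL, dL, wL, zL).
rewrite -addrA e1.
have comm k (b : T -> A) : b * L ^+ k = L ^+ k * b by apply/commrX/parameter_central.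
rewrite mulrDr [X' * Y' * (Y * X)](_ : _ = 1); last by nc (tt, Y'Y, X'X).
congr (_ + _); rewrite mulrA comm -mulrA; congr (_ * _).
have gL := parameter_central g; have wzL := parameter_central (cst (w * z - z * w)).
by rewrite /h X'E Y'E; nc (tt, eL, fL, gL, wzL).
Qed.

End LeadingTerms.

Lemma exists_leading (F : fieldType) (A : unitAlgType F) (x : nat -> A) m :
  algebraic_algebra A -> exists2 rho : {poly F}, rho.[0] != 0 &
    forall k, (k < m)%N -> exists X X', leading (rho := rho) 0 (x k) X X'.
Proof.
move=> algA; have [r rP] := choice (fun k => algebraic_quasi_inverse (algA (x k))).
exists (\prod_(k < m) r k).
  by rewrite horner_prod; apply/prodf_neq0 => k _; have [q []] := rP k.
move=> k km; have [q [r0 qP]] := rP k.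
have nz (t : good_points (\prod_(k < m) r k)) : (r k).[val t] != 0.
  have /andP[_] := valP t; rewrite horner_prod => /prodf_neq0/(_ (Ordinal km)); exact.
pose L := fun t : good_points (\prod_(k < m) r k) => (val t)%:A : A.
exists (1 + L ^+ 1 * (cst (x k) + L * 0)), (fun t => (r k).[val t]^-1 *: q.[(val t)%:A]).
have XE t : (1 + L ^+ 1 * (cst (x k) + L * 0)) t = 1 + val t *: x k.
  by rewrite expr1 mulr0 addr0 -[LHS]/(1 + L t * x k) mulr_algl.
split.
- split; apply/funext => t; have [e1 e2] := qP (val t).
    by rewrite -[LHS]/(_ t * _) XE -scalerAr e1 scalerA mulVf // scale1r.
  by rewrite -[LHS]/(_ * _ t) XE -scalerAl e2 scalerA mulVf // scale1r.
- exists (r k) => //; exists q => t; by rewrite scalerA mulfV // scale1r.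
by exists 0; first exact: (regular_const _ 0).
Qed.

Lemma iter_comm_pair_morph (R P : pzRingType) (f : {rmorphism R -> P}) n (x x' y y' : R) :
  iter n (comm_pair (f y) (f y')) (f x, f x') =
  (f (iter n (comm_pair y y') (x, x')).1, f (iter n (comm_pair y y') (x, x')).2).
Proof.
elim: n => [//|n IH]; rewrite !iterS IH /comm_pair /=.
by congr pair; rewrite !rmorphM.
Qed.

Lemma engel_law_function (T : Type) (R : pzRingType) n : engel_law R n -> engel_law (T -> R) n.
Proof.
move=> eng x x' y y' [xx' x'x] [yy' y'y]; apply/funext => t.
have ev (a b : T -> R) : a * b = 1 -> function_eval t a * function_eval t b = 1.
  by move=> ab; rewrite -rmorphM ab rmorph1.
have := eng _ _ _ _ (conj (ev _ _ xx') (ev _ _ x'x)) (conj (ev _ _ yy') (ev _ _ y'y)).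
by rewrite iter_comm_pair_morph.
Qed.

Lemma infinite_engel_identity (F : fieldType) (A : unitAlgType F) n (w z : A) :
  infinite_field F -> algebraic_algebra A -> engel_law A n -> iter n (ad_right z) w = 0.
Proof.
move=> infF algA eng.
have [rho rho0 lead] := exists_leading (fun k => nth z [:: w] k) 2 algA.
have [X [X' lX]] := lead 0%N isT; have [Y [Y' lY]] := lead 1%N isT.
have step m : exists N, leading N (iter m (ad_right z) w)
    (iter m (comm_pair Y Y') (X, X')).1 (iter m (comm_pair Y Y') (X, X')).2.
  elim: m => [|m [N IH]]; first by exists 0%N.
  by exists (N + 0).+1; apply: leading_commutator IH lY.
have [N [_ _ [c rc e]]] := step n.
move: e; rewrite (engel_law_function eng) //; last first.
- by case: lY.
- by case: lX.
move=> /esym/eqP; rewrite addrC -subr_eq0 addrK => /eqP/parameter_cancel.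
exact: (leading_coef0 infF rho0 rc).
Qed.

(* The third index of {0, 1, 2} is [3 - i - j]. *)
Fixpoint lie_word (R : pzRingType) (v : nat -> R) (d i j : nat) : R :=
  if d is d'.+1 then
    let k := (3 - i - j)%N in
    lie_word v d' i k * lie_word v d' k j - lie_word v d' k j * lie_word v d' i k
  else v (3 * i + j)%N.

Lemma infinite_solvable_identity (F : fieldType) (A : unitAlgType F) d (v : nat -> A) :
  infinite_field F -> algebraic_algebra A ->
  (forall x x', derived_pair (@inverse_pair A) d x x' -> x = 1) ->
  lie_word v d 0 1 = 0.
Proof.
move=> infF algA sol; have [rho rho0 lead] := exists_leading v 9 algA.
have step m i j : (i < 3)%N -> (j < 3)%N -> i != j -> exists N X X',
    leading (rho := rho) N (lie_word v m i j) X X' /\ derived_pair (@inverse_pair _) m X X'.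
  elim: m i j => [|m IH] i j i3 j3 ij.
    have [|X [X' lX]] := lead (3 * i + j)%N.
      by rewrite (@leq_trans (3 * i + 3)) ?ltn_add2l // -mulnSr (@leq_mul 3 _ 3 3).
    by exists 0%N, X, X'; split=> //; apply: derived_pair0; case: lX.
  have [k3 ik kj] : [/\ (3 - i - j < 3)%N, i != (3 - i - j)%N & (3 - i - j)%N != j].
    by case: i j i3 j3 ij => [|[|[|]]] // [|[|[|]]].
  have [N [X [X' [lX dX]]]] := IH _ _ i3 k3 ik.
  have [M [Y [Y' [lY dY]]]] := IH _ _ k3 j3 kj.
  exists (N + M).+1, (X' * Y' * X * Y), (Y' * X' * Y * X).
  by split; [apply: leading_commutator lX lY|apply: derived_pairR].
have [N [X [X' [[_ _ [c rc XE]] dX]]]] := step d 0%N 1%N isT isT isT.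
have X1 : X = 1.
  apply/funext => t; apply: (sol _ (X' t)).
  apply: (derived_pair_morph (f := function_eval t)) dX => y y' [yy' y'y].
  by split; rewrite -rmorphM ?yy' ?y'y rmorph1.
move: XE; rewrite X1 => /esym/eqP; rewrite addrC -subr_eq0 addrK => /eqP/parameter_cancel.
exact: (leading_coef0 infF rho0 rc).
Qed.

(** * Finite fields *)

Lemma nat_pigeonhole (T : eqType) (s : seq T) (f : nat -> T) :
  (forall i, f i \in s) -> exists i j, f i = f (i + j.+1)%N.
Proof.
move=> fs; apply: contrapT => inj.
have : uniq (map f (iota 0 (size s).+1)).
  rewrite map_inj_in_uniq ?iota_uniq // => i j _ _ fij.
  wlog ij : i j fij / (i < j)%N.
    by move=> W; have [/W->|/W->|] := ltngtP i j.
  by case: inj; exists i, (j - i).-1; rewrite prednK ?subn_gt0 // subnKC // ltnW.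
have sub : {subset map f (iota 0 (size s).+1) <= s} by move=> _ /mapP[i _ ->].
by move=> /uniq_leq_size/(_ sub); rewrite size_map size_iota ltnn.
Qed.

Lemma not_infinite_field (F : fieldType) : ~ infinite_field F -> exists s : seq F, forall x, x \in s.
Proof.
move=> /existsNP[n nn]; apply: contrapT => nos; apply: nn.
elim: n => [|n [s us ns]]; first by exists [::].
have [x xs] : exists x, x \notin s.
  by apply: contrapT => nx; apply: nos; exists s => x; apply: contrapT => /negP xs; apply: nx; exists x.
by exists (x :: s); rewrite /= ?xs.
Qed.

Lemma finite_tuples (T : eqType) (s : seq T) n : exists l : seq (seq T),
  forall w, size w = n -> {subset w <= s} -> w \in l.
Proof.
elim: n => [|n [l lP]]; first by exists [:: [::]] => -[].
exists [seq x :: w | x <- s, w <- l] => -[//|x w] /= [sw] ws.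
apply/allpairsP; exists (x, w); split=> //; first by apply: ws; rewrite mem_head.
by apply: lP => // y yw; apply: ws; rewrite inE yw orbT.
Qed.

Section FiniteField.
Variables (F : fieldType) (s : seq F).
Hypothesis sF : forall x, x \in s.

Lemma finite_field_pchar : exists2 p, prime p & p%:R = 0 :> F.
Proof.
have [i [j e]] := nat_pigeonhole (fun i => sF i%:R).
have [||p /andP[prp /eqP p0]] := @natf0_pchar F j.+1 => //; last by exists p.
by move/eqP: e; rewrite natrD -subr_eq0 opprD addNKr oppr_eq0.
Qed.

(** The powers of x are values at x of remainders modulo P, and these are finite in number. *)
Lemma finite_field_periodic (A : algType F) : algebraic_algebra A -> periodic A.
Proof.
move=> algA x; have [P nzP Px] := algA x.
have [l lP] := finite_tuples s (size P).
suff : forall i, x ^+ i \in [seq horner_alg x (Poly w) | w <- l].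
  by move=> /nat_pigeonhole[i [j e]]; exists i, j.
move=> i; apply/mapP; exists (mkseq (nth 0 ('X^i %% P)) (size P)).
  by apply: lP => [|y _ //]; rewrite size_mkseq.
have -> : Poly (mkseq (nth 0 ('X^i %% P)) (size P)) = 'X^i %% P.
  apply/polyP => k; rewrite coef_Poly; have [kP|Pk] := ltnP k (size P).
    by rewrite nth_mkseq.
  by rewrite !nth_default ?size_mkseq // (leq_trans _ Pk) // ltnW // ltn_modp.
transitivity (horner_alg x 'X^i); first by rewrite rmorphXn /= horner_algX.
by rewrite [in LHS](divp_eq 'X^i P) rmorphD rmorphM /= Px mulr0 add0r.
Qed.

End FiniteField.

(** * Units and group laws in quotients of periodic rings *)

Section Quotients.
Variables (R P : pzRingType) (f : {rmorphism R -> P}).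
Hypotheses (surjf : forall y, exists x, y = f x) (perR : periodic R).

Lemma periodic_quotient : periodic P.
Proof.
move=> y; have [x ->] := surjf y; have [m [k e]] := perR x.
by exists m, k; rewrite -!rmorphXn e.
Qed.

Lemma inverse_pair_unique (u u1 u2 : P) : inverse_pair u u1 -> inverse_pair u u2 -> u1 = u2.
Proof. by move=> [_ e1] [e2 _]; rewrite -[u1]mulr1 -e2 mulrA e1 mul1r. Qed.

(** For an idempotent power e of a preimage x of u, f e is an invertible idempotent, hence 1; so the
    unit x e + (1 - e) also maps to u. *)
Lemma periodic_unit_lift u u' : inverse_pair u u' ->
  exists x x', [/\ inverse_pair x x', f x = u & f x' = u'].
Proof.
move=> uu'; have [x xE] := surjf u; have [n ee] := periodic_idempotent x perR.
set e := x ^+ n.+1 in ee; have xe : x * e = e * x by apply/commrX.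
have [xn nx] : x * x ^+ n = e /\ x ^+ n * x = e by rewrite -exprS -exprSr.
have ne : x ^+ n * e = e * x ^+ n by apply/commr_sym/commrX/commr_sym/commrX.
have fe : f e = 1.
  have : inverse_pair (f e) (u' ^+ n.+1).
    have uu := uu'; case: uu => e1 e2; have c : GRing.comm u u' by rewrite /GRing.comm e1.
    by rewrite rmorphXn -xE /inverse_pair -!exprMn_comm // ?e1 ?e2 ?expr1n //; apply: commr_sym.
  move=> [fe1 _]; have : f e * f e * u' ^+ n.+1 = f e * u' ^+ n.+1 by rewrite -rmorphM ee.
  by rewrite -mulrA fe1 mulr1.
have inv : inverse_pair (x * e + (1 - e)) (x ^+ n * e + (1 - e)).
  move: (x ^+ n) xn nx ne => y xn nx ne; clearbody e; have ex := esym xe; have ey := esym ne.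
  by split; nc (tt, xn, nx, ee, ex, ey).
exists (x * e + (1 - e)), (x ^+ n * e + (1 - e)).
have fx : f (x * e + (1 - e)) = u.
  by rewrite rmorphD rmorphB rmorphM rmorph1 fe subrr mulr1 addr0 -xE.
split=> //; apply: (inverse_pair_unique _ uu'); rewrite -fx.
by case: inv => e1 e2; split; rewrite -rmorphM ?e1 ?e2 rmorph1.
Qed.

Lemma engel_law_quotient n : engel_law R n -> engel_law P n.
Proof.
move=> eng x x' y y' /periodic_unit_lift[a [a' [aa' <- <-]]] /periodic_unit_lift[b [b' [bb' <- <-]]].
by rewrite iter_comm_pair_morph /= eng // rmorph1.
Qed.

Lemma derived_law_quotient d :
  (forall x x', derived_pair (@inverse_pair R) d x x' -> x = 1) ->
  forall x x', derived_pair (@inverse_pair P) d x x' -> x = 1.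
Proof.
move=> sol x x' /(derived_pair_lift (f := f) (V := @inverse_pair R)) [].
  by move=> z z' /periodic_unit_lift.
by move=> a [a' [/sol -> <- _]]; rewrite rmorph1.
Qed.

End Quotients.

Section FinitePart.
Variables (R : pzRingType) (p : nat).
Hypotheses (prp : prime p) (p0 : p%:R = 0 :> R) (perR : periodic R).

Let p0' (P : pzRingType) (f : {rmorphism R -> P}) : p%:R = 0 :> P.
Proof. by rewrite -(rmorph_nat f) p0 rmorph0. Qed.

Lemma finite_engel_identity n (x0 x1 x2 x3 : R) : engel_law R n ->
  let X := (x0 * x1 - x1 * x0) ^+ (p ^ n.+1) in
  let Y := (x2 * x3 - x3 * x2) ^+ (p ^ n.+1) in
  (X * Y - Y * X) * X = X * (X * Y - Y * X).
Proof.
move=> eng; set x := x0 * x1 - _; set y := x2 * x3 - _.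
have [[N nil]|nnil] := EM (exists N, forall w, w \in words [:: x; y] N -> w = 0).
  exact: (engel_nil_identity prp p0 eng nil).
have [m|P [f [primeP surjf fw]]] := @exists_prime_avoiding R [:: x; y].
  by apply: contrapT => nw; apply: nnil; exists m => w wm; apply: contrapT => nz; apply: nw; exists w.
have nz1 : 1 != 0 :> P.
  by have [w] := fw 0%N; rewrite inE => /eqP ->; rewrite rmorph1 => /eqP.
have comm := periodic_engel_commutative nz1 prp (p0' f) primeP (periodic_quotient surjf perR)
  (engel_law_quotient surjf perR eng).
have [w + nz] := fw 1%N; rewrite /= inE !mulr1 inE => wE; case: nz.
by case/orP: wE => /eqP ->; rewrite rmorphB !rmorphM /= comm subrr.
Qed.

(** The prime radical, with surjections onto prime rings in place of prime ideals. *)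
Definition prime_nil (x : R) : Prop := forall (P : pzRingType) (f : {rmorphism R -> P}),
  prime_ring P -> (forall y, exists x, y = f x) -> f x = 0.

Lemma prime_nil_nilpotent x : prime_nil x -> nilpotent_elt x.
Proof.
move=> nx; apply: contrapT => nnil.
have [m|P [f [primeP surjf fw]]] := @exists_prime_avoiding R [:: x].
  by exists (x ^+ m); [rewrite words1 mem_head|move=> e; apply: nnil; exists m].
have [w] := fw 1%N; rewrite words1 inE expr1 => /eqP ->; case; exact: nx.
Qed.

Variable d : nat.
Hypothesis sol : forall x x' : R, derived_pair (@inverse_pair R) d x x' -> x = 1.

Definition sq_comm_word (S : pzRingType) (a b c : S) : S :=
  (a * b - b * a) ^+ 2 * c - c * (a * b - b * a) ^+ 2.

Lemma prime_nil_sq_comm_word a b c : prime_nil (sq_comm_word a b c).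
Proof.
move=> P f primeP surjf; have [one0|nz1] := eqVneq (1 : P) 0.
  by rewrite -[LHS]mulr1 one0 mulr0.
rewrite /sq_comm_word rmorphB !rmorphM rmorphB !rmorphM -expr2.
exact: (periodic_solvable_identity nz1 prp (p0' f) primeP (periodic_quotient surjf perR)
  (derived_law_quotient surjf perR sol)).
Qed.

(* The exponent [k] is uniform because the words are elements of the ring [B] of all
   functions of the variables: otherwise some prime quotient of [B] would see a
   non-nilpotent commutator, although the image of the prime-nil functions is central. *)
Lemma finite_solvable_identity : exists k, forall v : nat -> R,
  let y := sq_comm_word (v 0%N) (v 1%N) (v 2%N) in
  let z := sq_comm_word (v 3) (v 4) (v 5) in (y * z - z * y) ^+ k = 0.
Proof.
pose B := ((nat -> R) -> R).
pose y : B := fun v => sq_comm_word (v 0%N) (v 1%N) (v 2%N).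
pose z : B := fun v => sq_comm_word (v 3) (v 4) (v 5).
suff [k ck] : nilpotent_elt (y * z - z * y).
  exists k => v; have -> : 0 = function_eval v (0 : B) by [].
  by rewrite -ck rmorphXn.
apply: contrapT => nnil.
have [m|Q [f [primeQ surjf fw]]] := @exists_prime_avoiding B [:: y * z - z * y].
  by exists ((y * z - z * y) ^+ m); [rewrite words1 mem_head|move=> e; apply: nnil; exists m].
have [w] := fw 1%N; rewrite words1 inE expr1 => /eqP ->; case.
pose J q := exists2 b : B, (forall v, prime_nil (b v)) & q = f b.
have J0 : J 0 by exists 0; rewrite ?rmorph0 // => v P g _ _; rewrite rmorph0.
have idealJ : ideal_like J.
  split=> [_ _ [b nb ->] [c nc ->]|q _ [b nb ->]|q _ [b nb ->]].
  - exists (b - c); last by rewrite rmorphB.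
    by move=> v P g pP sg; rewrite -[(b - c) v]/(b v - c v) rmorphB nb // nc // subrr.
  - have [a ->] := surjf q; exists (a * b); last by rewrite rmorphM.
    by move=> v P g pP sg; rewrite -[(a * b) v]/(a v * b v) rmorphM nb // mulr0.
  - have [a ->] := surjf q; exists (b * a); last by rewrite rmorphM.
    by move=> v P g pP sg; rewrite -[(b * a) v]/(b v * a v) rmorphM nb // mul0r.
have invB b : (forall v, prime_nil (b v)) -> exists b' : B, inverse_pair (1 + b) b'.
  move=> nb; have [b' b'P] := choice (fun v => let: ex_intro2 b' h _ :=
    nilpotent_inv (prime_nil_nilpotent (nb v)) in ex_intro _ b' h).
  by exists b'; split; apply/funext => v; case: (b'P v).
have pair_f b b' : inverse_pair (1 + b) b' -> inverse_pair (1 + f b) (f b').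
  by case=> e1 e2; split; rewrite -(rmorph1 f) -rmorphD -rmorphM ?e1 ?e2.
have qregJ q : J q -> exists q', inverse_pair (1 + q) q'.
  by move=> [b /invB[b' /pair_f bb'] ->]; exists (f b').
have two : 2%:R = 0 :> Q \/ exists h : Q, h * 2%:R = 1.
  apply: (two_pchar prp); rewrite -(rmorph_nat f) (_ : p%:R = 0) ?rmorph0 //.
  by apply/funext => v; rewrite -[LHS]/(function_eval v p%:R) rmorph_nat p0.
(* A unit of Q in 1 + J lifts to a unit 1 + b of B, and the law holds in B pointwise. *)
have solQ q q' : derived_pair (fun q q' => J (q - 1) /\ inverse_pair q q') d q q' -> q = 1.
  case/(derived_pair_lift (f := f) (V := @inverse_pair B)) => [{}q {}q' [[b nb qb] qq']|b [b' [Db <- _]]].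
    have [b' bb'] := invB b nb; exists (1 + b), b'.
    have fb : f (1 + b) = q by rewrite rmorphD rmorph1 -qb addrC subrK.
    split=> //; apply: (inverse_pair_unique _ qq'); rewrite -fb rmorphD rmorph1.
    exact: pair_f.
  rewrite -[RHS](rmorph1 f); congr (f _); apply/funext => v; apply: (sol (x' := b' v)).
  apply: (derived_pair_morph (f := function_eval v)) Db => c c' [e1 e2].
  by split; rewrite -rmorphM ?e1 ?e2 rmorph1.
have Jy : J (f y) by exists y => // v; apply: prime_nil_sq_comm_word.
have cy := solvable_adjoint_central primeQ J0 idealJ qregJ two solQ Jy.
by rewrite rmorphB !rmorphM cy subrr.
Qed.

End FinitePart.

(** * Evaluations in 3 x 3 matrices *)

Section Evaluations.
Variables (R P : pzRingType) (f : {rmorphism R -> P}).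

Lemma rmorph_iter_ad_right n (s t : R) :
  f (iter n (ad_right s) t) = iter n (ad_right (f s)) (f t).
Proof. by elim: n => [//|n IH]; rewrite !iterS -IH /ad_right rmorphB !rmorphM. Qed.

Lemma rmorph_lie_word (v : nat -> R) d i j :
  f (lie_word v d i j) = lie_word (fun k => f (v k)) d i j.
Proof. by elim: d i j => [//|d IH] i j /=; rewrite rmorphB !rmorphM !IH. Qed.

Lemma rmorph_sq_comm_word a b c : f (sq_comm_word a b c) = sq_comm_word (f a) (f b) (f c).
Proof. by rewrite /sq_comm_word rmorphB !rmorphM rmorphB !rmorphM -!expr2. Qed.

Definition solvable_nil_word (S : pzRingType) k (v : nat -> S) : S :=
  let y := sq_comm_word (v 0%N) (v 1%N) (v 2%N) in
  let z := sq_comm_word (v 3) (v 4) (v 5) in (y * z - z * y) ^+ k.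

Lemma rmorph_solvable_nil_word k (v : nat -> R) :
  f (solvable_nil_word k v) = solvable_nil_word k (fun i => f (v i)).
Proof. by rewrite /solvable_nil_word rmorphXn rmorphB !rmorphM !rmorph_sq_comm_word. Qed.

Definition engel_nil_word (S : pzRingType) q (x0 x1 x2 x3 : S) : S :=
  let X := (x0 * x1 - x1 * x0) ^+ q in let Y := (x2 * x3 - x3 * x2) ^+ q in
  (X * Y - Y * X) * X - X * (X * Y - Y * X).

Lemma rmorph_engel_nil_word q x0 x1 x2 x3 :
  f (engel_nil_word q x0 x1 x2 x3) = engel_nil_word q (f x0) (f x1) (f x2) (f x3).
Proof. by rewrite /engel_nil_word !(rmorphB, rmorphM, rmorphXn). Qed.

End Evaluations.

Section MatrixValues.
Variable F : fieldType.

Definition mx3_unit (i j : nat) : 'M[F]_3 := delta_mx (inord i) (inord j).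
Local Notation E := mx3_unit.

Lemma mx3_unitM i j k l : (j < 3)%N -> (k < 3)%N ->
  E i j * E k l = if j == k then E i l else 0.
Proof.
move=> j3 k3; rewrite /mx3_unit -mulmxE mul_delta_mx_cond -val_eqE /= !inordK //.
by case: (j == k).
Qed.

Lemma mx3_unit_neq0 i j : E i j <> 0.
Proof.
move/matrixP/(_ (inord i) (inord j)); rewrite !mxE !eqxx => /eqP.
by rewrite oner_eq0.
Qed.

Lemma ad_right_value n : iter n (ad_right (E 1 1)) (E 0 1) <> 0.
Proof.
suff -> : iter n (ad_right (E 1 1)) (E 0 1) = E 0 1 by apply: mx3_unit_neq0.
elim: n => [//|n IH]; rewrite iterS IH /ad_right !mx3_unitM //=; exact: subr0.
Qed.

Lemma lie_word_value d i j : (i < 3)%N -> (j < 3)%N -> i != j ->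
  lie_word (fun k => E (k %/ 3) (k %% 3)) d i j = E i j.
Proof.
elim: d i j => [|d IH] i j i3 j3 ij /=.
  by rewrite mulnC divnMDl // modnMDl divn_small // modn_small // addn0.
have [k3 ik kj] : [/\ (3 - i - j < 3)%N, i != (3 - i - j)%N & (3 - i - j)%N != j].
  by case: i j i3 j3 ij => [|[|[|]]] // [|[|[|]]].
by rewrite !IH // !mx3_unitM // eqxx eq_sym (negbTE ij) subr0.
Qed.

(** The two commutators are p - r and p + t - r, and their powers change at most the sign of r.
    Hence X Y - Y X = t, whose commutator with X is -t. *)
Lemma engel_nil_word_value q : (0 < q)%N ->
  engel_nil_word q (E 0 1) (E 1 0) (E 0 1) (E 1 0 + E 1 2) <> 0.
Proof.
case: q => // q _; pose p := E 0 0; pose r := E 1 1; pose t := E 0 2.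
have a0 : E 0 1 * E 1 0 - E 1 0 * E 0 1 = p - r by rewrite !mx3_unitM.
have b0 : E 0 1 * (E 1 0 + E 1 2) - (E 1 0 + E 1 2) * E 0 1 = p + t - r.
  by rewrite mulrDr mulrDl !mx3_unitM //= addr0.
have pp : p * p = p by rewrite mx3_unitM.
have pr : p * r = 0 by rewrite mx3_unitM.
have pt : p * t = t by rewrite mx3_unitM.
have rp : r * p = 0 by rewrite mx3_unitM.
have rr : r * r = r by rewrite mx3_unitM.
have rt : r * t = 0 by rewrite mx3_unitM.
have tp : t * p = 0 by rewrite mx3_unitM.
have tr : t * r = 0 by rewrite mx3_unitM.
have tt0 : t * t = 0 by rewrite mx3_unitM.
have nzt : t <> 0 by apply: mx3_unit_neq0.
rewrite /engel_nil_word a0 b0; clearbody p r t.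
have aX : (p - r) ^+ q.+1 = p + r \/ (p - r) ^+ q.+1 = p - r.
  elim: q => [|q IH]; first by rewrite expr1; right.
  by rewrite exprS; case: IH => ->; [right|left]; nc (tt, pp, pr, rp, rr).
have bX : (p + t - r) ^+ q.+1 = p + t + r \/ (p + t - r) ^+ q.+1 = p + t - r.
  elim: q {aX} => [|q IH]; first by rewrite expr1; right.
  by rewrite exprS; case: IH => ->; [right|left]; nc (tt, pp, pr, pt, rp, rr, rt, tp, tr, tt0).
move=> e; apply: nzt; apply: oppr_inj; rewrite oppr0 -[RHS]e.
by case: aX => ->; case: bX => ->; nc (tt, pp, pr, pt, rp, rr, rt, tp, tr, tt0).
Qed.

(** y = E 0 2 and z = - E 2 0, so y z - z y = E 2 2 - E 0 0 is not nilpotent. *)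
Lemma sq_comm_word_value k :
  let y := sq_comm_word (E 0 1) (E 1 0) (E 0 2) in
  let z := sq_comm_word (E 0 1) (E 1 0) (E 2 0) in (y * z - z * y) ^+ k <> 0.
Proof.
have y2 : (E 0 1 * E 1 0 - E 1 0 * E 0 1) ^+ 2 = E 0 0 + E 1 1.
  by rewrite !mx3_unitM //= expr2 mulrBl !mulrBr !mx3_unitM //= subr0 sub0r opprK.
have yE : sq_comm_word (E 0 1) (E 1 0) (E 0 2) = E 0 2.
  by rewrite /sq_comm_word y2 mulrDl mulrDr !mx3_unitM //= !addr0 subr0.
have zE : sq_comm_word (E 0 1) (E 1 0) (E 2 0) = - E 2 0.
  by rewrite /sq_comm_word y2 mulrDl mulrDr !mx3_unitM //= !addr0 sub0r.
rewrite yE zE /= mulrN mulNr opprK !mx3_unitM //= addrC => yz.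
have e k' : (E 2 2 - E 0 0) ^+ k' * E 2 2 = E 2 2.
  elim: k' => [|k' IH]; first by rewrite expr0 mul1r.
  by rewrite exprS -mulrA IH mulrBl !mx3_unitM //= subr0.
by apply: (@mx3_unit_neq0 2 2); rewrite -(e k) yz mul0r.
Qed.

End MatrixValues.

(** * Groups of units *)

Section UnitGroup.
Variable A : unitRingType.

Lemma inverse_pair_units (x x' : A) : inverse_pair x x' ->
  exists u : units A, units_val u = x /\ units_val (u^-1)%g = x'.
Proof.
move=> [xx' x'x]; have ux : x \is a GRing.unit by apply/unitrP; exists x'.
exists (Units ux); split=> //=; apply: (mulrI ux); by rewrite divrr // xx'.
Qed.

Lemma units_valR (x y : units A) : units_val [~ x, y]%g =
  units_val (x^-1)%g * units_val (y^-1)%g * units_val x * units_val y.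
Proof.
by rewrite -[RHS]/(units_val (x^-1 * y^-1 * x * y)%g) commgEl conjgE !mulgA.
Qed.

Lemma derived_pair_units m (x x' : A) : derived_pair (@inverse_pair A) m x x' ->
  exists u : units A, [/\ units_val u = x, units_val (u^-1)%g = x' & derived_series m u].
Proof.
elim=> {m x x'} [x x' /inverse_pair_units[u [ux ux']]|m|
  m _ _ _ _ _ [u [<- <- Du]] _ [w [<- <- Dw]]|m _ _ _ [u [<- <- Du]]|
  m _ _ _ _ _ [u [<- <- Du]] _ [w [<- <- Dw]]].
- by exists u.
- exists 1%g; rewrite invg1; split=> //; case: m => //= m; exact: generated_1.
- exists (u * w)%g; rewrite invMg; split=> //.
  by case: m Du Dw => //= m; apply: generated_M.
- exists (u^-1)%g; rewrite invgK; split=> //.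
  by case: m Du => //= m; apply: generated_V.
exists [~ u, w]%g; rewrite invgR !units_valR; split=> //.
by apply: generated_in; exists u, w.
Qed.

Lemma solvable_units d : (forall x : units A, derived_series d x -> x = 1%g) ->
  forall x x' : A, derived_pair (@inverse_pair A) d x x' -> x = 1.
Proof. by move=> sol x x' /derived_pair_units[u [<- _ /sol ->]]. Qed.

Lemma engel_law_units n :
  (forall x y : units A, iter n (fun z => [~ z, y]%g) x = 1%g) -> engel_law A n.
Proof.
move=> eng _ _ _ _ /inverse_pair_units[u [<- <-]] /inverse_pair_units[w [<- <-]].
suff -> : iter n (comm_pair (units_val w) (units_val (w^-1)%g)) (units_val u, units_val (u^-1)%g) =
    (units_val (iter n (fun z => [~ z, w]%g) u), units_val ((iter n (fun z => [~ z, w]%g) u)^-1)%g).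
  by rewrite eng.
elim: n {eng} => [//|n IH]; rewrite !iterS IH /comm_pair.
by rewrite invgR !units_valR.
Qed.

End UnitGroup.

Theorem corollary2p3 (F : fieldType) (A : unitAlgType F) :
  algebraic_algebra A ->
  solvable_group (units A) \/ bounded_engel (units A) ->
  satisfies_PI A.
Proof.
move=> algA law; pose X := nc_var F.
have [infF|finF] := EM (infinite_field F).
  case: law => [[d /solvable_units sol]|[n _ /engel_law_units eng]].
    apply: (@satisfies_PI_of_matrix F A (lie_word X d 0 1)
      (fun k => mx3_unit F (k %/ 3) (k %% 3))) => [|v]; rewrite rmorph_lie_word.
      rewrite (_ : (fun k => _) = fun k => mx3_unit F (k %/ 3) (k %% 3)).
        by rewrite lie_word_value //; apply: mx3_unit_neq0.
      by apply/funext => k; apply: eval_nc_var.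
    exact: infinite_solvable_identity sol.
  apply: (@satisfies_PI_of_matrix F A (iter n (ad_right (X 1%N)) (X 0%N))
    (fun k => mx3_unit F k 1)) => [|v]; rewrite rmorph_iter_ad_right /X /= !eval_nc_var.
    exact: ad_right_value.
  exact: infinite_engel_identity eng.
have [s sF] := not_infinite_field finF.
have perA := finite_field_periodic sF algA.
have [p prp pF] := finite_field_pchar sF.
have pA : p%:R = 0 :> A by rewrite -(rmorph_nat (in_alg A)) pF rmorph0.
case: law => [[d /solvable_units sol]|[n _ /engel_law_units eng]].
  have [k idk] := finite_solvable_identity prp pA perA sol.
  have valE (B : algType F) (v : nat -> B) :
      eval_nc v (solvable_nil_word k X) = solvable_nil_word k v.
    by rewrite rmorph_solvable_nil_word (_ : (fun i => _) = v) //; apply/funext => i; apply: eval_nc_var.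
  pose w i := nth 0 [:: mx3_unit F 0 1; mx3_unit F 1 0; mx3_unit F 0 2;
    mx3_unit F 0 1; mx3_unit F 1 0; mx3_unit F 2 0] i.
  apply: (@satisfies_PI_of_matrix F A (solvable_nil_word k X) w) => [|v]; rewrite valE.
    exact: sq_comm_word_value.
  exact: idk.
set q := (p ^ n.+1)%N.
pose f := engel_nil_word q (X 0%N) (X 1%N) (X 2%N) (X 3%N).
have valE (B : algType F) (v : nat -> B) :
    eval_nc v f = engel_nil_word q (v 0%N) (v 1%N) (v 2%N) (v 3%N).
  by rewrite rmorph_engel_nil_word; congr (engel_nil_word q _ _ _ _); apply: eval_nc_var.
pose w i := nth 0 [:: mx3_unit F 0 1; mx3_unit F 1 0; mx3_unit F 0 1;
  mx3_unit F 1 0 + mx3_unit F 1 2] i.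
apply: (@satisfies_PI_of_matrix F A f w) => [|v]; rewrite valE.
  by apply: engel_nil_word_value; rewrite expn_gt0 prime_gt0.
rewrite /engel_nil_word (finite_engel_identity prp pA perA _ _ _ _ eng); exact: subrr.
Qed.
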